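(* The flow in $\mathbb H^{n+1}$ defined by $$\frac{d}{dt}\sigma_t=\Big(\frac1n\sum_{k=1}^n\mathrm{arctanh}(\lambda_{k;t})\Big)\nu_t$$ on hypersurfaces of small principal curvatures induces in $\mathbb G_{n+1}$ the mean curvature flow up to a tangent factor, namely, if $\sigma_t$ evolves by this flow and $G_t$ is the Gauss map of $\sigma_t$, then $$\frac{d}{dt}G_t=\overline{\mathrm H}_t+B_t(\mathbb J(\overline{\mathrm H}_t)).$$
   Context: Here $\sigma\colon M\times(-\varepsilon,\varepsilon)\to\mathbb H^{n+1}$ is smooth, $M$ is an oriented $n$-manifold, and each $\sigma_t=\sigma(\cdot,t)$ is an immersion with small principal curvatures; $\nu_t$ is the unit normal field of $\sigma_t$ compatible with the orientations, $B_t$ its shape operator, $d\sigma_t(B_t(W))=-D_W\nu_t$ ($D$ the Levi-Civita connection of $\mathbb H^{n+1}$), and $\lambda_{1;t},\dots,\lambda_{n;t}$ are the principal curvatures (eigenvalues of $B_t$), which lie in $(-1,1)$ (small principal curvatures). $\mathbb H^{n+1}=\{x\in\mathbb R^{n+1,1}\mid\langle x,x\rangle=-1,\ x_{n+2}>0\}$ with $\langle x,y\rangle=\sum_{i\le n+1}x_iy_i-x_{n+2}y_{n+2}$; $T^1\mathbb H^{n+1}=\{(x,v)\mid x\in\mathbb H^{n+1},\ \langle x,v\rangle=0,\ \langle v,v\rangle=1\}$. $\mathbb G_{n+1}$ is the $2n$-manifold of oriented maximal unparametrized geodesics of $\mathbb H^{n+1}$, and $\mathrm p\colon T^1\mathbb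 H^{n+1}\to\mathbb G_{n+1}$ sends $(x,v)$ to the oriented geodesic through $x$ tangent to $v$. For $w\in T_x\mathbb H^{n+1}$ with $\langle w,v\rangle=0$, let $w^{\mathcal H}=(w,0)$ and $w^{\mathcal V}=(0,w)$ in $T_{(x,v)}T^1\mathbb H^{n+1}$. $d\mathrm p$ restricts to an isomorphism from the span of such vectors onto $T_{\mathrm p(x,v)}\mathbb G_{n+1}$, and on $\mathbb G_{n+1}$ one (well) defines $\mathbf g(d\mathrm p(w_1^{\mathcal H}+u_1^{\mathcal V}),d\mathrm p(w_2^{\mathcal H}+u_2^{\mathcal V}))=\langle w_1,w_2\rangle-\langle u_1,u_2\rangle$ and $\mathbb J\,d\mathrm p(w^{\mathcal H}+u^{\mathcal V})=d\mathrm p(u^{\mathcal H}+w^{\mathcal V})$. The Gauss map is $G_t(p)=\mathrm p(\sigma_t(p),\nu_t(p))$; it is a Riemannian ($G_t^*\mathbf g$ positive definite) Lagrangian immersion, and $\mathbb J$ exchanges its tangent and normal bundles. $\overline{\mathrm H}_t=\frac1n\mathrm{tr}_{G_t^*\mathbf g}\overline{\mathrm{II}}_t$ is its mean curvature vector, with $\overline{\mathrm{II}}_t(V,W)=(\mathbb D_{dG_t(V)}dG_t(W))^\perp$, $\mathbb D$ the Levi-Civita connection of $\mathbf g$. Via $dG_t$, $B_t$ acts on vectors tangent to $G_t$: $B_t(\mathbb J(\overline{\mathrm H}_t))$ means $dG_t(B_t(W))$ where $dG_t(W)=\mathbb J(\overline{\mathrm H}_t)$. *)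

(* Defs.v *)
From HB Require Import structures.
From mathcomp Require Import all_boot all_order all_algebra.
From mathcomp Require Import all_classical all_reals all_analysis.
Set Implicit Arguments.
Unset Strict Implicit.
Unset Printing Implicit Defensive.
Import Order.TTheory GRing.Theory Num.Theory.
Import numFieldNormedType.Exports.
Local Open Scope classical_set_scope.
Local Open Scope ring_scope.

(* For finite-dimensional V this is the usual class C^k on an open set U:
   the induction runs over all directional derivatives. *)
Fixpoint Ck_on (R : realType) (V W : normedModType R) (k : nat)
    (U : set V) (f : V -> W) : Prop :=
  match k with
  | 0%N => forall x, U x -> {for x, continuous f}
  | k'.+1 => (forall x, U x -> differentiable f x) /\
             (forall v, Ck_on k' U (fun x => 'D_v f x))
  end.

Definition smooth_on (R : realType) (V W : normedModType R)
    (U : set V) (f : V -> W) : Prop := forall k, Ck_on k U f.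

(* cmap is meaningful on cdom only, and cinv on cmap @` cdom only. *)
Record chart (R : realType) (m : nat) (X : Type) := Chart {
  cdom : set X;
  cmap : X -> 'rV[R]_m;
  cinv : 'rV[R]_m -> X }.

Definition cimg (R : realType) m (X : Type) (c : chart R m X) : set 'rV[R]_m :=
  cmap c @` cdom c.

Definition topological_chart (R : realType) (m : nat) (M : topologicalType)
    (c : chart R m M) : Prop :=
  [/\ open (cdom c), open (cimg c),
      (forall p, cdom c p -> cinv c (cmap c p) = p),
      (forall p, cdom c p -> {for p, continuous (cmap c)}) &
      (forall y, cimg c y -> {for y, continuous (cinv c)})].

Definition oriented_compatible (R : realType) (m : nat) (M : Type)
    (c c' : chart R m M) : Prop :=
  let tau := cmap c' \o cinv c in
  let U := cmap c @` (cdom c `&` cdom c') in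
  smooth_on U tau /\ (forall y, U y -> 0 < \det ('J tau y)).

Record oriented_manifold (R : realType) (n : nat) := OrientedManifold {
  carrier :> topologicalType;
  atlas : set (chart R n carrier);
  manifold_hausdorff : hausdorff_space carrier;
  manifold_second_countable : @second_countable carrier;
  atlas_cover : forall p : carrier, exists2 c, atlas c & cdom c p;
  atlas_charts : forall c, atlas c -> topological_chart c;
  atlas_oriented :
    forall c c', atlas c -> atlas c' -> oriented_compatible c c' }.

(* A metric on a coordinate domain: gm y xi eta is the value at the point of
   coordinates y on the vectors of coordinates xi and eta. *)
Definition metric_on (R : realType) (m : nat) :=
  'rV[R]_m -> 'rV[R]_m -> 'rV[R]_m -> R.

Definition ebase (R : realType) (m : nat) (a : 'I_m) : 'rV[R]_m :=
  delta_mx 0 a.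

Definition gcoef (R : realType) (m : nat) (gm : metric_on R m)
    (a b : 'I_m) (y : 'rV[R]_m) : R := gm y (ebase R a) (ebase R b).

(* A connection is given in coordinates by its coefficients:
   D_(e_b) e_c = \sum_a Gam y a b c e_a. *)
Definition connection_on (R : realType) (m : nat) :=
  'rV[R]_m -> 'I_m -> 'I_m -> 'I_m -> R.

(* Torsion-free and compatible with the metric. *)
Definition levi_civita (R : realType) (m : nat) (U : set 'rV[R]_m)
    (gm : metric_on R m) (Gam : connection_on R m) : Prop :=
  forall y, U y ->
    (forall a b c, Gam y a b c = Gam y a c b) /\
    (forall a b c, 'D_(ebase R c) (gcoef gm a b) y =
       \sum_d (Gam y d c a * gcoef gm d b y + Gam y d c b * gcoef gm a d y)).

Definition christoffel (R : realType) (m : nat) (gm : metric_on R m)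
    : connection_on R m := fun y a b c =>
  2^-1 * \sum_d invmx (\matrix_(i, j) gcoef gm i j y) a d *
    ('D_(ebase R b) (gcoef gm d c) y + 'D_(ebase R c) (gcoef gm d b) y
     - 'D_(ebase R d) (gcoef gm b c) y).

(* levi_civita is satisfiable for every symmetric nondegenerate metric. *)
Lemma levi_civita_christoffel (R : realType) (m : nat) (U : set 'rV[R]_m)
    (gm : metric_on R m) :
  (forall y v w, gm y v w = gm y w v) ->
  (forall y, U y -> \matrix_(i, j) gcoef gm i j y \in unitmx) ->
  levi_civita U gm (christoffel gm).
Proof.
move=> gC gU y Uy.
have gcC a b : gcoef gm a b = gcoef gm b a by apply/funext => z; exact: gC.
split=> [a b c|a b c].
  rewrite /christoffel; congr (_ * _); apply: eq_bigr => d _.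
  by rewrite (gcC b c) [X in _ * (X - _)]addrC.
have lower a' b' : \sum_d christoffel gm y d c a' * gcoef gm d b' y =
    2^-1 * ('D_(ebase R c) (gcoef gm b' a') y +
            'D_(ebase R a') (gcoef gm b' c) y -
            'D_(ebase R b') (gcoef gm c a') y).
  set X := fun d => 'D_(ebase R c) (gcoef gm d a') y +
            'D_(ebase R a') (gcoef gm d c) y -
            'D_(ebase R d) (gcoef gm c a') y.
  set g := \matrix_(i, j) gcoef gm i j y.
  have gT : g^T = g by apply/matrixP => i j; rewrite !mxE gcC.
  have -> : \sum_d christoffel gm y d c a' * gcoef gm d b' y =
     2^-1 * \sum_e (\sum_d g b' d * invmx g d e) * X e.
    under eq_bigr do rewrite /christoffel -mulrA mulr_suml.
    rewrite -mulr_sumr exchange_big /=; congr (_ * _).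
    apply: eq_bigr => e _; rewrite mulr_suml; apply: eq_bigr => d _.
    rewrite -/(X e) (gcC d b') [g b' d]mxE mulrAC; congr (_ * _).
    by rewrite mulrC.
  have E e : \sum_d g b' d * invmx g d e = (b' == e)%:R.
    by have /matrixP/(_ b' e) := mulmxV (gU _ Uy); rewrite [LHS]mxE [RHS]mxE.
  congr (_ * _); rewrite (bigD1 b') //= E eqxx mul1r big1 ?addr0 // => e eb.
  by rewrite E eq_sym (negbTE eb) mul0r.
rewrite big_split /= lower.
under [X in _ + X]eq_bigr do rewrite (gcC a).
rewrite lower -mulrDr (gcC b a) (gcC c b) (gcC c a).
set x := 'D_(ebase R c) _ _; set z := 'D_(ebase R a) _ _.
set w := 'D_(ebase R b) _ _.
have -> : x + z - w + (x + w - z) = 2 * x.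
  by rewrite addrACA [x + z + _]addrACA -opprD [z + w]addrC addrK
             mulr_natl mulr2n.
by rewrite mulKf // pnatr_eq0.
Qed.

Section Immersion.
Context (R : realType) (n m : nat) (gm : metric_on R m)
  (Gam : connection_on R m) (F : 'rV[R]_n -> 'rV[R]_m).
Implicit Types (u v w : 'rV[R]_n) (xi : 'rV[R]_m).

(* The covariant derivative of dF(w) along dF(v), for constant v and w. *)
Definition cov_deriv v w u : 'rV[R]_m :=
  'D_v (fun z => 'D_w F z) u +
  \row_a \sum_b \sum_c Gam (F u) a b c * 'D_v F u 0 b * 'D_w F u 0 c.

Definition first_form u : 'M[R]_n :=
  \matrix_(i, j) gm (F u) ('D_(ebase R i) F u) ('D_(ebase R j) F u).

(* The component of xi orthogonal to the image of dF. *)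
Definition normal_part u xi : 'rV[R]_m :=
  xi - \sum_i \sum_j (invmx (first_form u) i j *
                       gm (F u) xi ('D_(ebase R i) F u))
                     *: 'D_(ebase R j) F u.

Definition second_form v w u : 'rV[R]_m := normal_part u (cov_deriv v w u).

Definition mean_curvature u : 'rV[R]_m :=
  n%:R^-1 *: \sum_i \sum_j
    invmx (first_form u) i j *: second_form (ebase R i) (ebase R j) u.

End Immersion.

Definition mink (R : realType) (n : nat) (x y : 'rV[R]_(n.+2)) : R :=
  \sum_(i < n.+1) x 0 (lift ord_max i) * y 0 (lift ord_max i)
  - x 0 ord_max * y 0 ord_max.

Definition hyperbolic (R : realType) (n : nat) : set 'rV[R]_(n.+2) :=
  [set x | mink x x = -1 /\ 0 < x 0 ord_max].

Notation ambient2 R n := ('rV[R]_(n.+2) * 'rV[R]_(n.+2))%type.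

Definition T1H (R : realType) (n : nat) : set (ambient2 R n) :=
  [set z | [/\ hyperbolic z.1, mink z.1 z.2 = 0 & mink z.2 z.2 = 1]].

(* Tangent space of T1H at z: the linearised defining equations. *)
Definition tangent_T1H (R : realType) (n : nat) (z : ambient2 R n)
    : set (ambient2 R n) :=
  [set wu | [/\ mink wu.1 z.1 = 0, mink wu.1 z.2 + mink z.1 wu.2 = 0 &
               mink wu.2 z.2 = 0]].

(* The pairs (w, u), standing for w^H + u^V, with w and u in T_xH orthogonal
   to v, where z = (x, v). *)
Definition horver (R : realType) (n : nat) (z : ambient2 R n)
    : set (ambient2 R n) :=
  [set wu | [/\ mink wu.1 z.1 = 0, mink wu.1 z.2 = 0,
               mink wu.2 z.1 = 0 & mink wu.2 z.2 = 0]].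

Definition cosh (R : realType) (s : R) : R := (expR s + expR (- s)) / 2.
Definition sinh (R : realType) (s : R) : R := (expR s - expR (- s)) / 2.
Definition arctanh (R : realType) (s : R) : R := ln ((1 + s) / (1 - s)) / 2.

Definition geodesic_flow (R : realType) (n : nat) (s : R) (z : ambient2 R n)
    : ambient2 R n :=
  (cosh s *: z.1 + sinh s *: z.2, sinh s *: z.1 + cosh s *: z.2).

(* An oriented maximal unparametrized geodesic is represented by the set of
   its unit tangent vectors; gproj is the projection p sending (x, v) to the
   geodesic through x tangent to v. *)
Definition gproj (R : realType) (n : nat) (z : ambient2 R n)
    : set (ambient2 R n) :=
  range (fun s => geodesic_flow s z).

Definition geodesics (R : realType) (n : nat) : set (set (ambient2 R n)) :=
  @gproj R n @` @T1H R n.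

(* A smooth retraction of the open set retract_dom onto T1H: normalise x, then
   apply Gram-Schmidt to v. A function f on an open part of T1H is smooth iff
   f \o retract is smooth, and its differential is then the restriction of the
   differential of f \o retract. *)
Definition hnormalize (R : realType) (n : nat) (x : 'rV[R]_(n.+2))
    : 'rV[R]_(n.+2) := (Num.sqrt (- mink x x))^-1 *: x.

(* Orthogonal projection onto T_xH, for x in H. *)
Definition tanproj (R : realType) (n : nat) (x v : 'rV[R]_(n.+2))
    : 'rV[R]_(n.+2) := v + mink v x *: x.

Definition retract_dom (R : realType) (n : nat) : set (ambient2 R n) :=
  [set z | [/\ mink z.1 z.1 < 0, 0 < z.1 0 ord_max &
     0 < mink (tanproj (hnormalize z.1) z.2) (tanproj (hnormalize z.1) z.2)]].

Definition retract (R : realType) (n : nat) (z : ambient2 R n) : ambient2 R n :=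
  let x := hnormalize z.1 in let v := tanproj x z.2 in
  (x, (Num.sqrt (mink v v))^-1 *: v).

Lemma retract_T1H (R : realType) (n : nat) (z : ambient2 R n) :
  T1H z -> retract_dom z /\ retract z = z.
Proof.
case: z => x v [/= [xx x0] xv vv].
have hx : hnormalize x = x by rewrite /hnormalize xx opprK sqrtr1 invr1 scale1r.
have tv : tanproj x v = v.
  suff : mink v x = 0 by rewrite /tanproj => ->; rewrite scale0r addr0.
  rewrite -xv /mink mulrC; congr (_ - _).
  by apply: eq_bigr => i _; rewrite mulrC.
split; first by split; rewrite //= ?xx ?hx ?tv ?vv ?ltrN10.
by rewrite /retract /= hx tv vv sqrtr1 invr1 scale1r.
Qed.

Section GeodesicCharts.
Context (R : realType) (n : nat) (phi : chart R (n + n) (set (ambient2 R n))).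
Implicit Types (z wu : ambient2 R n) (y xi eta : 'rV[R]_(n + n)).

(* d(phi \o p) at z in T1H, on tangent vectors of T1H. *)
Definition dproj z wu : 'rV[R]_(n + n) :=
  'D_wu (cmap phi \o @gproj R n \o @retract R n) z.

Definition tube : set (ambient2 R n) :=
  @retract_dom R n `&` [set z | cdom phi (gproj (retract z))].

(* The charts of the unique smooth structure on the space of geodesics for
   which p is a smooth submersion. *)
Definition geodesic_chart : Prop :=
  [/\ cdom phi `<=` @geodesics R n,
      open tube /\ open (cimg phi),
      (forall l, cdom phi l -> cinv phi (cmap phi l) = l),
      smooth_on tube (cmap phi \o @gproj R n \o @retract R n) &
      (forall z, T1H z -> cdom phi (gproj z) ->
         forall xi, exists2 wu, tangent_T1H z wu & dproj z wu = xi)].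

(* A unit tangent vector of the geodesic of coordinates y; the metric and the
   structure J below do not depend on the choice. *)
Definition grep y : ambient2 R n := xget 0 (cinv phi y).

(* The (w, u) at z with dp (w^H + u^V) = xi. *)
Definition hvlift z xi : ambient2 R n :=
  xget 0 [set wu | horver z wu /\ dproj z wu = xi].

Definition gmetric : metric_on R (n + n) := fun y xi eta =>
  let wu1 := hvlift (grep y) xi in let wu2 := hvlift (grep y) eta in
  mink wu1.1 wu2.1 - mink wu1.2 wu2.2.

Definition gJ y xi : 'rV[R]_(n + n) :=
  let wu := hvlift (grep y) xi in dproj (grep y) (wu.2, wu.1).

End GeodesicCharts.

Section Hypersurface.
Context (R : realType) (n : nat) (M : oriented_manifold R n).
Implicit Types (c : chart R n M) (p : M) (t : R) (W : 'rV[R]_n).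
Implicit Types (sigma nu : M -> R -> 'rV[R]_(n.+2)).

Definition smooth_family (eps : R) sigma : Prop :=
  (forall p t, - eps < t < eps -> hyperbolic (sigma p t)) /\
  (forall c, atlas c ->
     smooth_on [set ut : 'rV[R]_n * R^o | cimg c ut.1 /\ - eps < ut.2 < eps]
       (fun ut : 'rV[R]_n * R^o => sigma (cinv c ut.1) ut.2)).

(* Derivative at p of a map f from M, on the vector of coordinates W in c. *)
Definition mderiv (m : nat) c (f : M -> 'rV[R]_m) p W : 'rV[R]_m :=
  'D_W (f \o cinv c) (cmap c p).

Definition immersion_at c (f : M -> 'rV[R]_(n.+2)) p : Prop :=
  injective (mderiv c f p).

(* o selects one of the two orientations of H: a basis (e_i) of T_xH is
   positive iff (-1)^o det (e_1, ..., e_(n+1), x) > 0. The rows below are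
   an even permutation of (dsigma e_1, ..., dsigma e_n, nu, sigma). *)
Definition unit_normal_at (o : bool) c (f N : M -> 'rV[R]_(n.+2)) p : Prop :=
  [/\ mink (f p) (N p) = 0, mink (N p) (N p) = 1,
      (forall W, mink (mderiv c f p W) (N p) = 0) &
      0 < (-1) ^+ o * \det (col_mx (col_mx (N p) (f p))
                             (\matrix_(i < n) mderiv c f p (ebase R i)))].

(* Levi-Civita connection of H along f: D_W N is the tangential part of the
   derivative of N in the ambient vector space. *)
Definition hyp_deriv c (f N : M -> 'rV[R]_(n.+2)) p W : 'rV[R]_(n.+2) :=
  tanproj (f p) (mderiv c N p W).

(* B is the matrix, acting on row vectors, of the shape operator. *)
Definition shape_operator_at c (f N : M -> 'rV[R]_(n.+2)) p (B : 'M[R]_n)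
    : Prop :=
  forall W, mderiv c f p (W *m B) = - hyp_deriv c f N p W.

Definition gauss_map sigma nu p t : set (ambient2 R n) :=
  gproj (sigma p t, nu p t).

Definition gauss_coord sigma nu c (phi : chart R (n + n) (set (ambient2 R n))) t
    : 'rV[R]_n -> 'rV[R]_(n + n) :=
  fun u => cmap phi (gauss_map sigma nu (cinv c u) t).

End Hypersurface.

(* Main.v *)
Require Import Defs.
From HB Require Import structures.
From mathcomp Require Import all_boot all_order all_algebra.
From mathcomp Require Import all_classical all_reals all_analysis.
From mathcomp Require Import ring lra.
Set Implicit Arguments.
Unset Strict Implicit.
Unset Printing Implicit Defensive.
Import Order.TTheory GRing.Theory Num.Theory.
Import numFieldNormedType.Exports.
Local Open Scope classical_set_scope.
Local Open Scope ring_scope.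

(** On pairs of vectors of Minkowski space put the flat form
    kform a b = <a.1, b.1> - <a.2, b.2>.  At (x, v) the projection p kills the
    flow direction (v, x), and on the horizontal space, the pairs of vectors
    orthogonal to x and v, it carries kform to the metric of the space of
    geodesics and the exchange of the two components to J
    (gmetric_dproj, gJ_dproj).  The choices made in the definition of this
    metric are harmless because the geodesic flow preserves all these data.

    This makes the Levi-Civita connection computable.  The second covariant
    derivative of the coordinate map P of p, seen as a map on flat space, is
    symmetric; its product with dP of a third argument is skew in the last
    two arguments on horizontal vectors, because the pull-back of the metric
    by P differs from kform by terms that vanish to second order there.  A
    tensor symmetric in one pair of arguments and skew in another is zero
    (cov_hessian_horver).  So if the derivative of zeta into T^1H is
    horizontal, the covariant derivatives of G = P o zeta are the images under
    dP of the ordinary second derivatives of zeta (cov_deriv_G).  To speak of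
    the derivatives of the metric one needs the metric to be differentiable:
    its inverse matrix is the push-forward by dP of the inverse of kform,
    evaluated along a local section of P (gcoef_diff).

    Apply this to zeta = (sigma, nu), for which
    d zeta(W) = (d sigma(W), - d sigma(BW)).  With I the first form of sigma,
    the metric induced by G is I - B I B^T, that is, (1 - B^2) I, and the
    normal space of G is the J-image of its tangent space.  Hence the mean
    curvature is determined by the numbers
    C_ijk = <sigma_ij, nu_k> - <nu_ij, sigma_k>, which by the Codazzi equation
    are symmetric in all three indices.  So their trace in i, j is a trace of
    something differentiated in the direction k, and Jacobi's formula for the
    derivative of determinants identifies it with n times the k-th derivative
    of f = (1/2n) ln (det (I + BI) / det (I - BI))
    (dspeed_trace).  As det (1 + B) and det (1 - B) are the products of the
    1 + lambda_k and of the 1 - lambda_k, f is the speed of the flow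
    (sum_arctanh).  The result is H = J dG(W), where - W is the gradient
    of f for the metric of G (mean_curvature_tanlift).

    Finally sigma_t = f nu forces nu_t = f sigma - d sigma(grad_I f), and
    grad_I f = - (W - B^2 W), so that
    (sigma_t, nu_t) = f (nu, sigma) + (- d sigma(BW), d sigma(W))
                      + (d sigma(BW), - d sigma(B^2 W)).
    The first term is the flow direction, killed by dp; the second projects to
    J dG(W) = H and the third to dG(BW) (gauss_map_evolution). *)

(** * Directional derivatives *)

Section Calculus.
Context (R : realType).
Implicit Types U V W : normedModType R.

Lemma derive_comb V W (f : V -> W) x (a : R) v w : differentiable f x ->
  'D_(a *: v + w) f x = a *: 'D_v f x + 'D_w f x.
Proof. by move=> df; rewrite !deriveE// linearP. Qed.

Lemma derive_add V W (f : V -> W) x v w : differentiable f x ->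
  'D_(v + w) f x = 'D_v f x + 'D_w f x.
Proof. by move=> df; rewrite !deriveE// linearD. Qed.

Lemma derive_scale V W (f : V -> W) x (a : R) v : differentiable f x ->
  'D_(a *: v) f x = a *: 'D_v f x.
Proof. by move=> df; rewrite !deriveE// linearZ. Qed.

Lemma derive_lincomb V W (f : V -> W) x (I : Type) (r : seq I) (a : I -> R) v :
  differentiable f x ->
  'D_(\sum_(i <- r) a i *: v i) f x = \sum_(i <- r) a i *: 'D_(v i) f x.
Proof.
move=> df; rewrite deriveE// linear_sum; apply: eq_bigr => i _.
by rewrite linearZ deriveE.
Qed.

Lemma is_diff_derive V W (f : V -> W) x v : differentiable f x ->
  is_derive x v f ('D_v f x).
Proof. by move=> df; apply/derivableP/diff_derivable. Qed.

(** The inner map is only assumed to have a derivative in the direction v: the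
    statement reduces to the curve c through g a, for which this is the same as
    differentiability. *)
Lemma is_derive_chain U V W (f : V -> W) (g : U -> V) a v dg :
  differentiable f (g a) -> is_derive a v g dg ->
  is_derive a v (fun x => f (g x)) ('D_dg f (g a)).
Proof.
move=> df [gd gv]; pose c (h : R) := g (h *: v + a).
have /derivable1_diffP dc : derivable c 0 1 by exact: (derivable1P g a v).1 gd.
have c0 : c 0 = g a by rewrite /c scale0r add0r.
have dcv : 'd c 0 1 = dg.
  have E : (fun h : R => h^-1 *: ((c \o shift 0) (h *: 1) - c 0)) =
           (fun h : R => h^-1 *: ((g \o shift a) (h *: v) - g a)).
    by rewrite funeqE => h /=; rewrite addr0 c0 [_%:A]mulr1.
  by rewrite -gv -deriveE// /derive E.
have dfc : differentiable f (c 0) by rewrite c0.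
have dfg : differentiable (f \o c) 0 by exact: differentiable_comp.
have E : (fun h : R => h^-1 *: (f (g (h *: v + a)) - f (g a))) =
         (fun h : R => h^-1 *: ((f \o c \o shift 0) (h *: 1) - (f \o c) 0)).
  by rewrite funeqE => h /=; rewrite addr0 c0 [_%:A]mulr1.
split; first by rewrite /derivable E; apply: diff_derivable.
transitivity ('D_1 (f \o c) 0); first by rewrite /derive [X in lim (X @ _)]E.
by rewrite (deriveE _ dfg) diff_comp//= dcv c0 deriveE.
Qed.

Lemma is_derive_ext V W (f g : V -> W) a v d : f =1 g ->
  is_derive a v f d -> is_derive a v g d.
Proof. by move=> /funext ->. Qed.

Lemma is_derive_mx V m n (F : V -> 'M[R]_(m, n)) a v (dF : 'M[R]_(m, n)) :
  (forall i j, is_derive a v (fun x => F x i j) (dF i j)) -> is_derive a v F dF.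
Proof.
move=> H; have dF' : derivable F a v.
  by apply/derivable_mxP => i j; have [] := H i j.
split => //; rewrite derive_mx//; apply/matrixP => i j; rewrite mxE.
by have [] := H i j.
Qed.

Lemma is_derive_coord V m n (F : V -> 'M[R]_(m, n)) a v (dF : 'M[R]_(m, n)) i j :
  is_derive a v F dF -> is_derive a v (fun x => F x i j) (dF i j).
Proof.
move=> [dF' <-]; split; first by move/derivable_mxP : dF' => /(_ i j).
by rewrite derive_mx// mxE.
Qed.

Lemma derive_coord V m n (F : V -> 'M[R]_(m, n)) a v i j :
  derivable F a v -> 'D_v (fun x => F x i j) a = 'D_v F a i j.
Proof. by move=> dF; rewrite derive_mx// mxE. Qed.

Lemma differentiable_sumf V W (I : Type) (r : seq I) (h : I -> V -> W) x :
  (forall i, differentiable (h i) x) ->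
  differentiable (fun y => \sum_(i <- r) h i y) x.
Proof.
move=> H; elim: r => [|i r IH].
  by under eq_fun do rewrite big_nil; exact: differentiable_cst.
under eq_fun do rewrite big_cons.
exact: (differentiableD (H i) IH).
Qed.

Lemma differentiable_prodf V (I : Type) (r : seq I) (h : I -> V -> R) x :
  (forall i, differentiable (h i) x) ->
  differentiable (fun y => \prod_(i <- r) h i y) x.
Proof.
move=> H; elim: r => [|i r IH].
  by under eq_fun do rewrite big_nil; exact: differentiable_cst.
under eq_fun do rewrite big_cons.
exact: (differentiableM (H i) IH).
Qed.

Lemma is_derive_sumf V W (I : Type) (r : seq I) (h : I -> V -> W) x v dh :
  (forall i, is_derive x v (h i) (dh i)) ->
  is_derive x v (fun y => \sum_(i <- r) h i y) (\sum_(i <- r) dh i).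
Proof.
move=> H; elim: r => [|i r IH].
  rewrite big_nil; under eq_fun do rewrite big_nil; exact: is_derive_cst.
rewrite big_cons; under eq_fun do rewrite big_cons.
exact: (is_deriveD (H i) IH).
Qed.

Lemma is_derive_mul V (f g : V -> R) x v df dg :
  is_derive x v f df -> is_derive x v g dg ->
  is_derive x v (fun y => f y * g y) (df * g x + f x * dg).
Proof.
move=> hf hg; apply: is_derive_eq (is_deriveM hf hg) _.
by rewrite addrC /GRing.scale/= [g x * _]mulrC.
Qed.

Lemma is_derive_scalef V m n (f : V -> R) (g : V -> 'M[R]_(m, n)) x v df dg :
  is_derive x v f df -> is_derive x v g dg ->
  is_derive x v (fun y => f y *: g y) (df *: g x + f x *: dg).
Proof.
move=> hf hg; apply: is_derive_mx => i j; rewrite !mxE.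
under eq_fun do rewrite mxE.
exact: (is_derive_mul hf (is_derive_coord i j hg)).
Qed.

Lemma differentiable_mx V m n (F : V -> 'M[R]_(m, n)) x :
  (forall i j, differentiable (fun y => F y i j) x) -> differentiable F x.
Proof.
move=> H; have -> : F = fun y => \sum_i \sum_j F y i j *: delta_mx i j.
  by rewrite funeqE => y; rewrite -matrix_sum_delta.
apply: differentiable_sumf => i; apply: differentiable_sumf => j.
exact: differentiableZl.
Qed.

Lemma differentiable_entry V m n (F : V -> 'M[R]_(m, n)) x i j :
  differentiable F x -> differentiable (fun y => F y i j) x.
Proof.
move=> dF; apply: (@differentiable_comp _ _ _ _ F (fun M : 'M[R]_(m, n) => M i j)) => //.
exact: differentiable_coord.
Qed.

Lemma differentiable_det V n (F : V -> 'M[R]_n) x :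
  differentiable F x -> differentiable (fun y => \det (F y)) x.
Proof.
move=> dF; apply: differentiable_sumf => s.
apply: differentiableM; first exact: differentiable_cst.
by apply: differentiable_prodf => i; exact: differentiable_entry.
Qed.

(** Jacobi's formula: by Laplace expansion along a row, the determinant is affine
    in each entry, with the cofactor as slope. *)
Lemma derive_det n (A X : 'M[R]_n) : 'D_X (fun M => \det M) A = \tr (X *m \adj A).
Proof.
have dd : differentiable (fun M : 'M[R]_n => \det M) A.
  by apply: differentiable_det; exact: ex_diff.
rewrite {1}[X]matrix_sum_delta deriveE// linear_sum.
apply: eq_bigr => i _; rewrite linear_sum mxE; apply: eq_bigr => j _.
rewrite linearZ /= -deriveE//; congr (_ * _); rewrite mxE.
have E h : \det (h *: delta_mx i j + A) = \det A + h * cofactor A i j.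
  rewrite (expand_det_row _ i) (expand_det_row A i).
  have C k : cofactor (h *: delta_mx i j + A) i k = cofactor A i k.
    rewrite /cofactor; congr (_ * \det _); apply/matrixP => a b.
    rewrite !mxE [_ == i]eq_sym (negbTE (neq_lift _ _)) /= mulr0 add0r//.
  under eq_bigr => k _ do rewrite C !mxE eqxx /= mulrDl addrC.
  rewrite big_split /=; congr (_ + _); rewrite (bigD1 j)//= eqxx mulr1 big1 ?addr0// => k kj.
  by rewrite (negbTE kj) mulr0 mul0r.
apply/cvg_lim => //; apply: cvg_near_cst; near=> h => /=.
rewrite E addrC addKr /GRing.scale /= mulKf//.
by near: h; exact: nbhs_dnbhs_neq.
Unshelve. all: by end_near. Qed.

Lemma differentiable_scalef (V : normedModType R) m (f : V -> R) (g : V -> 'rV[R]_m) x :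
  differentiable f x -> differentiable g x -> differentiable (fun q => f q *: g q) x.
Proof.
move=> df dg; apply: differentiable_mx => i j; under eq_fun do rewrite mxE.
by apply: differentiableM => //; exact: differentiable_entry.
Qed.

Lemma near_compose (V W : normedModType R) (f : V -> W) x (Q : W -> Prop) :
  {for x, continuous f} -> (\forall q \near f x, Q q) -> \forall q \near x, Q (f q).
Proof. by move=> c; exact: c. Qed.

End Calculus.

(** * Symmetry of second derivatives *)

Section Schwarz.
Context (R : realType).
Implicit Types U V W : normedModType R.

Lemma diff_eps V W (f : V -> W) x (e : R) : differentiable f x -> 0 < e ->
  exists2 r : R, 0 < r &
    forall k, `|k| < r -> `|f (k + x) - f x - 'D_k f x| <= e * `|k|.
Proof.
move=> df e0; have /eqaddoP/(_ e e0) := diff_locally df.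
move=> /nbhs_ballP[r r0 H]; exists r => // k kr.
have := H k; rewrite -ball_normE /= sub0r normrN => /(_ kr).
by rewrite deriveE// /= opprD addrA.
Qed.

Lemma differentiable_eps V W (f : V -> W) x (L : {linear V -> W}) :
  continuous L ->
  (forall e : R, 0 < e -> \forall k \near (0 : V),
     `|f (k + x) - f x - L k| <= e * `|k|) ->
  differentiable f x /\ ('d f x = L :> (V -> W)).
Proof.
move=> Lc H; have E : f \o shift x = cst (f x) + L +o_ 0 id.
  apply/eqaddoP => e e0; apply: filterS (H e e0) => k.
  by rewrite -addrA -opprD.
have dL := diff_unique Lc E.
by split => //; apply/diff_locallyP; rewrite dL.
Qed.

Lemma near_eq_differentiable V W (f g : V -> W) x :
  (\forall y \near x, f y = g y) -> differentiable f x -> differentiable g x.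
Proof.
move=> fg df; apply: (differentiable_eps (diff_continuous df) _).1 => e e0.
have [r r0 H] := diff_eps df e0.
have [/= r1 r10 H1] : nbhs_ball x (fun y => f y = g y) by apply/nbhs_ballP.
apply/nbhs_ballP; exists (Num.min r r1) => /=; first by rewrite lt_min r0.
move=> k; rewrite -ball_normE /= sub0r normrN lt_min => /andP[kr kr1].
have B y : `|y| < r1 -> f (y + x) = g (y + x).
  by move=> yr; apply: H1; rewrite -ball_normE /= [y + x]addrC opprD addrA subrr sub0r normrN.
rewrite -B// -[in g x](add0r x) -B ?normr0// add0r -deriveE//.
exact: H.
Qed.

Lemma is_derive_line V (v y : V) (s : R) :
  is_derive s 1 (fun h : R => h *: v + y) v.
Proof.
have dk : differentiable (fun h : R => h *: v) s by exact: differentiableZl.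
have dv : is_derive s 1 (fun h : R => h *: v) v.
  by split; [exact: diff_derivable|rewrite deriveE// diffZl// diff_val scale1r].
have := is_deriveD dv (is_derive_cst y s 1).
by rewrite addr0.
Qed.

Let second_difference V (f : V -> R) x v w (h : R) : R :=
  f (h *: v + (h *: w + x)) - f (h *: v + x) - (f (h *: w + x) - f x).

(** The mean value theorem in the direction v turns the second difference into
    h times a difference of values of D_v f, and the first order expansion of
    D_v f at x estimates both of these. *)
Lemma second_difference_limit V (f : V -> R) x v w (e : R) :
  (\forall y \near x, differentiable f y) -> differentiable (fun y => 'D_v f y) x ->
  0 < e -> exists2 r : R, 0 < r & forall h, 0 < h -> h < r ->
    `|second_difference f x v w h - h ^+ 2 * 'D_w (fun y => 'D_v f y) x|
      <= e * h ^+ 2.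
Proof.
move=> /nbhs_ballP[r1 /= r10 H1] d2 e0.
(* M serves twice: for h < r / M the parallelogram spanned by h v and h w stays
   in the ball of radius r, and the two expansions with error e / M each add up to
   at most e; the summand 1 makes M positive. *)
pose M := 2 * `|v| + 2 * `|w| + 1.
have M0 : 0 < M by rewrite ltr_wpDl// addr_ge0// mulr_ge0.
have [r2 r20 H2] := diff_eps d2 (divr_gt0 e0 M0).
pose r := Num.min r1 r2.
have r0 : 0 < r by rewrite lt_min r10.
exists (r / M); first exact: divr_gt0.
move=> h h0 hr.
have hM : h * M < r by rewrite -ltr_pdivlMr.
have small (s : R) (a : R) : 0 <= s <= h -> 0 <= a <= 1 ->
   `|s *: v + (a * h) *: w| < r.
  move=> /andP[s0 sh] /andP[a0 a1]; apply: le_lt_trans hM.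
  apply: le_trans (ler_normD _ _) _.
  rewrite (normrZ s v) (normrZ (a * h) w) (ger0_norm s0) (ger0_norm (mulr_ge0 a0 (ltW h0))).
  rewrite /M !mulrDr mulr1; have := normr_ge0 v; have := normr_ge0 w.
  move: `|v| `|w| => nv nw nv0 nw0.
  have A1 : s * nv <= h * nv by exact: ler_wpM2r.
  have A2 : a * h * nw <= h * nw by rewrite ler_wpM2r// ler_piMl// ltW.
  have A4 : 0 <= h * nw by rewrite mulr_ge0// ltW.
  have A3 : 0 <= h * nv by rewrite mulr_ge0// ltW.
  by lra.
pose g (s : R) := f (s *: v + (h *: w + x)) - f (s *: v + x).
pose dg (s : R) := 'D_v f (s *: v + (h *: w + x)) - 'D_v f (s *: v + x).
have gd (s : R) : 0 <= s <= h -> is_derive s 1 g (dg s).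
  move=> sh.
  have L (y : V) : is_derive s 1 (fun s : R => s *: v + y) v.
    exact: is_derive_line.
  have B (a : R) : 0 <= a <= 1 ->
      differentiable f (s *: v + ((a * h) *: w + x)).
    move=> a01; apply: H1; rewrite -ball_normE /= addrA [_ + x]addrC opprD.
    rewrite addrA subrr add0r normrN; apply: lt_le_trans (small _ _ sh a01) _.
    by rewrite ge_min lexx.
  apply: is_deriveB; apply: is_derive_chain; try exact: L.
  - by have := B 1; rewrite mul1r; apply; rewrite lexx ler01.
  - by have := B 0; rewrite mul0r scale0r add0r; apply; rewrite lexx ler01.
have gc : {within `[0, h], continuous g}.
  apply: derivable_within_continuous => s.
  by rewrite in_itv /= => sh; have [] := gd _ sh.
have gd' (s : R) : s \in `]0, h[ -> is_derive s 1 g (dg s).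
  by rewrite in_itv /= => /andP[s0 sh]; apply: gd; rewrite !ltW.
have [s] := MVT h0 gd' gc.
rewrite in_itv /= subr0 => /andP[s0 sh] E.
have -> : second_difference f x v w h = dg s * h.
  by rewrite -E /g /second_difference scale0r !add0r.
have s01 : 0 <= s <= h by rewrite !ltW.
have K (a : R) : 0 <= a <= 1 ->
   `|'D_v f (s *: v + (a * h) *: w + x) - 'D_v f x
      - (s * 'D_v (fun y => 'D_v f y) x + a * h * 'D_w (fun y => 'D_v f y) x)|
     <= e / M * (h * (`|v| + `|w|)).
  move=> /[dup] a01 /andP[a0 a1]; set k := _ + _ *: w.
  have -> : s * 'D_v (fun y => 'D_v f y) x + a * h * 'D_w (fun y => 'D_v f y) x
     = 'D_k (fun y => 'D_v f y) x by rewrite /k derive_comb// derive_scale.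
  apply: le_trans (H2 k _) _.
    by apply: lt_le_trans (small _ _ s01 a01) _; rewrite ge_min lexx orbT.
  apply: ler_wpM2l; first by apply: divr_ge0; exact: ltW.
  rewrite /k; apply: le_trans (ler_normD _ _) _.
  rewrite (normrZ s v) (normrZ (a * h) w) (gtr0_norm s0) (ger0_norm (mulr_ge0 a0 (ltW h0))) mulrDr.
  apply: lerD; first by apply: ler_wpM2r => //; exact: ltW.
  by rewrite ler_wpM2r// ler_piMl// ltW.
have K1 : _ := K 1 _; have K0 : _ := K 0 _.
have {}K1 := K1 (introT andP (conj ler01 (lexx 1))).
have {}K0 := K0 (introT andP (conj (lexx 0) ler01)).
rewrite !mul1r -[_ + x]addrA in K1; rewrite !mul0r scale0r !addr0 in K0.
set A := 'D_w _ x in K1 *; set D := 'D_v (fun y => 'D_v f y) x in K1 K0.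
rewrite /dg; set p := 'D_v f _ in K1 *; set q := 'D_v f _ in K0 *.
set c := 'D_v f x in K1 K0.
have -> : (p - q) * h - h ^+ 2 * A =
    h * ((p - c - (s * D + h * A)) - (q - c - s * D)) by ring.
rewrite normrM gtr0_norm// expr2 mulrCA ler_pM2l//.
apply: le_trans (ler_normB _ _) _; apply: le_trans (lerD K1 K0) _.
rewrite -!mulrDr.
have ->: e * h = e / M * (h * M) by field; rewrite gt_eqF.
rewrite ler_pM2l ?divr_gt0// ler_pM2l// /M.
by have := normr_ge0 v; have := normr_ge0 w; lra.
Qed.

(** Schwarz's theorem in Young's form: the second difference is symmetric in v and
    w, and divided by h^2 it approximates both mixed derivatives. *)
Lemma derive_swap_real V (f : V -> R) x v w :
  (\forall y \near x, differentiable f y) ->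
  differentiable (fun y => 'D_v f y) x -> differentiable (fun y => 'D_w f y) x ->
  'D_v (fun y => 'D_w f y) x = 'D_w (fun y => 'D_v f y) x.
Proof.
move=> nf dv dw; apply/eqP; rewrite -subr_eq0 -normr_le0.
apply/ler_addgt0Pr => e e0; rewrite add0r.
have e20 : 0 < e / 2 by rewrite divr_gt0.
have [r1 r10 H1] := second_difference_limit w nf dv e20.
have [r2 r20 H2] := second_difference_limit v nf dw e20.
pose h := Num.min r1 r2 / 2.
have m0 : 0 < Num.min r1 r2 by rewrite lt_min r10.
have h0 : 0 < h by rewrite divr_gt0.
have hm : h < Num.min r1 r2 by rewrite /h ltr_pdivrMr// mulr_natr mulr2n ltrDl.
have := H1 h h0; have := H2 h h0; move: (hm); rewrite lt_min => /andP[h1 h2].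
move=> /(_ h2) K2 /(_ h1) K1.
have S : second_difference f x w v h = second_difference f x v w h.
  rewrite /second_difference [h *: w + (_ + _)]addrCA; ring.
rewrite S in K2; rewrite -(ler_pM2l (exprn_gt0 2 h0)).
rewrite -[X in X * _]gtr0_norm ?exprn_gt0// -normrM.
set A := 'D_w _ x in K1 *; set B := 'D_v _ x in K2 *.
set D := second_difference _ _ _ _ _ in K1 K2.
have -> : h ^+ 2 * (B - A) = (D - h ^+ 2 * A) - (D - h ^+ 2 * B) by ring.
apply: le_trans (ler_normB _ _) _; apply: le_trans (lerD K1 K2) _.
by rewrite -mulrDl -splitr mulrC.
Qed.

Lemma derive_swap V m (F : V -> 'rV[R]_m) x v w :
  (\forall y \near x, differentiable F y) ->
  differentiable (fun y => 'D_v F y) x -> differentiable (fun y => 'D_w F y) x ->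
  'D_v (fun y => 'D_w F y) x = 'D_w (fun y => 'D_v F y) x.
Proof.
move=> nf dv dw; apply/rowP => i.
have C u : {near x, (fun y => 'D_u (fun z => F z 0 i) y) =1 (fun y => 'D_u F y 0 i)}.
  near=> y; apply: derive_coord; apply: diff_derivable; near: y; exact: nf.
transitivity ('D_v (fun y => 'D_w (fun z => F z 0 i) y) x).
  rewrite (near_eq_derive _ (C w)); apply/esym/derive_coord.
  exact: diff_derivable.
transitivity ('D_w (fun y => 'D_v (fun z => F z 0 i) y) x); last first.
  rewrite (near_eq_derive _ (C v)); apply/derive_coord.
  exact: diff_derivable.
apply: derive_swap_real.
- by apply: filterS nf => y; exact: differentiable_entry.
- apply: near_eq_differentiable (differentiable_entry 0 i dv).
  by apply: filterS (C v) => y /= ->.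
- apply: near_eq_differentiable (differentiable_entry 0 i dw).
  by apply: filterS (C w) => y /= ->.
Unshelve. all: by end_near. Qed.

End Schwarz.

(** * Local right inverses *)

(** Row vectors form a complete space, in which contractions have fixed points. *)
HB.instance Definition _ (R : realType) (m n : nat) :=
  Uniform_isComplete.Build 'M[R]_(m, n) cauchy_cvg.

Section LocalInverse.
Context (R : realType).

Lemma coord_le_norm m (x : 'rV[R]_m) i : `|x 0 i| <= `|x|.
Proof.
rewrite [leRHS]/Num.Def.normr/= mx_normrE.
exact: (le_bigmax _ (fun ij : 'I_1 * 'I_m => `|x ij.1 ij.2|) (0, i)).
Qed.

Lemma norm_le_coord m (x : 'rV[R]_m) (c : R) : 0 <= c ->
  (forall i, `|x 0 i| <= c) -> `|x| <= c.
Proof.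
move=> c0 H; rewrite [leLHS]/Num.Def.normr/= mx_normrE bigmax_le// => -[i j] _.
by rewrite ord1.
Qed.

Lemma row_sum_ebase m (x : 'rV[R]_m) : x = \sum_j x 0 j *: ebase R j.
Proof.
by rewrite {1}[x]matrix_sum_delta big_ord1.
Qed.

Lemma derive_ebase m (W : normedModType R) (f : 'rV[R]_m -> W) x v :
  differentiable f x ->
  'D_v f x = \sum_j v 0 j *: 'D_(ebase R j) f x.
Proof. by move=> df; rewrite -derive_lincomb// -row_sum_ebase. Qed.

(** Mean value inequality, coordinate by coordinate. *)
Lemma small_derivative_lipschitz m (K : 'rV[R]_m -> 'rV[R]_m) (y0 : 'rV[R]_m) :
  (\forall y \near y0, differentiable K y) ->
  (forall v, {for y0, continuous (fun y => 'D_v K y)}) ->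
  (forall v, 'D_v K y0 = 0) ->
  exists2 r : R, 0 < r & forall y y', `|y - y0| < r -> `|y' - y0| < r ->
    `|K y - K y'| <= 2^-1 * `|y - y'|.
Proof.
move=> dK cK K0.
(* With this bound on each partial derivative their m-fold sum is below 1/2. *)
pose e : R := (2 * m.+1%:R)^-1.
have e0 : 0 < e by rewrite invr_gt0 mulr_gt0// ltr0n.
have : \forall y \near y0, differentiable K y /\
    forall j i, `|'D_(ebase R j) K y 0 i| <= e.
  have N j : \forall y \near y0, forall i, `|'D_(ebase R j) K y 0 i| <= e.
    near=> y => i; apply: le_trans (coord_le_norm _ _) _.
    rewrite -[X in `|X|]subr0 -(K0 (ebase R j)) distrC ltW//.
    by near: y; move: (cK (ebase R j)) => /cvgrPdist_lt /(_ e e0).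
  have {}N : \forall y \near y0, forall j i, `|'D_(ebase R j) K y 0 i| <= e.
    exact: (@filter_forall _ _ _ (nbhs y0) _ N).
  near=> y; split; first by near: y.
  by near: y.
move=> /nbhs_ballP[r r0 H]; exists r => // y y' yr yr'.
have {}H (s : R) : 0 <= s <= 1 -> differentiable K (s *: (y - y') + y') /\
    forall j i, `|'D_(ebase R j) K (s *: (y - y') + y') 0 i| <= e.
  move=> /andP[s0 s1]; apply: H; rewrite -ball_normE /= distrC.
  have -> : s *: (y - y') + y' - y0 = s *: (y - y0) + (1 - s) *: (y' - y0).
    apply/rowP => i; rewrite !mxE; ring.
  apply: le_lt_trans (ler_normD _ _) _.
  rewrite !normrZ (ger0_norm s0) ger0_norm ?subr_ge0//.
  have [->|sn0] := eqVneq s 0; first by rewrite mul0r add0r subr0 mul1r.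
  have sp : 0 < s by rewrite lt_neqAle eq_sym sn0.
  have A : s * `|y - y0| < s * r by rewrite ltr_pM2l.
  have B : (1 - s) * `|y' - y0| <= (1 - s) * r by rewrite ler_wpM2l ?subr_ge0// ltW.
  by lra.
apply: norm_le_coord => [|i]; first by rewrite mulr_ge0.
pose g (s : R) := K (s *: (y - y') + y') 0 i.
pose dg (s : R) := 'D_(y - y') K (s *: (y - y') + y') 0 i.
have gd (s : R) : 0 <= s <= 1 -> is_derive s 1 g (dg s).
  move=> s01; apply: (@is_derive_coord _ _ _ _ (fun s : R => K (s *: (y - y') + y'))).
  by apply: is_derive_chain; [exact: (H _ s01).1|exact: is_derive_line].
have gc : {within `[0, 1], continuous g}.
  apply: derivable_within_continuous => s.
  by rewrite in_itv /= => sh; have [] := gd _ sh.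
have gd' (s : R) : s \in `]0, 1[ -> is_derive s 1 g (dg s).
  by rewrite in_itv /= => /andP[s0 sh]; apply: gd; rewrite !ltW.
have [s] := MVT ltr01 gd' gc.
rewrite in_itv /= subr0 mulr1 => /andP[s0 s1] E.
have [d b] := H s (introT andP (conj (ltW s0) (ltW s1))).
have -> : (K y - K y') 0 i = dg s.
  by rewrite -E /g scale1r scale0r subrK add0r !mxE.
rewrite /dg derive_ebase// summxE.
apply: le_trans (ler_norm_sum _ _ _) _.
apply: (@le_trans _ _ (\sum_(j < m) `|y - y'| * e)).
  apply: ler_sum => j _; rewrite mxE normrM; apply: ler_pM => //.
  exact: coord_le_norm.
rewrite sumr_const card_ord -mulrnAr mulrC; apply: ler_wpM2r => //.
rewrite /e invfM -mulrnAr ler_piMr// -[_ *+ m]mulr_natl ler_pdivrMr ?ltr0n//.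
by rewrite mul1r ler_nat.
Unshelve. all: by end_near. Qed.

(** A solution of Q x = y is a fixed point of x |-> y + (x - Q x), which is a
    contraction since the derivative of x - Q x vanishes at y0.  The solution
    found satisfies |Y y - y0| <= 2 |y - y0|, whence the derivative of Y at y0. *)
Lemma local_right_inverse m (Q : 'rV[R]_m -> 'rV[R]_m) (y0 : 'rV[R]_m) :
  (\forall y \near y0, differentiable Q y) ->
  (forall v, {for y0, continuous (fun y => 'D_v Q y)}) ->
  (forall v, 'D_v Q y0 = v) -> Q y0 = y0 ->
  exists Y : 'rV[R]_m -> 'rV[R]_m,
    [/\ Y y0 = y0, differentiable Y y0, (forall v, 'D_v Y y0 = v) &
        \forall y \near y0, Q (Y y) = y].
Proof.
move=> dQ cQ Q1 Qy0; pose K (y : 'rV[R]_m) : 'rV[R]_m := y - Q y.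
have did y : differentiable (id : 'rV[R]_m -> _) y by exact: ex_diff.
have dK : \forall y \near y0, differentiable K y.
  by apply: filterS dQ => y dy; exact: differentiableB.
have DK (v : 'rV[R]_m) : \forall y \near y0, v - 'D_v Q y = 'D_v K y.
  apply: filterS dQ => y dy; rewrite deriveB//; last exact: diff_derivable.
  by rewrite derive_id.
have K0 (v : 'rV[R]_m) : 'D_v K y0 = 0.
  by apply: etrans (esym (nbhs_singleton (DK v))) _; rewrite Q1 subrr.
have cK (v : 'rV[R]_m) : {for y0, continuous (fun y => 'D_v K y)}.
  have E : v - 'D_v Q y0 = 'D_v K y0 := nbhs_singleton (DK v).
  rewrite /prop_for /continuous_at K0.
  have -> : 0 = v - 'D_v Q y0 by rewrite Q1 subrr.
  have N : {near y0, (fun y => v - 'D_v Q y) =1 (fun y => 'D_v K y)} by exact: DK.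
  apply: cvg_trans (near_eq_cvg N) _.
  exact: (cvgB (cvg_cst v) (cQ v)).
have [r r0 Klip] := small_derivative_lipschitz dK cK K0.
have Ky0 : K y0 = 0 by rewrite /K Qy0 subrr.
pose U : set 'rV[R]_m := [set x | `|x - y0| <= r / 2].
have Ur x : U x -> `|x - y0| < r.
  by move=> Ux; apply: le_lt_trans Ux _; rewrite ltr_pdivrMr// mulr_natr mulr2n ltrDl.
have Uy0 : U y0 by rewrite /U /= subrr normr0 divr_ge0// ltW.
have clU : closed U.
  rewrite /U; apply: (@closed_comp _ _ (fun x : 'rV[R]_m => `|x - y0|) [set t | t <= r / 2]).
    move=> x _; exact: (cvg_norm (cvgB cvg_id (cvg_cst y0))).
  exact: closed_le.
(* The ball U of radius r / 2 is preserved: y - y0 contributes at most r / 4 and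
   the contraction with constant 1/2 at most another r / 4. *)
have E y : `|y - y0| < r / 4 -> exists2 x, U x & Q x = y.
  move=> yr; pose f x := y + K x.
  have fU : {homo f : x / U x >-> U x}.
    move=> x Ux; rewrite /U /f /= addrAC; apply: le_trans (ler_normD _ _) _.
    have := Klip x y0 (Ur _ Ux) (Ur _ Uy0); rewrite Ky0 subr0.
    move: Ux; rewrite /U /=; move: `|x - _| `|K x| `|y - _| yr => a b c; lra.
  have ctr : is_contraction (mkfun_fun fU).
    exists (2^-1%:nng)%R; split => /=; first by rewrite invf_lt1// ltr1n.
    move=> [a b] [/= Ua Ub]; rewrite /f opprD addrACA subrr add0r.
    exact: Klip (Ur _ Ua) (Ur _ Ub).
  have [x Ux xE] := banach_fixed_point ctr clU (ex_intro _ y0 Uy0).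
  have {}xE : x = y + (x - Q x) := xE.
  exists x => //; apply: (@addIr _ (x - Q x)).
  by rewrite -xE addrC subrK.
pose Y y := if pselect (exists2 x, U x & Q x = y) is left h then sval (cid2 h) else y0.
have YE y : `|y - y0| < r / 4 -> U (Y y) /\ Q (Y y) = y.
  by move=> /E h; rewrite /Y; case: pselect => // h'; case: cid2.
have Yb y : `|y - y0| < r / 4 -> `|Y y - y0| <= 2 * `|y - y0|.
  move=> yr; have [Uy Qy] := YE y yr.
  have := Klip _ _ (Ur _ Uy) (Ur _ Uy0); rewrite Ky0 subr0 {1}/K Qy => h.
  have : `|Y y - y0| <= `|Y y - y| + `|y - y0|.
    by rewrite -(subrKA y); exact: ler_normD.
  move: `|Y y - y0| `|Y y - y| `|y - y0| h => a b c; lra.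
have YY0 : Y y0 = y0.
  have : `|Y y0 - y0| <= 2 * `|y0 - y0| by apply: Yb; rewrite subrr normr0 divr_gt0.
  by rewrite subrr normr0 mulr0 normr_le0 subr_eq0 => /eqP.
have nr : \forall y \near y0, `|y - y0| < r / 4.
  apply/nbhs_ballP; exists (r / 4) => /=; first by rewrite divr_gt0.
  by move=> y; rewrite -ball_normE /= distrC.
exists Y; have [dY dYE] : differentiable Y y0 /\ 'd Y y0 = id :> (_ -> _).
  apply: (@differentiable_eps _ _ _ Y y0 idfun); first by move=> z; exact: cvg_id.
  move=> e e0.
  have dK0 := nbhs_singleton dK.
  have [s s0 Hs] := diff_eps dK0 (divr_gt0 e0 (ltr0n R 2)).
  pose d := Num.min (r / 4) (s / 2).
  apply/nbhs_ballP; exists d => /=; first by rewrite lt_min !divr_gt0.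
  move=> k; rewrite -ball_normE /= sub0r normrN lt_min => /andP[kr ks].
  have kr' : `|k + y0 - y0| < r / 4 by rewrite addrK.
  have [_ Qk] := YE _ kr'; have b := Yb _ kr'; rewrite addrK in b.
  have h : `|Y (k + y0) - y0| < s by move: b ks; lra.
  have {}h := Hs _ h; rewrite subrK K0 Ky0 !subr0 in h.
  have -> : Y (k + y0) - Y y0 - idfun k = K (Y (k + y0)).
    by rewrite YY0 /K Qk opprD addrA addrAC.
  apply: le_trans h _; rewrite -mulrA ler_pM2l//.
  by move: b; lra.
split => //; first by move=> v; rewrite deriveE// dYE.
by apply: filterS nr => y /YE[].
Qed.

End LocalInverse.

(** * Functions of class C^k on an open set *)

Section Smoothness.
Context (R : realType) (V : normedModType R) (U : set V) (Uo : open U).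
Implicit Types (W : normedModType R) (f g : V -> R) (k : nat).

Lemma near_open x : U x -> \forall y \near x, U y.
Proof. by move=> Ux; apply: open_nbhs_nbhs. Qed.

(** Since U is open, the values of f on U determine its derivatives there.  This
    lets the closed formulas for derivatives below feed the induction on k. *)
Lemma eq_Ck_on W k (f g : V -> W) : (forall x, U x -> f x = g x) ->
  Ck_on k U f -> Ck_on k U g.
Proof.
elim: k f g => [|k IH] f g fg /=.
  move=> cf x Ux; rewrite /prop_for /continuous_at -fg//.
  have N : {near x, f =1 g} by apply: filterS (near_open Ux) => y; exact: fg.
  by apply: cvg_trans (near_eq_cvg N) _; exact: cf.
move=> [df Df]; split=> [x Ux|v].
  apply: near_eq_differentiable (df x Ux).
  by apply: filterS (near_open Ux) => y; exact: fg.
apply: IH (Df v) => x Ux; apply: near_eq_derive.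
by apply: filterS (near_open Ux) => y; exact: fg.
Qed.

Lemma Ck_onS W k (f : V -> W) : Ck_on k.+1 U f -> Ck_on k U f.
Proof.
elim: k f => [|k IH] f [df Df].
  by move=> x Ux; apply: differentiable_continuous; exact: df.
by split => // v; apply: IH; exact: Df.
Qed.

Lemma Ck_on_cst W k (c : W) : Ck_on k U (fun _ : V => c).
Proof.
elim: k c => [|k IH] c /=.
  by move=> x _; exact: cst_continuous.
split=> [x _|v]; first exact: differentiable_cst.
by apply: eq_Ck_on (IH 0) => x _; rewrite derive_cst.
Qed.

Lemma Ck_on_add W k (f g : V -> W) :
  Ck_on k U f -> Ck_on k U g -> Ck_on k U (fun x => f x + g x).
Proof.
elim: k f g => [|k IH] f g /= Hf Hg.
  by move=> x Ux; exact: (cvgD (Hf x Ux) (Hg x Ux)).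
case: Hf Hg => [df Df] [dg Dg]; split=> [x Ux|v].
  exact: (differentiableD (df x Ux) (dg x Ux)).
apply: eq_Ck_on (IH _ _ (Df v) (Dg v)) => x Ux.
by rewrite deriveD//; apply: diff_derivable; [exact: df|exact: dg].
Qed.

Lemma Ck_on_mul k f g :
  Ck_on k U f -> Ck_on k U g -> Ck_on k U (fun x => f x * g x).
Proof.
elim: k f g => [|k IH] f g.
  move=> /= Hf Hg x Ux; exact: (cvgM (Hf x Ux) (Hg x Ux)).
move=> Hf Hg; have [df Df] := Hf; have [dg Dg] := Hg.
split=> [x Ux|v]; first exact: (differentiableM (df x Ux) (dg x Ux)).
have E := Ck_on_add (IH _ _ (Df v) (Ck_onS Hg)) (IH _ _ (Ck_onS Hf) (Dg v)).
refine (eq_Ck_on _ E).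
move=> x Ux; apply/esym.
by have [_ ->] := is_derive_mul (is_diff_derive v (df x Ux)) (is_diff_derive v (dg x Ux)).
Qed.

Lemma Ck_on_inv k f : (forall x, U x -> f x != 0) ->
  Ck_on k U f -> Ck_on k U (fun x => (f x)^-1).
Proof.
move=> f0; elim: k f f0 => [|k IH] f f0.
  move=> /= Hf x Ux; exact: (cvgV (f0 x Ux) (Hf x Ux)).
move=> Hf; have [df Df] := Hf.
split=> [x Ux|v]; first exact: (differentiableV (df x Ux) (f0 x Ux)).
have I := IH f f0 (Ck_onS Hf).
have E := Ck_on_mul (Ck_on_cst k (-1 : R)) (Ck_on_mul (Ck_on_mul I I) (Df v)).
refine (eq_Ck_on _ E).
move=> x Ux; rewrite deriveV ?f0//; last by apply: diff_derivable; exact: df.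
by rewrite mulN1r -mulNr -expr2 exprVn.
Qed.

Lemma differentiable_sqrt f x : 0 < f x -> differentiable f x ->
  differentiable (fun y => Num.sqrt (f y)) x.
Proof.
move=> f0 df; apply: (@differentiable_comp _ _ _ _ f (Num.sqrt : R -> R)) => //.
by apply/derivable1_diffP; have [] := is_derive1_sqrt f0.
Qed.

Lemma derive_sqrt f x v : 0 < f x -> differentiable f x ->
  'D_v (fun y => Num.sqrt (f y)) x = (2 * Num.sqrt (f x))^-1 * 'D_v f x.
Proof.
move=> f0 df; have [ds Ds] := is_derive1_sqrt f0.
have dd : differentiable (Num.sqrt : R -> R) (f x) by apply/derivable1_diffP.
have [_ ->] := is_derive_chain dd (is_diff_derive v df).
have E (d : R) : 'D_d (Num.sqrt : R -> R) (f x) = d *: (2 * Num.sqrt (f x))^-1.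
  by rewrite -Ds -derive_scale// [d *: 1]mulr1.
by rewrite E [RHS]mulrC.
Qed.

Lemma Ck_on_sqrt k f : (forall x, U x -> 0 < f x) ->
  Ck_on k U f -> Ck_on k U (fun x => Num.sqrt (f x)).
Proof.
elim: k f => [|k IH] f f0.
  move=> /= Hf x Ux; apply: (@continuous_comp _ _ _ f Num.sqrt); first exact: Hf.
  exact: sqrt_continuous.
move=> Hf; have [df Df] := Hf.
split=> [x Ux|v]; first by apply: differentiable_sqrt; [exact: f0|exact: df].
have I := IH f f0 (Ck_onS Hf).
have I2 : Ck_on k U (fun x => (2 * Num.sqrt (f x))^-1).
  apply: Ck_on_inv; last by apply: Ck_on_mul => //; exact: Ck_on_cst.
  by move=> x Ux; rewrite mulf_neq0// gt_eqF// sqrtr_gt0 f0.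
have E := Ck_on_mul I2 (Df v).
refine (eq_Ck_on _ E) => x Ux.
by rewrite derive_sqrt; [|exact: f0|exact: df].
Qed.

Lemma Ck_on_sum k W (I : Type) (r : seq I) (h : I -> V -> W) :
  (forall i, Ck_on k U (h i)) -> Ck_on k U (fun x => \sum_(i <- r) h i x).
Proof.
move=> H; elim: r => [|i r IH].
  by under eq_fun do rewrite big_nil; exact: Ck_on_cst.
by under eq_fun do rewrite big_cons; exact: Ck_on_add.
Qed.

Lemma Ck_on_prod k (I : Type) (r : seq I) (h : I -> V -> R) :
  (forall i, Ck_on k U (h i)) -> Ck_on k U (fun x => \prod_(i <- r) h i x).
Proof.
move=> H; elim: r => [|i r IH].
  by under eq_fun do rewrite big_nil; exact: Ck_on_cst.
by under eq_fun do rewrite big_cons; exact: Ck_on_mul.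
Qed.

Lemma Ck_on_entry k m n (F : V -> 'M[R]_(m, n)) i j :
  Ck_on k U F -> Ck_on k U (fun x => F x i j).
Proof.
elim: k F => [|k IH] F /=.
  move=> cF x Ux; apply: (@continuous_comp _ _ _ F (fun M : 'M[R]_(m, n) => M i j)).
    exact: cF.
  exact: coord_continuous.
move=> [dF DF]; split=> [x Ux|v]; first exact/differentiable_entry/dF.
apply: eq_Ck_on (IH _ (DF v)) => x Ux.
by rewrite derive_coord//; apply/diff_derivable/dF.
Qed.

Lemma Ck_on_mx k m n (F : V -> 'M[R]_(m, n)) :
  (forall i j, Ck_on k U (fun x => F x i j)) -> Ck_on k U F.
Proof.
elim: k F => [|k IH] F /= H.
  move=> x Ux; apply/cvgrPdist_le => e e0.
  have N : \forall y \near x, forall i j, `|F x i j - F y i j| <= e.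
    apply: filter_forall => i; apply: filter_forall => j.
    by have /cvgrPdist_le/(_ e e0) := H i j x Ux.
  apply: filterS N => y Hy; rewrite [leLHS]/Num.Def.normr/= mx_normrE.
  by rewrite bigmax_le ?ltW// => -[i j] _; rewrite !mxE; exact: Hy.
have dF x : U x -> differentiable F x.
  by move=> Ux; apply: differentiable_mx => i j; have [d _] := H i j; exact: d.
split=> // v; apply: IH => i j; have [_ D] := H i j.
apply: eq_Ck_on (D v) => x Ux.
by rewrite derive_coord//; apply/diff_derivable/dF.
Qed.

Lemma Ck_on_det k n (F : V -> 'M[R]_n) :
  (forall i j, Ck_on k U (fun x => F x i j)) -> Ck_on k U (fun x => \det (F x)).
Proof.
move=> H; apply: Ck_on_sum => s; apply: Ck_on_mul; first exact: Ck_on_cst.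
by apply: Ck_on_prod.
Qed.

End Smoothness.

Section MatrixInverse.
Context (R : realType).

Lemma differentiable_invmx (V : normedModType R) m (F : V -> 'M[R]_m) x :
  differentiable F x -> F x \in unitmx -> differentiable (fun q => invmx (F q)) x.
Proof.
move=> dF Fu.
have dd := differentiable_det dF.
have d0 : \det (F x) != 0 by rewrite -unitfE -unitmxE.
have nU : \forall q \near x, (\det (F q))^-1 *: \adj (F q) = invmx (F q).
  have := near_compose (Q := fun r : R => r != 0) (differentiable_continuous dd).
  move=> /(_ _) h; apply: filterS (h _) => [q q0|].
    by rewrite /invmx unitmxE unitfE q0.
  exact: (near_open (@open_neq R 0) d0).
apply: near_eq_differentiable nU _.
apply: differentiable_mx => i j; under eq_fun do rewrite mxE.
apply: differentiableM; first exact: differentiableV.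
under eq_fun do rewrite mxE.
apply: differentiableM; first exact: differentiable_cst.
apply: differentiable_det; apply: differentiable_mx => k l.
by under eq_fun do rewrite !mxE; exact: differentiable_entry.
Qed.

End MatrixInverse.

(** * The Minkowski product *)

Section Minkowski.
Context (R : realType) (n : nat).
Implicit Types (x y z : 'rV[R]_(n.+2)) (V : normedModType R).

(** The diagonal of the Gram matrix; with it the product is a single sum over all
    coordinates. *)
Definition mink_sign (i : 'I_n.+2) : R := (-1) ^+ (i == ord_max).

Lemma minkE x y : mink x y = \sum_i mink_sign i * (x 0 i * y 0 i).
Proof.
rewrite big_ord_recr /= /mink /mink_sign eqxx mulN1r; congr (_ - _).
apply: eq_bigr => i _; have -> : lift ord_max i = widen_ord (leqnSn n.+1) i.
  by apply: val_inj; rewrite /= /bump leqNgt ltn_ord.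
by rewrite -val_eqE /= ltn_eqF ?ltn_ord// mul1r.
Qed.

Lemma minkC x y : mink x y = mink y x.
Proof. by rewrite !minkE; apply: eq_bigr => i _; rewrite [x 0 i * _]mulrC. Qed.

Lemma minkDl x y z : mink (x + y) z = mink x z + mink y z.
Proof.
rewrite !minkE -big_split; apply: eq_bigr => i _ /=.
by rewrite mxE mulrDl mulrDr.
Qed.

Lemma minkZl (a : R) x y : mink (a *: x) y = a * mink x y.
Proof.
rewrite !minkE mulr_sumr; apply: eq_bigr => i _ /=.
by rewrite mxE -mulrA mulrCA.
Qed.

Lemma minkDr x y z : mink x (y + z) = mink x y + mink x z.
Proof. by rewrite minkC minkDl !(minkC x). Qed.

Lemma minkZr (a : R) x y : mink x (a *: y) = a * mink x y.
Proof. by rewrite minkC minkZl minkC. Qed.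

Lemma mink0l x : mink 0 x = 0.
Proof. by rewrite -(scale0r 0) minkZl mul0r. Qed.

Lemma mink0r x : mink x 0 = 0.
Proof. by rewrite minkC mink0l. Qed.

Lemma minkNl x y : mink (- x) y = - mink x y.
Proof. by rewrite -scaleN1r minkZl mulN1r. Qed.

Lemma minkNr x y : mink x (- y) = - mink x y.
Proof. by rewrite minkC minkNl minkC. Qed.

Definition minkB := (minkDl, minkDr, minkZl, minkZr, minkNl, minkNr, mink0l, mink0r).

Lemma mink_suml (I : Type) (r : seq I) (F : I -> 'rV[R]_(n.+2)) y :
  mink (\sum_(i <- r) F i) y = \sum_(i <- r) mink (F i) y.
Proof.
elim: r => [|i r IH]; first by rewrite !big_nil mink0l.
by rewrite !big_cons minkDl IH.
Qed.

Lemma mink_sumr (I : Type) (r : seq I) (F : I -> 'rV[R]_(n.+2)) y :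
  mink y (\sum_(i <- r) F i) = \sum_(i <- r) mink y (F i).
Proof. by rewrite minkC mink_suml; apply: eq_bigr => i _; rewrite minkC. Qed.

Lemma mink_delta x i : mink x (delta_mx 0 i) = mink_sign i * x 0 i.
Proof.
rewrite minkE (bigD1 i)//= mxE !eqxx /= mulr1 big1 ?addr0// => j ji.
by rewrite mxE eqxx (negbTE ji) !mulr0.
Qed.

Lemma mink_sign_sqr i : mink_sign i * mink_sign i = 1.
Proof. by rewrite /mink_sign -expr2 sqrr_sign. Qed.

Lemma mink_nondegenerate x : (forall y, mink x y = 0) -> x = 0.
Proof.
move=> H; apply/rowP => i; rewrite mxE -[LHS]mul1r -(mink_sign_sqr i) -mulrA.
by rewrite -mink_delta H mulr0.
Qed.

Lemma is_derive_mink V (f g : V -> 'rV[R]_(n.+2)) p v df dg :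
  is_derive p v f df -> is_derive p v g dg ->
  is_derive p v (fun q => mink (f q) (g q)) (mink df (g p) + mink (f p) dg).
Proof.
move=> hf hg; under eq_fun do rewrite minkE; rewrite !minkE -big_split /=.
apply: is_derive_sumf => i; rewrite -mulrDr.
have h := is_derive_mul (is_derive_coord 0 i hf) (is_derive_coord 0 i hg).
have := is_derive_mul (is_derive_cst (mink_sign i) p v) h.
by rewrite mul0r add0r.
Qed.

Lemma differentiable_mink V (f g : V -> 'rV[R]_(n.+2)) p :
  differentiable f p -> differentiable g p ->
  differentiable (fun q => mink (f q) (g q)) p.
Proof.
move=> hf hg; under eq_fun do rewrite minkE.
apply: differentiable_sumf => i.
apply: differentiableM; first exact: differentiable_cst.
by apply: differentiableM; exact: differentiable_entry.
Qed.

Lemma Ck_on_mink V (U : set V) k (f g : V -> 'rV[R]_(n.+2)) : open U ->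
  Ck_on k U f -> Ck_on k U g -> Ck_on k U (fun q => mink (f q) (g q)).
Proof.
move=> Uo hf hg; under eq_fun do rewrite minkE.
apply: Ck_on_sum => // i; apply: Ck_on_mul => //; first exact: Ck_on_cst.
by apply: Ck_on_mul => //; exact: Ck_on_entry.
Qed.

End Minkowski.

(** * Horizontal vectors and the geodesic flow *)

Section UnitTangentBundle.
Context (R : realType) (n : nat).
Notation E := (ambient2 R n).
Implicit Types (z a b c : E).

(** On horizontal vectors this flat form is the pull-back of the metric of the
    space of geodesics. *)
Definition kform a b : R := mink a.1 b.1 - mink a.2 b.2.

(** The projection onto horizontal vectors along x and v; the two signs differ
    because <x, x> = -1 and <v, v> = 1. *)
Definition hor z a : E :=
  (a.1 + mink a.1 z.1 *: z.1 - mink a.1 z.2 *: z.2,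
   a.2 + mink a.2 z.1 *: z.1 - mink a.2 z.2 *: z.2).

(** On horizontal vectors this is the lift of J. *)
Definition swap a : E := (a.2, a.1).

Lemma kformC a b : kform a b = kform b a.
Proof. by rewrite /kform minkC [mink a.2 _]minkC. Qed.

Lemma kform_nondegenerate a : (forall b, kform a b = 0) -> a = 0.
Proof.
case: a => a1 a2 H; congr (_, _); apply: mink_nondegenerate => y.
  by have := H (y, 0); rewrite /kform /= mink0r subr0.
by have := H (0, y); rewrite /kform /= mink0r sub0r => /eqP; rewrite oppr_eq0 => /eqP.
Qed.

Lemma hor_horver z a : T1H z -> horver z (hor z a).
Proof.
move=> [[xx _] xv vv]; have vx : mink z.2 z.1 = 0 by rewrite minkC.
by split; rewrite /= !minkB ?xx ?xv ?vv ?vx; ring.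
Qed.

Lemma hor_id z a : horver z a -> hor z a = a.
Proof.
by case: a => a1 a2 [/= h1 h2 h3 h4]; rewrite /hor /= h1 h2 h3 h4 !scale0r !subr0 !addr0.
Qed.

Lemma kform_hor z a b : horver z b -> kform (hor z a) b = kform a b.
Proof.
move=> [h1 h2 h3 h4]; rewrite /kform /= !minkB ![mink z.1 _]minkC ![mink z.2 _]minkC.
by rewrite h1 h2 h3 h4 !mulr0 !subr0 !addr0.
Qed.

Lemma kform_hor_nondegenerate z a : T1H z -> horver z a ->
  (forall b, horver z b -> kform a b = 0) -> a = 0.
Proof.
move=> Tz ha H; apply: kform_nondegenerate => b.
by rewrite kformC -(kform_hor _ ha) kformC; apply/H/hor_horver.
Qed.

Lemma horver_swap z a : horver z a -> horver z (swap a).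
Proof. by move=> []. Qed.

Lemma horver_comb z (r : R) a b : horver z a -> horver z b -> horver z (r *: a + b).
Proof.
move=> [h1 h2 h3 h4] [k1 k2 k3 k4].
by split; rewrite /= !minkB ?h1 ?h2 ?h3 ?h4 ?k1 ?k2 ?k3 ?k4 mulr0 addr0.
Qed.

Lemma cosh0 : cosh 0 = 1 :> R.
Proof. by rewrite /cosh oppr0 expR0 -mulr2n -[1 *+ 2]/(2%:R) divff. Qed.

Lemma sinh0 : sinh 0 = 0 :> R.
Proof. by rewrite /sinh oppr0 subrr mul0r. Qed.

Lemma coshD (s t : R) : cosh (s + t) = cosh s * cosh t + sinh s * sinh t.
Proof. rewrite /cosh /sinh opprD !expRD; by field. Qed.

Lemma sinhD (s t : R) : sinh (s + t) = sinh s * cosh t + cosh s * sinh t.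
Proof. rewrite /cosh /sinh opprD !expRD; by field. Qed.

Lemma coshN (s : R) : cosh (- s) = cosh s.
Proof. by rewrite /cosh opprK addrC. Qed.

Lemma sinhN (s : R) : sinh (- s) = - sinh s.
Proof. by rewrite /sinh opprK -mulNr opprB. Qed.

Lemma cosh2_sinh2 (s : R) : cosh s * cosh s - sinh s * sinh s = 1.
Proof. by rewrite -cosh0 -(subrr s) coshD coshN sinhN mulrN. Qed.

Lemma is_derive_expN (s : R) : is_derive s 1 (fun t => expR (- t)) (- expR (- s)).
Proof.
apply: is_derive_eq (is_derive1_comp (is_derive_expR _) (is_deriveN (is_derive_id s 1))) _.
by rewrite mulrN1.
Qed.

Lemma is_derive_cosh (s : R) : is_derive s 1 (@cosh R) (sinh s).
Proof.
have h := is_deriveD (is_derive_expR s) (is_derive_expN s).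
have := is_derive_mul h (is_derive_cst (2^-1 : R) s (1 : R)).
by rewrite mulr0 addr0.
Qed.

Lemma is_derive_sinh (s : R) : is_derive s 1 (@sinh R) (cosh s).
Proof.
have h := is_deriveB (is_derive_expR s) (is_derive_expN s).
have := is_derive_mul h (is_derive_cst (2^-1 : R) s (1 : R)).
by rewrite mulr0 addr0 opprK.
Qed.

Lemma geodesic_flow0 z : geodesic_flow 0 z = z.
Proof.
by case: z => x v; rewrite /geodesic_flow cosh0 sinh0 !scale1r !scale0r addr0 add0r.
Qed.

Lemma geodesic_flowD (s t : R) z :
  geodesic_flow s (geodesic_flow t z) = geodesic_flow (s + t) z.
Proof.
rewrite /geodesic_flow /= coshD sinhD; congr (_, _);
  by apply/rowP => i; rewrite !mxE; ring.
Qed.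

Lemma gproj_flow (s : R) z : gproj (geodesic_flow s z) = gproj z.
Proof.
rewrite /gproj eqEsubset; split => _ [t _ <-].
  by exists (t + s) => //; rewrite geodesic_flowD.
by exists (t - s) => //; rewrite geodesic_flowD subrK.
Qed.

Lemma gproj_self z : gproj z z.
Proof. by exists 0 => //; rewrite geodesic_flow0. Qed.

End UnitTangentBundle.

(** * Maps into products *)

Section Projections.
Context (R : realType).

Lemma differentiable_fst (V W : normedModType R) (z : V * W) : differentiable fst z.
Proof. by apply: linear_differentiable => {}z; exact: cvg_fst. Qed.

Lemma differentiable_snd (V W : normedModType R) (z : V * W) : differentiable snd z.
Proof. by apply: linear_differentiable => {}z; exact: cvg_snd. Qed.

End Projections.

Section Pairs.
Context (R : realType) (V W1 W2 : normedModType R).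

Lemma is_derive_pair (f : V -> W1) (g : V -> W2) x v df dg :
  is_derive x v f df -> is_derive x v g dg ->
  is_derive x v (fun y => (f y, g y)) (df, dg).
Proof.
move=> [hf <-] [hg <-].
have C : (fun h => h^-1 *: (((fun y => (f y, g y)) \o shift x) (h *: v) - (f x, g x)))
    @ 0^' --> (('D_v f x, 'D_v g x) : W1 * W2) := cvg_pair hf hg.
split; first by apply/cvg_ex; exists (('D_v f x, 'D_v g x) : W1 * W2); exact: C.
by apply/cvg_lim; [exact: norm_hausdorff|exact: C].
Qed.

Lemma is_derive_fst (f : V -> W1 * W2) x v df :
  is_derive x v f df -> is_derive x v (fun y => (f y).1) df.1.
Proof.
move=> hf.
have c : continuous (@fst W1 W2) by move=> z; exact: cvg_fst.
have d : differentiable (@fst W1 W2) (f x) by exact: linear_differentiable.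
have := is_derive_chain d hf.
by rewrite deriveE// diff_lin.
Qed.

Lemma is_derive_snd (f : V -> W1 * W2) x v df :
  is_derive x v f df -> is_derive x v (fun y => (f y).2) df.2.
Proof.
move=> hf.
have c : continuous (@snd W1 W2) by move=> z; exact: cvg_snd.
have d : differentiable (@snd W1 W2) (f x) by exact: linear_differentiable.
have := is_derive_chain d hf.
by rewrite deriveE// diff_lin.
Qed.

End Pairs.

(** * Curves in the unit tangent bundle *)

Section T1HCurves.
Context (R : realType) (n : nat).
Implicit Types (z a b c : ambient2 R n).

(** The difference is a sum of squares, by Lagrange's identity in the plane spanned
    by x and v.  It keeps geodesics on the upper sheet of the hyperboloid. *)
Lemma T1H_timelike z : T1H z -> z.2 0 ord_max ^+ 2 <= z.1 0 ord_max ^+ 2.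
Proof.
case: z => x v [/= [xx x0] xv vv]; rewrite -subr_ge0.
pose l (i : 'I_n.+1) := lift ord_max i.
suff -> : x 0 ord_max ^+ 2 - v 0 ord_max ^+ 2 =
   \sum_i (v 0 (l i) * x 0 ord_max - x 0 (l i) * v 0 ord_max) ^+ 2.
  by apply: sumr_ge0 => i _; exact: sqr_ge0.
set p := x 0 ord_max; set q := v 0 ord_max.
have E i : (v 0 (l i) * p - x 0 (l i) * q) ^+ 2 =
  (v 0 (l i) * v 0 (l i)) * p ^+ 2 - (x 0 (l i) * v 0 (l i)) * (2 * p * q)
   + (x 0 (l i) * x 0 (l i)) * q ^+ 2 by ring.
under eq_bigr do rewrite E.
rewrite big_split big_split /= sumrN -!mulr_suml.
move: xx xv vv; rewrite /mink -/p -/q => /eqP; rewrite subr_eq => /eqP ->.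
move=> /eqP; rewrite subr_eq add0r => /eqP -> /eqP; rewrite subr_eq => /eqP ->.
ring.
Qed.

Lemma T1H_flow s z : T1H z -> T1H (geodesic_flow s z).
Proof.
move=> Tz; have tl := T1H_timelike Tz; case: Tz => [[xx x0] xv vv].
have vx : mink z.2 z.1 = 0 by rewrite minkC.
have cs := cosh2_sinh2 s.
split => /=.
- split; first by rewrite !minkB xx xv vx vv; move: cs; lra.
  rewrite !mxE; move: tl x0; move: (z.1 0 ord_max) (z.2 0 ord_max) => p q tl p0.
  have : `|q| <= `|p| by rewrite -ler_sqr ?nnegrE// !real_normK ?num_real.
  rewrite (gtr0_norm p0) ler_norml => /andP[q1 q2].
  have e1 := expR_gt0 s; have e2 := expR_gt0 (- s).
  rewrite /cosh /sinh; move: (expR s) (expR (- s)) e1 e2 => e f e0 f0.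
  have : 0 <= e * (p + q) by apply: mulr_ge0; [exact: ltW|lra].
  have : 0 <= f * (p - q) by apply: mulr_ge0; [exact: ltW|lra].
  have [q0|q0] := lerP 0 q.
    have : 0 < e * (p + q) by rewrite mulr_gt0//; lra.
    lra.
  have : 0 < f * (p - q) by rewrite mulr_gt0//; lra.
  lra.
- by rewrite !minkB xx xv vx vv; ring.
- by rewrite !minkB xx xv vx vv; move: cs; lra.
Qed.

Lemma horver_flow s z a : horver z a -> horver (geodesic_flow s z) (geodesic_flow s a).
Proof. by move=> [h1 h2 h3 h4]; split; rewrite /= !minkB h1 h2 h3 h4; ring. Qed.

Lemma kform_flow s a b : kform (geodesic_flow s a) (geodesic_flow s b) = kform a b.
Proof.
rewrite /kform /= !minkB.
have -> : mink a.1 b.1 - mink a.2 b.2 = (cosh s * cosh s - sinh s * sinh s) *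
   (mink a.1 b.1 - mink a.2 b.2) by rewrite cosh2_sinh2 mul1r.
ring.
Qed.

Lemma swap_flow s a : swap (geodesic_flow s a) = geodesic_flow s (swap a).
Proof. by rewrite /swap /geodesic_flow /= addrC [sinh _ *: _ + _]addrC. Qed.

Lemma is_derive_flow z :
  is_derive (0 : R) (1 : R) (fun s : R => geodesic_flow s z) (z.2, z.1).
Proof.
have c := is_derive_cosh (0:R); have s := is_derive_sinh (0:R).
rewrite sinh0 in c; rewrite cosh0 in s.
apply: is_derive_pair.
  have := is_deriveD (is_derive_scalef c (is_derive_cst z.1 (0:R) (1:R)))
    (is_derive_scalef s (is_derive_cst z.2 (0:R) (1:R))).
  by rewrite !scaler0 scale0r scale1r !addr0 add0r.
have := is_deriveD (is_derive_scalef s (is_derive_cst z.1 (0:R) (1:R)))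
    (is_derive_scalef c (is_derive_cst z.2 (0:R) (1:R))).
by rewrite !scaler0 scale0r scale1r !addr0.
Qed.

(** The normalising factor is even in h: projecting a line back to the quadric does
    not change its velocity at 0. *)
Lemma is_derive_renormalize (k : R) :
  is_derive (0 : R) (1 : R) (fun h : R => (Num.sqrt (1 + k * (h * h)))^-1) 0.
Proof.
pose f (h : R) := 1 + k * (h * h).
have df (h : R) : is_derive h 1 f (k * (h + h)).
  have i := is_derive_id h (1:R).
  have := is_deriveD (is_derive_cst (1:R) h 1)
    (is_derive_mul (is_derive_cst k h (1:R)) (is_derive_mul i i)).
  by rewrite mul0r !add0r mul1r mulr1.
have f0 : f 0 = 1 by rewrite /f !mulr0 addr0.
have df0 : differentiable f 0 by apply/derivable1_diffP; have [] := df 0.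
have f0p : 0 < f 0 by rewrite f0.
have sf : differentiable (fun h => Num.sqrt (f h)) 0 by exact: differentiable_sqrt.
have sf0 : Num.sqrt (f 0) != 0 by rewrite f0 sqrtr1 oner_neq0.
have ds : derivable (fun h => Num.sqrt (f h)) 0 1 by exact: diff_derivable.
split; first exact: derivableV.
rewrite deriveV// derive_sqrt//; have [_ ->] := df 0.
by rewrite addr0 !mulr0 ?scaler0.
Qed.

Let curve_near (k : R) : \forall h \near (0:R), 0 < 1 + k * (h * h).
Proof.
have c : {for (0:R), continuous (fun h : R => 1 + k * (h * h))}.
  apply: cvgD; first exact: cvg_cst.
  by apply: cvgM; [exact: cvg_cst|apply: cvgM; exact: cvg_id].
have := cvgr_gt _ c; apply; by rewrite !mulr0 addr0.
Qed.

(** Identities between maps on T^1H can be differentiated only along curves that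
    stay in T^1H; horizontal and vertical vectors are treated separately because
    then one component of the curve is constant. *)
Lemma horizontal_curve z w : T1H z -> horver z (w, 0) ->
  exists g : R -> 'rV[R]_(n.+2), [/\ g 0 = z.1, is_derive (0 : R) (1 : R) g w &
    \forall h \near 0, T1H (g h, z.2)].
Proof.
move=> [[xx x0] xv vv] [/= wx wv _ _].
pose rho (h : R) := (Num.sqrt (1 + (- mink w w) * (h * h)))^-1.
exists (fun h => rho h *: (h *: w + z.1)); split.
- by rewrite /rho !mulr0 addr0 sqrtr1 invr1 scale1r scale0r add0r.
- have := is_derive_scalef (is_derive_renormalize (- mink w w)) (is_derive_line w z.1 0).
  by rewrite scale0r add0r !mulr0 addr0 sqrtr1 invr1 scale1r.
have L : \forall h \near (0:R), 0 < (h *: w + z.1) 0 ord_max.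
  have /differentiable_continuous c :
     differentiable (fun h : R => (h *: w + z.1) 0 ord_max) 0.
    apply: differentiable_entry; apply/derivable1_diffP.
    by have [] := is_derive_line w z.1 0.
  by have := cvgr_gt _ c; apply; rewrite scale0r add0r.
near=> h.
have p : 0 < 1 + (- mink w w) * (h * h) by near: h; exact: curve_near.
have q : 0 < (h *: w + z.1) 0 ord_max by near: h.
have r0 : 0 < rho h by rewrite /rho invr_gt0 sqrtr_gt0.
have rr : rho h * rho h * (1 + (- mink w w) * (h * h)) = 1.
  by rewrite /rho -invfM -expr2 sqr_sqrtr ?ltW// mulVf// gt_eqF.
have zw : mink z.1 w = 0 by rewrite minkC.
split => //=.
  split; last by rewrite mxE mulr_gt0.
  rewrite !minkB xx zw wx; move: rr; move: (rho h) => s e.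
  transitivity (- (s * s * (1 + - mink w w * (h * h)))); first by ring.
  by rewrite e.
by rewrite !minkB wv xv mulr0 addr0 mulr0.
Unshelve. all: by end_near. Qed.

Lemma vertical_curve z u : T1H z -> horver z (0, u) ->
  exists g : R -> 'rV[R]_(n.+2), [/\ g 0 = z.2, is_derive (0 : R) (1 : R) g u &
    \forall h \near 0, T1H (z.1, g h)].
Proof.
move=> [[xx x0] xv vv] [/= _ _ ux uv].
pose rho (h : R) := (Num.sqrt (1 + mink u u * (h * h)))^-1.
exists (fun h => rho h *: (h *: u + z.2)); split.
- by rewrite /rho !mulr0 addr0 sqrtr1 invr1 scale1r scale0r add0r.
- have := is_derive_scalef (is_derive_renormalize (mink u u)) (is_derive_line u z.2 0).
  by rewrite scale0r add0r !mulr0 addr0 sqrtr1 invr1 scale1r.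
near=> h.
have p : 0 < 1 + mink u u * (h * h) by near: h; exact: curve_near.
have rr : rho h * rho h * (1 + mink u u * (h * h)) = 1.
  by rewrite /rho -invfM -expr2 sqr_sqrtr ?ltW// mulVf// gt_eqF.
have vu : mink z.2 u = 0 by rewrite minkC.
have xu : mink z.1 u = 0 by rewrite minkC.
split => //=; first by rewrite !minkB xu xv mulr0 addr0 mulr0.
rewrite !minkB vv vu uv; move: rr; move: (rho h) => s e.
transitivity (s * s * (1 + mink u u * (h * h))); first by ring.
by rewrite e.
Unshelve. all: by end_near. Qed.

End T1HCurves.

(** * The differential of the projection to geodesics *)

Section GeodesicChart.
Context (R : realType) (n : nat) (phi : chart R (n + n) (set (ambient2 R n))).
Context (hphi : geodesic_chart phi).
Implicit Types (z a b c : ambient2 R n) (y xi eta : 'rV[R]_(n + n)).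

(** The chart read on an open set of the ambient vector space, where it has
    ordinary derivatives. *)
Definition geodesic_coord z : 'rV[R]_(n + n) :=
  cmap phi (gproj (retract z)).
Local Notation P := geodesic_coord.

Lemma dprojE z a : dproj phi z a = 'D_a P z.
Proof. by []. Qed.

Lemma open_tube : open (tube phi).
Proof. by case: hphi => _ []. Qed.

Lemma smooth_coord : smooth_on (tube phi) P.
Proof. by case: hphi. Qed.

Lemma coord_diff z : tube phi z -> differentiable P z.
Proof. by move=> tz; have [d _] := smooth_coord 1; exact: d. Qed.

Lemma dcoord_diff a z : tube phi z -> differentiable (fun z => 'D_a P z) z.
Proof. by move=> tz; have [_ D] := smooth_coord 2; have [d _] := D a; exact: d. Qed.

Definition in_chart z := T1H z /\ cdom phi (gproj z).

Lemma in_chart_tube z : in_chart z -> tube phi z.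
Proof.
by move=> [Tz cz]; have [rz rzE] := retract_T1H Tz; split => //; rewrite /= rzE.
Qed.

Lemma coord_T1H z : T1H z -> P z = cmap phi (gproj z).
Proof. by move=> Tz; have [_ rzE] := retract_T1H Tz; rewrite /P rzE. Qed.

Lemma in_chart_cinv z : in_chart z -> cinv phi (P z) = gproj z.
Proof. by move=> [Tz cz]; rewrite coord_T1H//; case: hphi => _ _ K _ _; exact: K. Qed.

Lemma in_chart_cimg z : in_chart z -> cimg phi (P z).
Proof. by move=> [Tz cz]; rewrite coord_T1H//; exists (gproj z). Qed.

Lemma in_chart_flow s z : in_chart z -> in_chart (geodesic_flow s z).
Proof. by move=> [Tz cz]; split; [exact: T1H_flow|rewrite gproj_flow]. Qed.

Lemma dproj_lin z (r : R) a b : in_chart z ->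
  dproj phi z (r *: a + b) = r *: dproj phi z a + dproj phi z b.
Proof. by move=> /in_chart_tube/coord_diff d; rewrite !dprojE derive_comb. Qed.

Lemma dproj_add z a b : in_chart z ->
  dproj phi z (a + b) = dproj phi z a + dproj phi z b.
Proof. by move=> /in_chart_tube/coord_diff d; rewrite !dprojE derive_add. Qed.

Lemma dproj_scale z (r : R) a : in_chart z ->
  dproj phi z (r *: a) = r *: dproj phi z a.
Proof. by move=> /in_chart_tube/coord_diff d; rewrite !dprojE derive_scale. Qed.

Lemma is_derive_coord_curve (g : R -> ambient2 R n) dg : in_chart (g 0) ->
  is_derive (0 : R) (1 : R) g dg ->
  is_derive (0 : R) (1 : R) (fun h => P (g h)) (dproj phi (g 0) dg).
Proof.
by move=> hg dgE; apply: is_derive_chain => //; apply/coord_diff/in_chart_tube.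
Qed.

Lemma dproj_fixed_curve z (g : R -> ambient2 R n) dg :
  in_chart z -> g 0 = z -> is_derive (0 : R) (1 : R) g dg ->
  (\forall h \near (0 : R), P (g h) = P z) -> dproj phi z dg = 0.
Proof.
move=> az g0 dgE H; rewrite -g0 in az *.
have [_ <-] := is_derive_coord_curve az dgE.
have -> : 'D_1 (fun h => P (g h)) (0 : R) = 'D_1 (cst (P z)) (0 : R).
  exact: near_eq_derive.
by rewrite derive_cst.
Qed.

(** The projection is constant along the flow, which leaves z with velocity
    (v, x). *)
Lemma dproj_flow_direction z : in_chart z -> dproj phi z (z.2, z.1) = 0.
Proof.
move=> az; apply: (dproj_fixed_curve az (geodesic_flow0 z) (is_derive_flow z)).
have Tz := az.1; near=> h; rewrite !coord_T1H ?gproj_flow//.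
exact: T1H_flow.
Unshelve. all: by end_near. Qed.

Let near_pos : \forall h \near (0 : R), 0 < 1 + h.
Proof.
have c : {for (0:R), continuous (fun h : R => 1 + h)}.
  by apply: cvgD; [exact: cvg_cst|exact: cvg_id].
by have := cvgr_gt _ c; apply; rewrite addr0.
Qed.

Let is_derive_radial m (x w : 'rV[R]_m) :
  is_derive (0 : R) (1 : R) (fun h : R => x + h *: w) w.
Proof. by under eq_fun do rewrite addrC; exact: is_derive_line. Qed.

Lemma retract_radial1 z (h : R) : 0 < 1 + h -> T1H z ->
  retract (z.1 + h *: z.1, z.2) = z.
Proof.
case: z => x v /= h0 /[dup] Tz [/= [xx x0] xv vv].
have -> : x + h *: x = (1 + h) *: x by rewrite scalerDl scale1r.
have nx : hnormalize ((1 + h) *: x) = x.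
  rewrite /hnormalize !minkB xx mulrN1 mulrN opprK -expr2.
  by rewrite sqrtr_sqr gtr0_norm// scalerA mulVf ?gt_eqF// scale1r.
rewrite /retract /= nx.
by rewrite /tanproj minkC xv scale0r addr0 vv sqrtr1 invr1 scale1r.
Qed.

Lemma retract_radial2 z (h : R) : 0 < 1 + h -> T1H z ->
  retract (z.1, z.2 + h *: z.2) = z.
Proof.
case: z => x v /= h0 /[dup] Tz [/= [xx x0] xv vv].
have -> : v + h *: v = (1 + h) *: v by rewrite scalerDl scale1r.
have nx : hnormalize x = x by rewrite /hnormalize xx opprK sqrtr1 invr1 scale1r.
rewrite /retract /= nx /tanproj minkZl [mink v x]minkC xv mulr0 scale0r addr0.
rewrite !minkB vv mulr1 -expr2 sqrtr_sqr gtr0_norm// scalerA mulVf ?gt_eqF//.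
by rewrite scale1r.
Qed.

Lemma retract_shear z (h : R) : T1H z -> retract (z.1, z.2 + h *: z.1) = z.
Proof.
case: z => x v /= /[dup] Tz [/= [xx x0] xv vv].
have nx : hnormalize x = x by rewrite /hnormalize xx opprK sqrtr1 invr1 scale1r.
rewrite /retract /= nx.
have -> : tanproj x (v + h *: x) = v.
  rewrite /tanproj !minkB [mink v x]minkC xv xx add0r mulrN1 scaleNr.
  by rewrite addrK.
by rewrite vv sqrtr1 invr1 scale1r.
Qed.

(** The retraction is constant along rescalings of x, rescalings of v and shears
    v + h x; together with the flow direction these span all pairs of
    combinations of x and v. *)
Lemma dproj_kill_x1 z : in_chart z -> dproj phi z (z.1, 0) = 0.
Proof.
move=> az; pose g (h : R) : ambient2 R n := (z.1 + h *: z.1, z.2).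
apply: (@dproj_fixed_curve z g) => //.
- by rewrite /g scale0r addr0; case: (z).
- by apply: is_derive_pair; exact: is_derive_radial.
have Tz := az.1; apply: filterS near_pos => h h0.
by rewrite /P retract_radial1// (retract_T1H Tz).2.
Qed.

Lemma dproj_kill_v2 z : in_chart z -> dproj phi z (0, z.2) = 0.
Proof.
move=> az; pose g (h : R) : ambient2 R n := (z.1, z.2 + h *: z.2).
apply: (@dproj_fixed_curve z g) => //.
- by rewrite /g scale0r addr0; case: (z).
- by apply: is_derive_pair; exact: is_derive_radial.
have Tz := az.1; apply: filterS near_pos => h h0.
by rewrite /P retract_radial2// (retract_T1H Tz).2.
Qed.

Lemma dproj_kill_x2 z : in_chart z -> dproj phi z (0, z.1) = 0.
Proof.
move=> az; pose g (h : R) : ambient2 R n := (z.1, z.2 + h *: z.1).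
apply: (@dproj_fixed_curve z g) => //.
- by rewrite /g scale0r addr0; case: (z).
- by apply: is_derive_pair; exact: is_derive_radial.
have Tz := az.1; near=> h; by rewrite /P retract_shear// (retract_T1H Tz).2.
Unshelve. all: by end_near. Qed.

Lemma dproj_kill_v1 z : in_chart z -> dproj phi z (z.2, 0) = 0.
Proof.
move=> az; have -> : (z.2, 0) = (z.2, z.1) + (-1) *: (0, z.1) :> ambient2 R n.
  by congr (_, _); rewrite /= ?scaler0 ?addr0// scaleN1r subrr.
by rewrite dproj_add// dproj_scale// dproj_flow_direction// dproj_kill_x2// scaler0 addr0.
Qed.

Lemma dproj_hor z a : in_chart z -> dproj phi z (hor z a) = dproj phi z a.
Proof.
move=> az.
have -> : hor z a = mink a.1 z.1 *: (z.1, 0) + (- mink a.1 z.2 *: (z.2, 0) +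
   (mink a.2 z.1 *: (0, z.1) + (- mink a.2 z.2 *: (0, z.2) + a))).
  rewrite /hor; move: (mink a.1 z.1) (mink a.1 z.2) (mink a.2 z.1) (mink a.2 z.2).
  move=> p q r s; case: (a) (z) => a1 a2 [x v] /=.
  by congr (_, _); apply/rowP => i; rewrite /= !mxE; ring.
by rewrite !dproj_lin// dproj_kill_x1// dproj_kill_v1// dproj_kill_x2//
  dproj_kill_v2// !scaler0 !add0r.
Qed.

Lemma dproj_surj z xi : in_chart z -> exists2 a, horver z a & dproj phi z a = xi.
Proof.
move=> az; case: hphi => _ _ _ _ S; have [a ta <-] := S z az.1 az.2 xi.
by exists (hor z a); [apply: hor_horver; case: az|exact: dproj_hor].
Qed.

(** The projection is invariant under the flow, but only on T^1H, so the identity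
    is differentiated along the curves in T^1H built for the horizontal and the
    vertical part of a. *)
Lemma dproj_flow s z a : in_chart z -> horver z a ->
  dproj phi (geodesic_flow s z) (geodesic_flow s a) = dproj phi z a.
Proof.
move=> az; have Tz := az.1.
have K g1 g2 c : (g1 (0:R), g2 (0:R)) = z ->
    is_derive (0:R) (1:R) g1 c.1 -> is_derive (0:R) (1:R) g2 c.2 ->
    (\forall h \near (0:R), T1H (g1 h, g2 h)) ->
    dproj phi (geodesic_flow s z) (geodesic_flow s c) = dproj phi z c.
  move=> g0 d1 d2 T.
  have d : is_derive (0:R) (1:R) (fun h => (g1 h, g2 h)) c.
    by have := is_derive_pair d1 d2; case: (c).
  have ds : is_derive (0:R) (1:R) (fun h => geodesic_flow s (g1 h, g2 h)) (geodesic_flow s c).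
    have S f (df : 'rV[R]_(n.+2)) (r : R) : is_derive (0:R) (1:R) f df ->
        is_derive (0:R) (1:R) (fun h => r *: f h) (r *: df).
      by move=> hf; exact: is_deriveZ.
    by apply: is_derive_pair; apply: is_deriveD; exact: S.
  have a1 : in_chart (g1 0, g2 0) by rewrite g0.
  have a2 : in_chart (geodesic_flow s (g1 0, g2 0)) by exact: in_chart_flow.
  have [_ E1] := is_derive_coord_curve a1 d.
  have [_ E2] := is_derive_coord_curve a2 ds.
  rewrite g0 in E1 E2; rewrite -E1 -E2; apply: near_eq_derive.
  by apply: filterS T => h Th; rewrite (coord_T1H Th) (coord_T1H (T1H_flow s Th)) gproj_flow.
move=> [h1 h2 h3 h4].
have ah : horver z (a.1, 0) by split => //=; rewrite mink0l.
have av : horver z (0, a.2) by split => //=; rewrite mink0l.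
have aE : a = (a.1, 0) + (0, a.2) by case: (a) => a1 a2; congr (_, _); rewrite /= ?addr0 ?add0r.
have fE : geodesic_flow s a = geodesic_flow s (a.1, 0) + geodesic_flow s (0, a.2).
  by congr (_, _); rewrite /= !scaler0 ?addr0 ?add0r.
have e1 : dproj phi (geodesic_flow s z) (geodesic_flow s (a.1, 0)) = dproj phi z (a.1, 0).
  have [g [g0 dg Tg]] := horizontal_curve Tz ah.
  apply: (K g (cst z.2) (a.1, 0) _ dg (is_derive_cst _ _ _) Tg).
  by rewrite g0 /=; case: (z).
have e2 : dproj phi (geodesic_flow s z) (geodesic_flow s (0, a.2)) = dproj phi z (0, a.2).
  have [g [g0 dg Tg]] := vertical_curve Tz av.
  apply: (K (cst z.1) g (0, a.2) _ (is_derive_cst _ _ _) dg Tg).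
  by rewrite g0 /=; case: (z).
have e3 : dproj phi z a = dproj phi z (a.1, 0) + dproj phi z (0, a.2).
  by rewrite {1}aE; exact: (dproj_add _ _ az).
rewrite fE e3 -e1 -e2; exact: (dproj_add _ _ (in_chart_flow s az)).
Qed.

End GeodesicChart.

(** * The metric and the para-complex structure of the space of geodesics *)

Section GeodesicMetric.
Context (R : realType) (n : nat) (phi : chart R (n + n) (set (ambient2 R n))).
Context (hphi : geodesic_chart phi).
Implicit Types (z a b c : ambient2 R n) (y xi eta : 'rV[R]_(n + n)).
Local Notation P := (geodesic_coord phi).
Local Notation in_chart := (in_chart phi).

Definition base1 i : ambient2 R n := (delta_mx 0 i, 0).
Definition base2 i : ambient2 R n := (0, delta_mx 0 i).

Lemma ambient_sum a :
  a = \sum_i a.1 0 i *: base1 i + \sum_i a.2 0 i *: base2 i.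
Proof.
have S1 (I : Type) (r : seq I) (F : I -> ambient2 R n) :
    (\sum_(i <- r) F i) = (\sum_(i <- r) (F i).1, \sum_(i <- r) (F i).2).
  elim: r => [|i r IH]; first by rewrite !big_nil.
  by rewrite !big_cons IH.
case: a => a1 a2; rewrite !S1 /=; congr (_, _) => /=.
  rewrite [X in _ + X]big1 ?addr0; last by move=> i _; rewrite scaler0.
  by rewrite {1}(row_sum_ebase a1).
rewrite [X in X + _]big1 ?add0r; last by move=> i _; rewrite scaler0.
by rewrite {1}(row_sum_ebase a2).
Qed.

Lemma derive_ambient (W : normedModType R) (f : ambient2 R n -> W) z a :
  differentiable f z ->
  'D_a f z = \sum_i a.1 0 i *: 'D_(base1 i) f z
           + \sum_i a.2 0 i *: 'D_(base2 i) f z.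
Proof. by move=> df; rewrite {1}[a]ambient_sum derive_add// !derive_lincomb. Qed.

Let K z : 'M[R]_(n.+2 + n.+2, n + n) :=
  col_mx (\matrix_i 'D_(base1 i) P z) (\matrix_i 'D_(base2 i) P z).

Let dprojK z a : in_chart z -> dproj phi z a = row_mx a.1 a.2 *m K z.
Proof.
move=> az; rewrite dprojE derive_ambient; last exact/coord_diff/in_chart_tube.
rewrite mul_row_col !mulmx_sum_row; congr (_ + _); apply: eq_bigr => i _;
  by rewrite rowK.
Qed.

Let lower (x : 'rV[R]_(n.+2)) : 'cV[R]_(n.+2) := \col_i (mink_sign R i * x 0 i).

Let mul_lower (x w : 'rV[R]_(n.+2)) : w *m lower x = (mink w x)%:M.
Proof.
apply/rowP => i; rewrite ord1 !mxE eqxx mulr1n minkE; apply: eq_bigr => j _.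
by rewrite mxE mulrCA.
Qed.

(** A dimension count: the differential of P together with the pairings of both
    components with x and v is a linear map A between spaces of dimension 2n + 4.
    It is onto, since dP is onto already on horizontal vectors and the Gram matrix
    of x and v is invertible; so A is injective, and horizontal vectors are those
    on which all the pairings vanish. *)
Lemma dproj_inj z a : in_chart z -> horver z a -> dproj phi z a = 0 -> a = 0.
Proof.
move=> az [h1 h2 h3 h4] da.
have [[xx _] xv vv] := az.1; have vx : mink z.2 z.1 = 0 by rewrite minkC.
pose X := row_mx (lower z.1) (lower z.2).
have XE w : w *m X = row_mx (mink w z.1)%:M (mink w z.2)%:M.
  by rewrite mul_mx_row !mul_lower.
pose A : 'M[R]_(n.+2 + n.+2, (n + n) + ((1 + 1) + (1 + 1))) :=
  row_mx (K z) (block_mx X 0 0 X).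
have AE b : in_chart z -> row_mx b.1 b.2 *m A =
    row_mx (dproj phi z b) (row_mx (b.1 *m X) (b.2 *m X)).
  move=> _; rewrite mul_mx_row -dprojK//; congr row_mx.
  by rewrite mul_row_block !mulmx0 addr0 add0r.
have fullA : row_full A.
  rewrite -sub1mx; apply/row_subP => i; move: (row i _) => t.
  rewrite -[t]hsubmxK -[rsubmx t]hsubmxK.
  rewrite -[lsubmx (rsubmx t)]hsubmxK -[rsubmx (rsubmx t)]hsubmxK.
  move: (lsubmx t) (lsubmx (lsubmx (rsubmx t))) (rsubmx (lsubmx (rsubmx t)))
    (lsubmx (rsubmx (rsubmx t))) (rsubmx (rsubmx (rsubmx t))) => xi p q r s.
  (* b0 has the prescribed pairings; a horizontal b then corrects its image. *)
pose b0 : ambient2 R n := (- p 0 0 *: z.1 + q 0 0 *: z.2, - r 0 0 *: z.1 + s 0 0 *: z.2).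
  have [b [k1 k2 k3 k4] bE] := dproj_surj hphi (xi - dproj phi z b0) az.
  apply/submxP; exists (row_mx (b0 + b).1 (b0 + b).2); rewrite AE// !XE.
  rewrite dproj_add// bE subrKC; congr (row_mx _ (row_mx (row_mx _ _) (row_mx _ _)));
    by rewrite /= !minkB ?xx ?xv ?vv ?vx ?k1 ?k2 ?k3 ?k4 [LHS]mx11_scalar;
       congr _%:M; ring.
have freeA : row_free A.
  move: fullA; rewrite /row_full /row_free => /eqP ->.
  by rewrite !addnS !addn0 !addSn.
have E0 : row_mx a.1 a.2 = 0.
  apply: (row_free_inj freeA); rewrite /= AE// da !XE h1 h2 h3 h4 mul0mx.
  by rewrite !raddf0 !row_mx0.
have e1 : a.1 = 0 by rewrite -(row_mxKl a.1 a.2) E0 linear0.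
have e2 : a.2 = 0 by rewrite -(row_mxKr a.1 a.2) E0 linear0.
by rewrite [a]surjective_pairing e1 e2.
Qed.

Lemma hvlift_dproj z a : in_chart z -> horver z a ->
  hvlift phi z (dproj phi z a) = a.
Proof.
move=> az ha; rewrite /hvlift; set S := [set _ | _].
have [hb bE] : S (xget 0 S) by apply: xgetPex; exists a.
move: (xget 0 S) hb bE => b hb bE.
have cE : b - a = (-1) *: a + b by rewrite scaleN1r addrC.
apply/eqP; rewrite -subr_eq0 cE; apply/eqP; apply: (dproj_inj az).
  exact: horver_comb.
by rewrite (dproj_lin hphi (-1) a b az) bE scaleN1r addNr.
Qed.

Lemma grep_flow z : in_chart z -> exists s, grep phi (P z) = geodesic_flow s z.
Proof.
move=> az; rewrite /grep (in_chart_cinv hphi az).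
have : gproj z (xget 0 (gproj z)) by apply: xgetPex; exists z; exact: gproj_self.
by move=> [s _ <-]; exists s.
Qed.

Lemma hvlift_grep z a : in_chart z -> horver z a ->
  exists2 s, grep phi (P z) = geodesic_flow s z &
   hvlift phi (grep phi (P z)) (dproj phi z a) = geodesic_flow s a.
Proof.
move=> az ha; have [s sE] := grep_flow az; exists s => //.
rewrite sE -(dproj_flow hphi s az ha) hvlift_dproj//.
  exact: in_chart_flow.
exact: horver_flow.
Qed.

Lemma gmetricE y xi eta : gmetric phi y xi eta =
  kform (hvlift phi (grep phi y) xi) (hvlift phi (grep phi y) eta).
Proof. by []. Qed.

(** The unit tangent vector chosen by grep is obtained from z by the flow for some
    time s; the flow carries horizontal lifts to horizontal lifts and preserves
    kform. *)
Lemma gmetric_dproj z a b : in_chart z ->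
  gmetric phi (P z) (dproj phi z a) (dproj phi z b) = kform (hor z a) (hor z b).
Proof.
move=> az; have ha := hor_horver a az.1; have hb := hor_horver b az.1.
have [s sE] := grep_flow az.
have L c : hvlift phi (grep phi (P z)) (dproj phi z c) = geodesic_flow s (hor z c).
  have hc := hor_horver c az.1.
  rewrite -(dproj_hor hphi c az) sE -(dproj_flow hphi s az hc).
  exact: (hvlift_dproj (in_chart_flow s az) (horver_flow s hc)).
by rewrite gmetricE; apply: etrans (congr2 (@kform R n) (L a) (L b)) (kform_flow _ _ _).
Qed.

(** As for the metric: the flow commutes with the exchange of components. *)
Lemma gJ_dproj z a : in_chart z -> horver z a ->
  gJ phi (P z) (dproj phi z a) = dproj phi z (swap a).
Proof.
move=> az ha; have [s sE lE] := hvlift_grep az ha.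
rewrite /gJ lE sE.
transitivity (dproj phi (geodesic_flow s z) (swap (geodesic_flow s a))); first by [].
by rewrite swap_flow (dproj_flow hphi s az (horver_swap ha)).
Qed.

End GeodesicMetric.

(** * Differentiability of the metric *)

Section GcoefDifferentiable.
Context (R : realType) (n : nat) (phi : chart R (n + n) (set (ambient2 R n))).
Context (hphi : geodesic_chart phi).
Implicit Types (z a b c : ambient2 R n) (y xi eta : 'rV[R]_(n + n)).
Local Notation P := (geodesic_coord phi).
Local Notation in_chart := (in_chart phi).

Lemma gmetric_lift z a b : in_chart z -> horver z a -> horver z b ->
  gmetric phi (P z) (dproj phi z a) (dproj phi z b) = kform a b.
Proof. by move=> az ha hb; rewrite gmetric_dproj// !hor_id. Qed.

Lemma kform_comb (r : R) a b c : kform (r *: a + b) c = r * kform a c + kform b c.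
Proof. rewrite /kform /= !minkB; ring. Qed.

Lemma gmetricC z xi eta : in_chart z ->
  gmetric phi (P z) xi eta = gmetric phi (P z) eta xi.
Proof. by move=> az; rewrite !gmetricE kformC. Qed.

Lemma gmetric_comb z (r : R) xi xi' eta : in_chart z ->
  gmetric phi (P z) (r *: xi + xi') eta =
  r * gmetric phi (P z) xi eta + gmetric phi (P z) xi' eta.
Proof.
move=> az; have [a ha <-] := dproj_surj hphi xi az.
have [b hb <-] := dproj_surj hphi xi' az; have [c hc <-] := dproj_surj hphi eta az.
rewrite -(dproj_lin hphi r a b az).
apply: etrans (gmetric_lift az (horver_comb r ha hb) hc) _.
apply: etrans (kform_comb r a b c) _; apply/esym.
exact: (congr2 (fun s t => r * s + t) (gmetric_lift az ha hc) (gmetric_lift az hb hc)).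
Qed.

Lemma gmetric_suml z (I : Type) (r : seq I) (k : I -> R) (xi : I -> 'rV[R]_(n + n)) eta : in_chart z ->
  gmetric phi (P z) (\sum_(i <- r) k i *: xi i) eta =
  \sum_(i <- r) k i * gmetric phi (P z) (xi i) eta.
Proof.
move=> az; elim: r => [|i r IH]; last by rewrite !big_cons gmetric_comb// IH.
rewrite !big_nil; have := gmetric_comb 1 0 0 eta az.
rewrite scaler0 addr0; move: (gmetric _ _ _ _) => x; lra.
Qed.

Lemma gmetric_sum z xi eta : in_chart z ->
  gmetric phi (P z) xi eta =
  \sum_i \sum_j gcoef (gmetric phi) i j (P z) * xi 0 i * eta 0 j.
Proof.
move=> az; rewrite {1}(row_sum_ebase xi) gmetric_suml//; apply: eq_bigr => i _.
rewrite (gmetricC (ebase R i) eta az) {1}(row_sum_ebase eta) gmetric_suml// mulr_sumr.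
apply: eq_bigr => j _; rewrite (gmetricC (ebase R j) (ebase R i) az) /gcoef.
by move: (gmetric _ _ _ _) => g; ring.
Qed.

(** For a submersion, the inverse of the metric downstairs is the push-forward of
    the inverse of the metric upstairs.  Here upstairs is flat, so this needs no
    horizontal lifts, and the formula is visibly differentiable in the point.  The
    vectors d1 k and d2 k are the images of the two halves of the standard basis. *)

Section LinearPushforward.
Context (d1 d2 : 'I_n.+2 -> 'rV[R]_(n + n)).

Definition push_cometric : 'M[R]_(n + n) := \matrix_(i, j) \sum_k mink_sign R k *
  (d1 k 0 i * d1 k 0 j - d2 k 0 i * d2 k 0 j).

(** The vector that represents the j-th coordinate of lin_map through kform. *)
Definition coord_dual j : ambient2 R n :=
  (\sum_k (mink_sign R k * d1 k 0 j) *: delta_mx 0 k,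
   - \sum_k (mink_sign R k * d2 k 0 j) *: delta_mx 0 k).

Definition lin_map a : 'rV[R]_(n + n) :=
  \sum_k a.1 0 k *: d1 k + \sum_k a.2 0 k *: d2 k.

Lemma mink_raise (x : 'rV[R]_(n.+2)) (f : 'I_n.+2 -> R) :
  mink x (\sum_k (mink_sign R k * f k) *: delta_mx 0 k) = \sum_k x 0 k * f k.
Proof.
rewrite mink_sumr; apply: eq_bigr => k _; rewrite minkZr mink_delta.
by rewrite mulrACA mink_sign_sqr mul1r mulrC.
Qed.

Lemma kform_coord_dual a j : kform a (coord_dual j) = lin_map a 0 j.
Proof.
rewrite /kform /coord_dual /= minkNr opprK !mink_raise [RHS]mxE !summxE.
by congr (_ + _); apply: eq_bigr => k _; rewrite [RHS]mxE.
Qed.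

Lemma lin_map_coord_dual j i : lin_map (coord_dual j) 0 i = push_cometric i j.
Proof.
rewrite /lin_map [LHS]mxE !summxE [RHS]mxE -big_split /=; apply: eq_bigr => k _.
have C (f : 'I_n.+2 -> R) : (\sum_k f k *: delta_mx 0 k : 'rV[R]_(n.+2)) 0 k = f k.
  rewrite summxE (bigD1 k)//= !mxE !eqxx mulr1 big1 ?addr0// => l lk.
  by rewrite !mxE eq_sym (negbTE lk) mulr0.
rewrite [X in X + _]mxE [X in _ + X]mxE [X in _ + X * _]mxE !C.
ring.
Qed.

End LinearPushforward.

Definition cometric z := push_cometric (fun k => 'D_(base1 R k) P z) (fun k => 'D_(base2 R k) P z).
Let coord_gradient z := coord_dual (fun k => 'D_(base1 R k) P z) (fun k => 'D_(base2 R k) P z).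

Let dproj_lin_map z a : in_chart z ->
  dproj phi z a = lin_map (fun k => 'D_(base1 R k) P z) (fun k => 'D_(base2 R k) P z) a.
Proof.
by move=> az; rewrite dprojE derive_ambient; last exact/(coord_diff hphi)/in_chart_tube.
Qed.

Let kform_coord_gradient z a j : in_chart z -> kform a (coord_gradient z j) = dproj phi z a 0 j.
Proof. by move=> az; rewrite (dproj_lin_map a az); exact: kform_coord_dual. Qed.

Let dproj_coord_gradient z j i : in_chart z -> dproj phi z (coord_gradient z j) 0 i = cometric z i j.
Proof. by move=> az; rewrite (dproj_lin_map _ az); exact: lin_map_coord_dual. Qed.

(** The horizontal part of coord_gradient z j represents the j-th coordinate of dP
    for kform on horizontal vectors, hence its image represents the j-th coordinate
    for the metric downstairs. *)
Lemma gcoef_cometric z : in_chart z ->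
  (\matrix_(i, j) gcoef (gmetric phi) i j (P z)) *m cometric z = 1%:M.
Proof.
move=> az; apply/matrixP => i j.
have [a ha aE] := dproj_surj hphi (ebase R i) az.
transitivity (gmetric phi (P z) (ebase R i) (dproj phi z (coord_gradient z j))).
  have -> : dproj phi z (coord_gradient z j) = \sum_k cometric z k j *: ebase R k.
    rewrite {1}(row_sum_ebase (dproj phi z (coord_gradient z j))); apply: eq_bigr => k _.
    by rewrite (dproj_coord_gradient _ _ az).
  rewrite (gmetricC _ _ az) (gmetric_suml _ _ _ _ az) [LHS]mxE; apply: eq_bigr => k _.
  by rewrite [X in X * _]mxE (gmetricC _ _ az) mulrC.
rewrite -[in LHS]aE; apply: etrans (gmetric_dproj hphi a (coord_gradient z j) az) _.
rewrite (hor_id ha) kformC; apply: etrans (kform_hor _ ha) _.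
rewrite kformC; apply: etrans (kform_coord_gradient _ _ az) _.
by rewrite aE /ebase !mxE eqxx eq_sym.
Qed.

Lemma retract_diff z : T1H z -> differentiable (@retract R n) z.
Proof.
move=> Tz; have [[xx x0] xv vv] := Tz.
have nx : hnormalize z.1 = z.1 by rewrite /hnormalize xx opprK sqrtr1 invr1 scale1r.
have tv : tanproj z.1 z.2 = z.2 by rewrite /tanproj minkC xv scale0r addr0.
have d1 := differentiable_fst z; have d2 := differentiable_snd z.
have dn : differentiable (fun z : ambient2 R n => hnormalize z.1) z.
  apply: differentiable_scalef => //; apply: differentiableV.
    apply: differentiable_sqrt; first by rewrite xx opprK.
    by apply: differentiableN; exact: differentiable_mink.
  by rewrite xx opprK sqrtr1 oner_neq0.
have dt : differentiable (fun z : ambient2 R n => tanproj (hnormalize z.1) z.2) z.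
  apply: differentiableD => //; apply: differentiable_scalef => //.
  exact: differentiable_mink.
apply: differentiable_pair => //; apply: differentiable_scalef => //.
have e : mink (tanproj (hnormalize z.1) z.2) (tanproj (hnormalize z.1) z.2) = 1.
  by rewrite nx tv vv.
apply: differentiableV; last by rewrite e sqrtr1 oner_neq0.
apply: differentiable_sqrt; first by rewrite e.
exact: differentiable_mink.
Qed.

Lemma retract_dom_T1H z : retract_dom z -> T1H (retract z).
Proof.
case: z => x v [/= xx x0]; rewrite /T1H /retract /=.
have hx : mink (hnormalize x) (hnormalize x) = -1.
  have p : 0 < - mink x x by rewrite oppr_gt0.
  rewrite /hnormalize !minkB mulrA -expr2 exprVn sqr_sqrtr ?ltW//.
  by rewrite -[X in _ * X]opprK mulrN mulVf// gt_eqF.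
have hx0 : 0 < hnormalize x 0 ord_max.
  by rewrite mxE mulr_gt0// invr_gt0 sqrtr_gt0 oppr_gt0.
move: (hnormalize x) hx hx0 => a aa a0.
have ht : mink a (tanproj a v) = 0.
  by rewrite /tanproj !minkB aa minkC mulrN1 subrr.
move: (tanproj a v) ht => b ab b0; split=> //=.
  by rewrite minkZr ab mulr0.
by rewrite !minkB mulrA -expr2 exprVn sqr_sqrtr ?ltW// mulVf// gt_eqF.
Qed.

Lemma tube_in_chart z : tube phi z -> in_chart (retract z).
Proof. by move=> [/retract_dom_T1H Tz cz]. Qed.

Lemma coord_retract z : retract_dom z -> P (retract z) = P z.
Proof.
move=> /retract_dom_T1H /retract_T1H [_ E].
exact: (f_equal (fun w => cmap phi (gproj w)) E).
Qed.

(** With L a linear right inverse of dP at z0, the map y |-> P (z0 + L (y - P z0))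
    has the identity as derivative at P z0; precompose with its local right inverse
    and retract onto T^1H. *)
Lemma local_lift z0 : in_chart z0 ->
  exists S : 'rV[R]_(n + n) -> ambient2 R n,
    [/\ S (P z0) = z0, differentiable S (P z0) &
        \forall y \near P z0, in_chart (S y) /\ P (S y) = y].
Proof.
move=> az; have tz := in_chart_tube az.
have lift i : {a | dproj phi z0 a = ebase R i}.
  apply: cid; have [a _ aE] := dproj_surj hphi (ebase R i) az.
  by exists a.
pose L (xi : 'rV[R]_(n + n)) := \sum_i xi 0 i *: sval (lift i).
pose y0 := P z0.
pose A y := z0 + L (y - y0).
have dA y : differentiable A y.
  apply: differentiableD; first exact: differentiable_cst.
  apply: differentiable_sumf => i; apply: differentiableZl.
  apply: differentiable_entry; apply: differentiableB; first exact: ex_diff.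
  exact: differentiable_cst.
have DA y v : is_derive y v A (L v).
  rewrite -[L v]add0r; apply: is_deriveD.
  apply: is_derive_sumf => i.
  have c : is_derive y v (fun y => (y - y0) 0 i) (v 0 i).
    apply: is_derive_coord; rewrite -[X in is_derive _ _ _ X]subr0.
    exact: is_deriveB.
  have dc : differentiable (fun y => (y - y0) 0 i) y.
    apply: differentiable_entry; apply: differentiableB; first exact: ex_diff.
    exact: differentiable_cst.
  have dz := differentiableZl (sval (lift i)) dc.
  split; first exact: diff_derivable.
  rewrite deriveE// diffZl//= -deriveE//.
  by have [_ ->] := c.
have A0 : A y0 = z0 by rewrite /A subrr /L big1 ?addr0// => i _; rewrite mxE scale0r.
have nA : \forall y \near y0, tube phi (A y).
  have c := differentiable_continuous (dA y0).
  have c' : A @ y0 --> z0 by move: c; rewrite /prop_for /continuous_at A0.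
  apply: c'.
  apply: open_nbhs_nbhs; split; [exact: (open_tube hphi)|exact: tz].
pose Q y := P (A y).
have DQ y v : tube phi (A y) -> is_derive y v Q ('D_(L v) P (A y)).
  by move=> ty; apply: is_derive_chain (DA y v); exact: coord_diff.
have dQ : \forall y \near y0, differentiable Q y.
  apply: filterS nA => y ty.
  by apply: (@differentiable_comp _ _ _ _ A P) => //; exact: coord_diff.
have DQE v : {near y0, (fun y => 'D_(L v) P (A y)) =1 (fun y => 'D_v Q y)}.
  by apply: filterS nA => y ty; have [_ ->] := DQ y v ty.
have DQ0 v : 'D_(L v) P (A y0) = 'D_v Q y0 := nbhs_singleton (DQE v).
have cQ v : {for y0, continuous (fun y => 'D_v Q y)}.
  rewrite /prop_for /continuous_at -DQ0.
  apply: cvg_trans (near_eq_cvg (DQE v)) _.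
  apply: (@differentiable_continuous _ _ _ y0 (fun y => 'D_(L v) P (A y))).
  apply: (@differentiable_comp _ _ _ _ A (fun z => 'D_(L v) P z)) => //.
  by rewrite A0; exact: (dcoord_diff hphi).
have Q1 v : 'D_v Q y0 = v.
  rewrite -DQ0 A0 /L derive_lincomb; last exact: (coord_diff hphi).
  rewrite [RHS]row_sum_ebase; apply: eq_bigr => i _; congr (_ *: _).
  by case: (lift i) => a /=.
have Q0 : Q y0 = y0 by rewrite /Q A0.
have [Y [Y0 dY _ nY]] := local_right_inverse dQ cQ Q1 Q0.
exists (fun y => retract (A (Y y))); split.
- by rewrite Y0 A0 (retract_T1H az.1).2.
- apply: (@differentiable_comp _ _ _ _ (A \o Y) (@retract R n)).
    by apply: differentiable_comp.
  by rewrite /= Y0 A0; exact: retract_diff az.1.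
have nAY : \forall y \near y0, tube phi (A (Y y)).
  apply: (near_compose (Q := fun y => tube phi (A y)) (differentiable_continuous dY)).
  by rewrite Y0; exact: nA.
near=> y; have ty : tube phi (A (Y y)) by near: y.
split; first exact: tube_in_chart.
rewrite coord_retract; last by case: ty.
by near: y.
Unshelve. all: by end_near. Qed.

(** The metric is defined through chosen lifts, so its regularity is read off the
    cometric, evaluated along a local section of P. *)
Lemma gcoef_diff z0 i j : in_chart z0 ->
  differentiable (gcoef (gmetric phi) i j) (P z0).
Proof.
move=> az; have [S [S0 dS nS]] := local_lift az.
have dM : differentiable (fun y => cometric (S y)) (P z0).
  apply: differentiable_mx => k l; under eq_fun do rewrite mxE.
  apply: differentiable_sumf => m.
  apply: differentiableM; first exact: differentiable_cst.
  have D b l' : differentiable (fun y => 'D_b P (S y) 0 l') (P z0).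
    apply: differentiable_entry.
    apply: (@differentiable_comp _ _ _ _ S (fun z => 'D_b P z)) => //.
    by rewrite S0; apply: (dcoord_diff hphi); exact: in_chart_tube.
  by apply: differentiableB; apply: differentiableM; exact: D.
have uM : cometric (S (P z0)) \in unitmx.
  by rewrite S0; have /mulmx1_unit[] := gcoef_cometric az.
have N : \forall y \near P z0,
    invmx (cometric (S y)) i j = gcoef (gmetric phi) i j y.
  apply: filterS nS => y [ay Py]; have E := gcoef_cometric ay.
  have [_ u] := mulmx1_unit E.
  have -> : invmx (cometric (S y)) = \matrix_(i, j) gcoef (gmetric phi) i j (P (S y)).
    by rewrite -[LHS]mul1mx -E -mulmxA mulmxV// mulmx1.
  by rewrite mxE Py.
apply: near_eq_differentiable N _.
by apply: differentiable_entry; exact: differentiable_invmx.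
Qed.

End GcoefDifferentiable.

(** * The Levi-Civita connection on horizontal vectors *)

Section Koszul.
Context (R : realType) (n : nat) (phi : chart R (n + n) (set (ambient2 R n))).
Context (hphi : geodesic_chart phi).
Context (Gam : connection_on R (n + n)).
Context (hGam : levi_civita (cimg phi) (gmetric phi) Gam).
Implicit Types (z a b c : ambient2 R n) (y xi eta : 'rV[R]_(n + n)).
Local Notation P := (geodesic_coord phi).
Local Notation in_chart := (in_chart phi).

(** If dgm is the derivative of gm prescribed by metric compatibility of G, then
    the Leibniz rule for gm(A, B) along C, with U and V the derivatives of A and B,
    regroups into covariant derivatives. *)
Lemma contraction_identity m (gm : 'I_m -> 'I_m -> R) (dgm G : 'I_m -> 'I_m -> 'I_m -> R)
    (C A B U V : 'rV[R]_m) :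
  (forall (c i j : 'I_m), dgm c i j = \sum_d (G d c i * gm d j + G d c j * gm i d)) ->
  \sum_i \sum_j ((\sum_(c < m) C 0 c * dgm c i j) * A 0 i * B 0 j +
     gm i j * U 0 i * B 0 j + gm i j * A 0 i * V 0 j) =
  \sum_i \sum_j gm i j * (U 0 i + \sum_(b < m) \sum_(c < m) G i b c * C 0 b * A 0 c) * B 0 j +
  \sum_i \sum_j gm i j * A 0 i * (V 0 j + \sum_(b < m) \sum_(c < m) G j b c * C 0 b * B 0 c).
Proof.
move=> H.
have E1 : \sum_i \sum_j (\sum_(c < m) C 0 c * \sum_d G d c i * gm d j) * A 0 i * B 0 j =
    \sum_i \sum_j gm i j * (\sum_(b < m) \sum_(c < m) G i b c * C 0 b * A 0 c) * B 0 j.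
  rewrite exchange_big [RHS]exchange_big; apply: eq_bigr => j _ /=.
  rewrite -!mulr_suml; congr (_ * _).
  under eq_bigr do rewrite mulr_suml.
  under eq_bigr do under eq_bigr do rewrite mulr_sumr mulr_suml.
  under [RHS]eq_bigr do rewrite mulr_sumr.
  under [RHS]eq_bigr do under eq_bigr do rewrite mulr_sumr.
  rewrite exchange_big /= [RHS]exchange_big /=; apply: eq_bigr => c _.
  rewrite exchange_big /=; apply: eq_bigr => d _; apply: eq_bigr => i _; ring.
have E2 : \sum_i \sum_j (\sum_(c < m) C 0 c * \sum_d G d c j * gm i d) * A 0 i * B 0 j =
    \sum_i \sum_j gm i j * A 0 i * (\sum_(b < m) \sum_(c < m) G j b c * C 0 b * B 0 c).
  apply: eq_bigr => i _.
  under eq_bigr do rewrite !mulr_suml.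
  under eq_bigr do under eq_bigr do rewrite mulr_sumr !mulr_suml.
  under [RHS]eq_bigr do rewrite mulr_sumr.
  under [RHS]eq_bigr do under eq_bigr do rewrite mulr_sumr.
  rewrite exchange_big /= [RHS]exchange_big /=; apply: eq_bigr => c _.
  rewrite exchange_big /=; apply: eq_bigr => d _; apply: eq_bigr => j _; ring.
under [X in _ = X + _]eq_bigr do under eq_bigr do rewrite mulrDr mulrDl.
under [X in _ = _ + X]eq_bigr do under eq_bigr do rewrite mulrDr.
under [X in _ = X + _]eq_bigr do rewrite big_split.
under [X in _ = _ + X]eq_bigr do rewrite big_split.
rewrite !big_split /= -E1 -E2 addrACA addrC -!big_split /=.
apply: eq_bigr => i _; rewrite -!big_split /=; apply: eq_bigr => j _.
have -> : \sum_(c < m) C 0 c * dgm c i j = (\sum_(c < m) C 0 c * \sum_d G d c i * gm d j) +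
   (\sum_(c < m) C 0 c * \sum_d G d c j * gm i d).
  by rewrite -big_split; apply: eq_bigr => c _; rewrite H big_split mulrDr.
ring.
Qed.

Lemma row_addE m (A B : 'rV[R]_m) i : (A + B) 0 i = A 0 i + B 0 i.
Proof. by rewrite mxE. Qed.

Definition christoffel_term y xi eta : 'rV[R]_(n + n) :=
  \row_i \sum_j \sum_k Gam y i j k * xi 0 j * eta 0 k.

Lemma christoffel_term_sym y xi eta : (forall i j k, Gam y i j k = Gam y i k j) ->
  christoffel_term y xi eta = christoffel_term y eta xi.
Proof.
move=> s; apply/rowP => i; rewrite !mxE exchange_big; apply: eq_bigr => k _.
by apply: eq_bigr => l _; rewrite s mulrAC.
Qed.

Lemma christoffel_term_addl y xi xi' eta :
  christoffel_term y (xi + xi') eta = christoffel_term y xi eta + christoffel_term y xi' eta.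
Proof.
apply/rowP => i; rewrite !mxE -big_split.
apply: eq_bigr => k _; rewrite -big_split; apply: eq_bigr => l _ /=.
by rewrite mxE mulrDr mulrDl.
Qed.

(** The Hessian of the map P, for the flat connection of the ambient space and the
    given connection on coordinates. *)
Definition cov_hessian z a b : 'rV[R]_(n + n) :=
  'D_a (fun z => 'D_b P z) z + christoffel_term (P z) ('D_a P z) ('D_b P z).

(** Schwarz's theorem and the absence of torsion. *)
Lemma cov_hessian_sym z a b : in_chart z -> cov_hessian z a b = cov_hessian z b a.
Proof.
move=> az; have tz := in_chart_tube az; rewrite /cov_hessian; apply: (congr2 +%R).
  apply: (derive_swap _ (dcoord_diff hphi a tz) (dcoord_diff hphi b tz)).
  by apply: filterS (near_open (open_tube hphi) tz) => w; exact: (coord_diff hphi).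
have [s _] := hGam (in_chart_cimg az).
exact: christoffel_term_sym.
Qed.

Lemma cov_hessian_addl z a a' b : in_chart z -> cov_hessian z (a + a') b = cov_hessian z a b + cov_hessian z a' b.
Proof.
move=> az; have tz := in_chart_tube az; rewrite /cov_hessian.
rewrite (derive_add _ _ (dcoord_diff hphi b tz)) (derive_add _ _ (coord_diff hphi tz)).
by rewrite [RHS]addrACA christoffel_term_addl.
Qed.

Lemma kform_horE z a b : T1H z -> kform (hor z a) (hor z b) = kform a b
  + (mink a.1 z.1 * mink b.1 z.1 - mink a.1 z.2 * mink b.1 z.2)
  - (mink a.2 z.1 * mink b.2 z.1 - mink a.2 z.2 * mink b.2 z.2).
Proof.
move=> [[xx _] xv vv]; have vx : mink z.2 z.1 = 0 by rewrite minkC.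
rewrite /kform /= !minkB xx xv vv vx.
rewrite ![mink z.1 _]minkC ![mink z.2 _]minkC; ring.
Qed.

(** Along a curve in T^1H the metric of dP a and dP b, for constant a and b, is
    kform a b plus products of two pairings with the components of the curve.  At z
    both factors vanish as a and b are horizontal there, so the derivative is zero;
    metric compatibility expresses this derivative by Hessians. *)
Lemma metric_derivative z a b c (g : R -> ambient2 R n) : in_chart z ->
  g 0 = z -> is_derive (0 : R) (1 : R) g c ->
  (\forall h \near (0 : R), T1H (g h)) ->
  horver z a -> horver z b ->
  gmetric phi (P z) (cov_hessian z c a) ('D_b P z)
  + gmetric phi (P z) ('D_a P z) (cov_hessian z c b) = 0.
Proof.
move=> az g0 dg Tg ha hb; have tz := in_chart_tube az.
have ng : \forall h \near (0 : R), in_chart (g h).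
  have dgc : differentiable g 0 by apply/derivable1_diffP; case: dg.
  have t : \forall h \near (0 : R), tube phi (g h).
    apply: (near_compose (Q := tube phi) (differentiable_continuous dgc)).
    by rewrite g0; exact: (near_open (open_tube hphi)).
  near=> h; have Th : T1H (g h) by near: h.
  have th : tube phi (g h) by near: h.
  by rewrite -(retract_T1H Th).2; exact: tube_in_chart.
pose E (h : R) := \sum_i \sum_j gcoef (gmetric phi) i j (P (g h)) *
  'D_a P (g h) 0 i * 'D_b P (g h) 0 j.
pose F (h : R) := kform a b
  + (mink a.1 (g h).1 * mink b.1 (g h).1 - mink a.1 (g h).2 * mink b.1 (g h).2)
  - (mink a.2 (g h).1 * mink b.2 (g h).1 - mink a.2 (g h).2 * mink b.2 (g h).2).
have EF : {near (0 : R), E =1 F}.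
  apply: filterS ng => h ah; rewrite /E -(gmetric_sum hphi _ _ ah).
  by apply: etrans (gmetric_dproj hphi a b ah) _; rewrite kform_horE //; case: ah.
have dF : is_derive (0 : R) (1 : R) F 0.
  have d1 := is_derive_fst dg; have d2 := is_derive_snd dg.
  have M (u w : 'rV[R]_(n.+2)) (f : R -> 'rV[R]_(n.+2)) df :
     is_derive (0 : R) (1 : R) f df -> mink u (f 0) = 0 -> mink w (f 0) = 0 ->
     is_derive (0 : R) (1 : R) (fun h => mink u (f h) * mink w (f h)) 0.
    move=> fd u0 w0.
    have := is_derive_mul (is_derive_mink (is_derive_cst u (0:R) (1:R)) fd)
      (is_derive_mink (is_derive_cst w (0:R) (1:R)) fd).
    by rewrite u0 w0 mulr0 mul0r addr0.
  have [a1 a2 a3 a4] := ha; have [b1 b2 b3 b4] := hb.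
  rewrite -g0 in a1 a2 a3 a4 b1 b2 b3 b4.
  have := is_deriveB (is_deriveD (is_derive_cst (kform a b) (0:R) (1:R))
      (is_deriveB (M _ _ _ _ d1 a1 b1) (M _ _ _ _ d2 a2 b2)))
    (is_deriveB (M _ _ _ _ d1 a3 b3) (M _ _ _ _ d2 a4 b4)).
  by rewrite !subr0 addr0.
have dE : is_derive (0 : R) (1 : R) E 0.
  by apply: near_eq_is_derive dF; apply: filterS EF => h ->.
have dP : is_derive (0 : R) (1 : R) (fun h => P (g h)) ('D_c P z).
  rewrite -g0; apply: is_derive_chain => //.
  by rewrite g0; exact: coord_diff.
have dD e : is_derive (0 : R) (1 : R) (fun h => 'D_e P (g h)) ('D_c (fun z => 'D_e P z) z).
  rewrite -g0; apply: (is_derive_chain (f := fun z => 'D_e P z)) => //.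
  by rewrite g0; exact: (dcoord_diff hphi).
have dG i j : is_derive (0 : R) (1 : R) (fun h => gcoef (gmetric phi) i j (P (g h)))
    (\sum_k 'D_c P z 0 k * 'D_(ebase R k) (gcoef (gmetric phi) i j) (P z)).
  rewrite -[\sum_k _](derive_ebase _ (gcoef_diff hphi i j az)).
  have := is_derive_chain (f := gcoef (gmetric phi) i j) _ dP.
  by rewrite g0; apply; exact: gcoef_diff.
have [_ lc] := hGam (in_chart_cimg az).
have CI := contraction_identity ('D_c P z) ('D_a P z) ('D_b P z)
  ('D_c (fun z => 'D_a P z) z) ('D_c (fun z => 'D_b P z) z) (fun k i j => lc i j k).
have dE' := is_derive_sumf (index_enum 'I_(n + n)) (fun i =>
   is_derive_sumf (index_enum 'I_(n + n)) (fun j =>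
     is_derive_mul (is_derive_mul (dG i j) (is_derive_coord 0 i (dD a)))
       (is_derive_coord 0 j (dD b)))).
have [_ v1] := dE; have [_ v2] := dE'.
rewrite g0 in v2.
have {v1 v2} v3 := etrans (esym v2) v1.
have hE e i : cov_hessian z c e 0 i = 'D_c (fun z => 'D_e P z) z 0 i +
    \sum_j \sum_k Gam (P z) i j k * 'D_c P z 0 j * 'D_e P z 0 k.
  by apply: etrans (row_addE _ _ i) _; rewrite [X in _ + X]mxE.
rewrite (gmetric_sum hphi _ _ az) (gmetric_sum hphi _ _ az).
under eq_bigr do under eq_bigr do rewrite hE.
under [X in _ + X]eq_bigr do under eq_bigr do rewrite hE.
apply: etrans (esym CI) _; apply: etrans _ v3.
apply: eq_bigr => i _; apply: eq_bigr => j _.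
apply: (congr1 (+%R^~ _)); exact: (esym (mulrDl _ _ _)).
Unshelve. all: by end_near. Qed.

(** The Hessian is additive in c, whose horizontal and vertical parts are velocities
    of curves in T^1H. *)
Lemma metric_derivative_hor z a b c : in_chart z ->
  horver z a -> horver z b -> horver z c ->
  gmetric phi (P z) (cov_hessian z c a) ('D_b P z)
  + gmetric phi (P z) ('D_a P z) (cov_hessian z c b) = 0.
Proof.
move=> az ha hb hc.
have [h1 h2 h3 h4] := hc.
have ch : horver z (c.1, 0) by split => //=; rewrite mink0l.
have cv : horver z (0, c.2) by split => //=; rewrite mink0l.
have E1 : gmetric phi (P z) (cov_hessian z (c.1, 0) a) ('D_b P z)
  + gmetric phi (P z) ('D_a P z) (cov_hessian z (c.1, 0) b) = 0.
  have [g [g0 dg Tg]] := horizontal_curve az.1 ch.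
  apply: (metric_derivative (g := fun h => (g h, z.2)) az _ _ Tg ha hb).
    by rewrite g0; case: (z).
  exact: (is_derive_pair dg (is_derive_cst _ _ _)).
have E2 : gmetric phi (P z) (cov_hessian z (0, c.2) a) ('D_b P z)
  + gmetric phi (P z) ('D_a P z) (cov_hessian z (0, c.2) b) = 0.
  have [g [g0 dg Tg]] := vertical_curve az.1 cv.
  apply: (metric_derivative (g := fun h => (z.1, g h)) az _ _ Tg ha hb).
    by rewrite g0; case: (z).
  exact: (is_derive_pair (is_derive_cst _ _ _) dg).
have S : cov_hessian z c = cov_hessian z ((c.1, 0) + (0, c.2)).
  by congr cov_hessian; case: (c) => c1 c2; congr (_, _); rewrite /= ?addr0 ?add0r.
have D xi xi' eta : gmetric phi (P z) (xi + xi') eta =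
    gmetric phi (P z) xi eta + gmetric phi (P z) xi' eta.
  by have := gmetric_comb hphi 1 xi xi' eta az; rewrite scale1r mul1r.
have K xi xi' eta eta' A B :
    gmetric phi (P z) xi B + gmetric phi (P z) A eta = 0 ->
    gmetric phi (P z) xi' B + gmetric phi (P z) A eta' = 0 ->
    gmetric phi (P z) (xi + xi') B + gmetric phi (P z) A (eta + eta') = 0.
  rewrite ![gmetric phi (P z) A _](gmetricC A _ az) !D => e1 e2.
  by rewrite addrACA e1 e2 addr0.
rewrite S (cov_hessian_addl (c.1, 0) (0, c.2) a az) (cov_hessian_addl (c.1, 0) (0, c.2) b az).
exact: (K _ _ _ _ _ _ E1 E2).
Qed.

(** The permutation argument behind the uniqueness of the Levi-Civita
    connection. *)
Lemma skew_sym_zero (T : Type) (H : T -> Prop) (S : T -> T -> T -> R) :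
  (forall c d e : T, H c -> H d -> H e -> S c d e = - S c e d) ->
  (forall c d e : T, S c d e = S d c e) ->
  forall c d e : T, H c -> H d -> H e -> S c d e = 0.
Proof.
move=> skew sym c d e hc hd he.
have : S c d e = - S c d e.
  rewrite {1}(skew c d e)// (sym c e d) (skew e c d)// opprK (sym e d c).
  by rewrite (skew d e c)// (sym d c e).
move: (S c d e) => x; lra.
Qed.

(** The Hessian paired with dP is symmetric in its first two arguments and skew in its
    last two on horizontal vectors, hence zero; and dP of the horizontal vectors is
    everything. *)
Lemma cov_hessian_horver z a b : in_chart z -> horver z a -> horver z b -> cov_hessian z a b = 0.
Proof.
move=> az ha hb.
pose S c a b := gmetric phi (P z) (cov_hessian z c a) ('D_b P z).
have skew c d e : horver z c -> horver z d -> horver z e -> S c d e = - S c e d.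
  move=> hc hd he; apply/eqP; rewrite -subr_eq0 opprK; apply/eqP.
  have := metric_derivative_hor az hd he hc.
  by rewrite (gmetricC ('D_d P z) _ az).
have sym c d e : S c d e = S d c e by rewrite /S (cov_hessian_sym c d az).
have S0 c d e : horver z c -> horver z d -> horver z e -> S c d e = 0.
  exact: (skew_sym_zero (H := horver z) (S := S)).
have [e he eE] := dproj_surj hphi (cov_hessian z a b) az.
suff e0 : e = 0.
  have d0 := dproj_lin hphi 1 0 0 az; rewrite scale1r scale1r addr0 in d0.
  rewrite -eE e0; apply: (@addrI _ (dproj phi z 0)); rewrite addr0; exact: esym.
apply: (kform_hor_nondegenerate az.1 he) => d hd.
apply: etrans (esym (gmetric_lift hphi az he hd)) _; rewrite eE.
exact: S0.
Qed.

End Koszul.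

(** * Covariant derivatives of a map with horizontal lift *)

Lemma split_sums (R : realType) (W : normedModType R) (I : Type) (r : seq I)
    (p q p' q' : I -> R) (x y x' y' : I -> W) :
  \sum_(i <- r) (p i *: x i + q i *: y i) +
  \sum_(i <- r) (p' i *: x' i + q' i *: y' i) =
  (\sum_(i <- r) p i *: x i + \sum_(i <- r) p' i *: x' i) +
  (\sum_(i <- r) q i *: y i + \sum_(i <- r) q' i *: y' i).
Proof. by rewrite !big_split /= addrACA. Qed.

Section LegendrianLift.
Context (R : realType) (n : nat) (phi : chart R (n + n) (set (ambient2 R n))).
Context (hphi : geodesic_chart phi).
Context (Gam : connection_on R (n + n)).
Context (hGam : levi_civita (cimg phi) (gmetric phi) Gam).
Local Notation P := (geodesic_coord phi).
Local Notation in_chart := (in_chart phi).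

Context (zeta : 'rV[R]_n -> ambient2 R n) (u0 : 'rV[R]_n).
Context (dz : \forall u \near u0, differentiable zeta u).
Context (ddz : forall w, differentiable (fun u => 'D_w zeta u) u0).
Context (Tz : \forall u \near u0, T1H (zeta u)).
Context (cz : in_chart (zeta u0)).
Context (hz : forall w, horver (zeta u0) ('D_w zeta u0)).
Context (G : 'rV[R]_n -> 'rV[R]_(n + n)).
Context (hG : forall u, G u = cmap phi (gproj (zeta u))).

Let z0 := zeta u0.

Lemma lift_G : \forall u \near u0, P (zeta u) = G u.
Proof. by apply: filterS Tz => u Tu; rewrite hG coord_T1H. Qed.

Lemma lift_tube : \forall u \near u0, tube phi (zeta u).
Proof.
have d := nbhs_singleton dz.
apply: (near_compose (Q := tube phi) (differentiable_continuous d)).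
exact: (near_open (open_tube hphi) (in_chart_tube cz)).
Qed.

Lemma derive_G w : \forall u \near u0, 'D_('D_w zeta u) P (zeta u) = 'D_w G u.
Proof.
have nG := near_join lift_G.
near=> u.
have du : differentiable zeta u by near: u.
have tu : tube phi (zeta u) by near: u; exact: lift_tube.
have E : \forall u' \near u, P (zeta u') = G u' by near: u.
rewrite -(near_eq_derive w E).
by have [_ ->] := is_derive_chain (coord_diff hphi tu) (is_diff_derive w du).
Unshelve. all: by end_near. Qed.

Lemma derive_G0 w : 'D_w G u0 = dproj phi z0 ('D_w zeta u0).
Proof. exact: (esym (nbhs_singleton (derive_G w))). Qed.

(** By the chain rule the second derivative of P o zeta is dP of the second
    derivative of zeta plus a second derivative of P; with the connection term the
    latter is a Hessian on horizontal vectors. *)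
Lemma cov_deriv_G v w :
  cov_deriv Gam G v w u0 = dproj phi z0 ('D_v (fun u => 'D_w zeta u) u0).
Proof.
have tz := in_chart_tube cz.
pose a := 'D_v zeta u0; pose b := 'D_w zeta u0.
pose c := 'D_v (fun u => 'D_w zeta u) u0.
have d0 := nbhs_singleton dz.
have dw : is_derive u0 v (fun u => 'D_w zeta u) c by exact: is_diff_derive.
have dD e : is_derive u0 v (fun u => 'D_e P (zeta u)) ('D_a (fun z => 'D_e P z) z0).
  apply: (is_derive_chain (f := fun z => 'D_e P z)).
    exact: (dcoord_diff hphi).
  exact: is_diff_derive.
have E : \forall u \near u0,
   \sum_i ('D_w zeta u).1 0 i *: 'D_(base1 R i) P (zeta u) +
   \sum_i ('D_w zeta u).2 0 i *: 'D_(base2 R i) P (zeta u) = 'D_w G u.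
  near=> u; have tu : tube phi (zeta u) by near: u; exact: lift_tube.
  rewrite -(derive_ambient _ (coord_diff hphi tu)).
  by near: u; exact: derive_G.
have S1 := is_derive_sumf (index_enum 'I_n.+2) (fun i =>
  is_derive_scalef (is_derive_coord 0 i (is_derive_fst dw)) (dD (base1 R i))).
have S2 := is_derive_sumf (index_enum 'I_n.+2) (fun i =>
  is_derive_scalef (is_derive_coord 0 i (is_derive_snd dw)) (dD (base2 R i))).
have [_ S] := near_eq_is_derive E (is_deriveD S1 S2).
have Eb : \forall z \near z0,
   \sum_i b.1 0 i *: 'D_(base1 R i) P z + \sum_i b.2 0 i *: 'D_(base2 R i) P z
   = 'D_b P z.
  apply: filterS (near_open (open_tube hphi) tz) => z tz'.
  by rewrite -(derive_ambient _ (coord_diff hphi tz')).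
have Z e (k : R) : is_derive z0 a (fun z => k *: 'D_e P z)
    (k *: 'D_a (fun z => 'D_e P z) z0).
  apply: is_deriveZ; apply: is_diff_derive; exact: (dcoord_diff hphi).
have B1 := is_derive_sumf (index_enum 'I_n.+2) (fun i => Z (base1 R i) (b.1 0 i)).
have B2 := is_derive_sumf (index_enum 'I_n.+2) (fun i => Z (base2 R i) (b.2 0 i)).
have [_ SB] := near_eq_is_derive Eb (is_deriveD B1 B2).
have ST : 'D_v (fun u => 'D_w G u) u0 = dproj phi z0 c + 'D_a (fun z => 'D_b P z) z0.
  apply: etrans S _; apply: etrans (split_sums _ _ _ _ _ _ _ _ _) _.
  apply: (congr2 +%R); last exact: esym SB.
  exact: esym (derive_ambient c (coord_diff hphi tz)).
have H0 := cov_hessian_horver hphi hGam cz (hz v) (hz w).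
transitivity (dproj phi z0 c + cov_hessian phi Gam z0 a b); last by rewrite H0 addr0.
rewrite /cov_deriv ST -addrA; apply: (congr1 (+%R _)); apply: (congr1 (+%R _)).
rewrite !derive_G0 -(nbhs_singleton lift_G).
by [].
Unshelve. all: by end_near. Qed.

End LegendrianLift.

(** * Frames and Gram matrices *)

Section Gram.
Context (R : realType) (n : nat).

Definition gram k l (A : 'M[R]_(k, n.+2)) (A' : 'M[R]_(l, n.+2)) : 'M[R]_(k, l) :=
  A *m diag_mx (\row_i mink_sign R i) *m A'^T.

Lemma gramE k l (A : 'M[R]_(k, n.+2)) (A' : 'M[R]_(l, n.+2)) i j :
  gram A A' i j = mink (row i A) (row j A').
Proof.
rewrite minkE /gram mul_mx_diag !mxE; apply: eq_bigr => m _.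
by rewrite !mxE mulrCA mulrA.
Qed.

Lemma gram_mull k l m (X : 'M[R]_(m, k)) (A : 'M[R]_(k, n.+2)) (A' : 'M[R]_(l, n.+2)) :
  gram (X *m A) A' = X *m gram A A'.
Proof. by rewrite /gram !mulmxA. Qed.

Lemma gram_mulr k l m (X : 'M[R]_(m, l)) (A : 'M[R]_(k, n.+2)) (A' : 'M[R]_(l, n.+2)) :
  gram A (X *m A') = gram A A' *m X^T.
Proof. by rewrite /gram trmx_mul !mulmxA. Qed.

Lemma gramT k l (A : 'M[R]_(k, n.+2)) (A' : 'M[R]_(l, n.+2)) : (gram A A')^T = gram A' A.
Proof. by apply/matrixP => i j; rewrite mxE !gramE minkC. Qed.

Lemma row_id (x : 'rV[R]_(n.+2)) i : row i x = x.
Proof. by apply/rowP => j; rewrite mxE ord1. Qed.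

Lemma gram11 (x y : 'rV[R]_(n.+2)) i j : gram x y i j = mink x y.
Proof. by rewrite gramE !row_id. Qed.

Lemma gram1r l (x : 'rV[R]_(n.+2)) (A : 'M[R]_(l, n.+2)) j : gram x A 0 j = mink x (row j A).
Proof. by rewrite gramE row_id. Qed.

End Gram.

(** At a point of an immersed hypersurface x is the position, v the unit normal, and
    the rows of e are the coordinate tangent vectors. *)

Section Frame.
Context (R : realType) (n : nat) (x v : 'rV[R]_(n.+2)) (e : 'M[R]_(n, n.+2)).
Context (xx : mink x x = -1) (xv : mink x v = 0) (vv : mink v v = 1).
Context (ex : forall i, mink (row i e) x = 0) (ev : forall i, mink (row i e) v = 0).
Context (fr : \det (col_mx (col_mx v x) e) != 0).

Let F : 'M[R]_(1 + 1 + n, n.+2) := col_mx (col_mx v x) e.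

Lemma frame_expand (w : 'rV[R]_(n.+2)) :
  exists a b c, w = a *: v + b *: x + c *m e.
Proof.
have uF : (col_mx (col_mx v x) e : 'M[R]_(n.+2)) \in unitmx.
  by rewrite unitmxE unitfE.
pose r : 'rV[R]_(1 + 1 + n) := w *m invmx (col_mx (col_mx v x) e : 'M[R]_(n.+2)).
have E : w = r *m F by rewrite /r mulmxKV.
exists (lsubmx (lsubmx r) 0 0), (rsubmx (lsubmx r) 0 0), (rsubmx r).
rewrite {1}E -{1}[r]hsubmxK -{1}[lsubmx r]hsubmxK /F !mul_row_col.
by rewrite {1}[lsubmx (lsubmx r)]mx11_scalar {1}[rsubmx (lsubmx r)]mx11_scalar !mul_scalar_mx.
Qed.

Lemma mink_mulmx m (c : 'rV[R]_m) (A : 'M[R]_(m, n.+2)) y :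
  mink (c *m A) y = \sum_i c 0 i * mink (row i A) y.
Proof. by rewrite mulmx_sum_row mink_suml; apply: eq_bigr => i _; rewrite minkZl. Qed.

Lemma mink_ex c : mink (c *m e) x = 0.
Proof. by rewrite mink_mulmx big1// => i _; rewrite ex mulr0. Qed.

Lemma mink_ev c : mink (c *m e) v = 0.
Proof. by rewrite mink_mulmx big1// => i _; rewrite ev mulr0. Qed.

Lemma frame_nondegenerate w : mink w v = 0 -> mink w x = 0 ->
  (forall i, mink w (row i e) = 0) -> w = 0.
Proof.
move=> wv wx we; apply: mink_nondegenerate => y.
have [a [b [c ->]]] := frame_expand y.
rewrite !minkDr !minkZr wv wx minkC mink_mulmx big1 ?mulr0 ?addr0// => i _.
by rewrite minkC we mulr0.
Qed.

Lemma frame_span w : mink w v = 0 -> mink w x = 0 -> exists c, w = c *m e.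
Proof.
move=> wv wx; have [a [b [c E]]] := frame_expand w.
have vx : mink v x = 0 by rewrite minkC.
have a0 : a = 0 by rewrite -wv E !minkDl !minkZl mink_ev vv xv; ring.
have b0 : b = 0.
  by apply/eqP; rewrite -oppr_eq0 -wx E !minkDl !minkZl mink_ex xx vx; apply/eqP; ring.
by exists c; rewrite E a0 b0 !scale0r !add0r.
Qed.

(** A vector in the kernel is the coefficient vector of a tangent vector that is
    orthogonal to the whole frame. *)
Lemma first_gram_unit : gram e e \in unitmx.
Proof.
rewrite -row_free_unit; apply: inj_row_free => c c0.
have w0 : c *m e = 0.
  apply: frame_nondegenerate; [exact: mink_ev|exact: mink_ex|move=> i].
  by rewrite -gram1r gram_mull c0 mxE.
have uF : (col_mx (col_mx v x) e : 'M[R]_(n.+2)) \in unitmx.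
  by rewrite unitmxE unitfE.
pose r : 'rV[R]_(1 + 1 + n) := row_mx (row_mx (0 : 'M[R]_1) (0 : 'M[R]_1)) c.
have E : r *m F = 0 by rewrite /r /F !mul_row_col !mul0mx !add0r.
have r0 : r = 0.
  by rewrite -[LHS](mulmxK uF); apply: etrans (congr1 (mulmx^~ _) E) (mul0mx _ _).
by rewrite -[c](row_mxKr (row_mx (0 : 'M[R]_1) (0 : 'M[R]_1))) -/r r0 linear0.
Qed.

End Frame.

(** * The metric induced by the Gauss map *)

Section TraceIdentity.
Context (R : realType) (n : nat) (I B A dh : 'M[R]_n).
Context (Iu : I \in unitmx) (IT : I^T = I) (BI : (B *m I)^T = B *m I).
Context (u1 : 1%:M - B \in unitmx) (u2 : 1%:M + B \in unitmx).

(** The metric <W, W'> - <BW, BW'> that the Gauss map induces; B acts on row vectors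
    from the right. *)
Definition gauss_gram : 'M[R]_n := I - B *m I *m B^T.
Let K := invmx gauss_gram.
Let IBT : I *m B^T = B *m I. Proof. by rewrite -BI trmx_mul IT. Qed.

(** The two factorisations of (1 - B^2) I show that the inverse of the
    induced metric, multiplied by 1 - B or 1 + B, inverts I + BI or I - BI. *)
Lemma gauss_gramE1 : gauss_gram = (1%:M - B) *m (I + B *m I).
Proof.
rewrite /gauss_gram -mulmxA IBT mulmxDr !mulmxBl !mul1mx.
by rewrite addrA subrK.
Qed.

Lemma gauss_gramE2 : gauss_gram = (1%:M + B) *m (I - B *m I).
Proof.
rewrite /gauss_gram -mulmxA IBT mulmxBr !mulmxDl !mul1mx.
by rewrite opprD addrA addrK.
Qed.

Lemma gauss_gramT : gauss_gram^T = gauss_gram.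
Proof. by rewrite /gauss_gram linearB /= IT !trmx_mul trmxK IT mulmxA. Qed.

Lemma add_gram_unit : I + B *m I \in unitmx.
Proof. by rewrite -{1}[I]mul1mx -mulmxDl unitmx_mul u2 Iu. Qed.

Lemma sub_gram_unit : I - B *m I \in unitmx.
Proof. by rewrite -{1}[I]mul1mx -mulmxBl unitmx_mul u1 Iu. Qed.

Lemma gauss_gram_unit : gauss_gram \in unitmx.
Proof. by rewrite gauss_gramE1 unitmx_mul u1 add_gram_unit. Qed.

Lemma invmx_add_gram : invmx (I + B *m I) = K *m (1%:M - B).
Proof.
have E : K *m (1%:M - B) *m (I + B *m I) = 1%:M.
  by rewrite -mulmxA -gauss_gramE1 mulVmx// gauss_gram_unit.
by rewrite -[RHS](mulmxK add_gram_unit) E mul1mx.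
Qed.

Lemma invmx_sub_gram : invmx (I - B *m I) = K *m (1%:M + B).
Proof.
have E : K *m (1%:M + B) *m (I - B *m I) = 1%:M.
  by rewrite -mulmxA -gauss_gramE2 mulVmx// gauss_gram_unit.
by rewrite -[RHS](mulmxK sub_gram_unit) E mul1mx.
Qed.

Lemma KB_sym : (K *m B)^T = K *m B.
Proof.
have KT : K^T = K by rewrite /K trmx_inv gauss_gramT.
have E : B *m gauss_gram = gauss_gram *m B^T.
  rewrite /gauss_gram mulmxBr mulmxBl -[in B *m I *m B^T](mulmxA B) IBT.
  by rewrite !mulmxA -!(mulmxA _ I) !IBT !mulmxA.
rewrite trmx_mul KT -[LHS]mul1mx -(mulVmx gauss_gram_unit) -!mulmxA.
by rewrite [gauss_gram *m _]mulmxA -E -mulmxA (mulmxV gauss_gram_unit) mulmx1.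
Qed.

(** With A = <sigma_mi, sigma_j> and dh the derivative of the second form BI, the
    left side is the trace of the cubic form C_mij for the induced metric, while
    the right side is what Jacobi's formula gives for the derivative of
    (1/2) ln (det (I + BI) / det (I - BI)).  Everything reduces to the inverses
    above and to the symmetry of K B. *)
Lemma trace_identity : \tr (K *m (dh - A *m B^T - B *m A^T)) =
  2^-1 * (\tr ((A + A^T + dh) *m invmx (I + B *m I)) -
          \tr ((A + A^T - dh) *m invmx (I - B *m I))).
Proof.
rewrite invmx_add_gram invmx_sub_gram.
have KT : K^T = K by rewrite /K trmx_inv gauss_gramT.
have S (X : 'M[R]_n) : \tr (X^T *m (K *m B)) = \tr (X *m (K *m B)).
  by rewrite -mxtrace_tr trmx_mul trmxK KB_sym mxtrace_mulC.
have e1 : \tr (K *m (A *m B^T)) = \tr (A *m (K *m B)).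
  rewrite -S -mxtrace_tr !trmx_mul trmxK KT mxtrace_mulC !mulmxA.
  by rewrite mxtrace_mulC !mulmxA mxtrace_mulC !mulmxA.
have e2 : \tr (K *m (B *m A^T)) = \tr (A *m (K *m B)).
  by rewrite -S mulmxA mxtrace_mulC.
rewrite !(mulmxBr, mulmxDr, mulmx1) !(mulmxDl, mulmxBl) !mulNmx !(mxtraceD, raddfB, raddfN) /=.
rewrite !S e1 e2 (mxtrace_mulC K dh).
have -> : \tr (A^T *m K) = \tr (A *m K) by rewrite -mxtrace_tr trmx_mul trmxK KT mxtrace_mulC.
by rewrite !mxtraceD S; field.
Qed.

End TraceIdentity.

(** * The normal bundle of the Gauss map *)

Section Jet.
Context (R : realType) (n : nat) (z : ambient2 R n) (e : 'M[R]_(n, n.+2)) (B : 'M[R]_n).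
Context (Tz : T1H z).
Context (ex : forall i, mink (row i e) z.1 = 0) (ev : forall i, mink (row i e) z.2 = 0).
Context (fr : \det (col_mx (col_mx z.2 z.1) e) != 0).
Context (I : 'M[R]_n) (IE : I = gram e e).
Context (BI : (B *m I)^T = B *m I).
Context (u1 : 1%:M - B \in unitmx) (u2 : 1%:M + B \in unitmx).
Implicit Types (W : 'rV[R]_n) (a b c : ambient2 R n).

Lemma kformDl a b c : kform (a + b) c = kform a c + kform b c.
Proof. by have := kform_comb 1 a b c; rewrite scale1r mul1r. Qed.

Lemma kformZl (r : R) a c : kform (r *: a) c = r * kform a c.
Proof.
have := kform_comb r a 0 c; rewrite addr0 => ->.
by rewrite /kform /= !mink0l subrr addr0.
Qed.

Lemma kform_suml (J : Type) (s : seq J) (F : J -> ambient2 R n) c :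
  kform (\sum_(i <- s) F i) c = \sum_(i <- s) kform (F i) c.
Proof.
elim: s => [|j s IH]; first by rewrite !big_nil /kform /= !mink0l subrr.
by rewrite !big_cons kformDl IH.
Qed.

Lemma kformBl a b c : kform (a - b) c = kform a c - kform b c.
Proof. by rewrite kformDl -scaleN1r kformZl mulN1r. Qed.

(** The derivative of (sigma, nu) in the direction W, by Weingarten's formula. *)
Definition tanlift W : ambient2 R n := (W *m e, - (W *m B *m e)).

Lemma horver_tanlift W : horver z (tanlift W).
Proof.
by split; rewrite /= ?minkNl ?(mink_ex ex) ?(mink_ev ev) ?oppr0.
Qed.

Let mink_ee W W' : mink (W *m e) (W' *m e) = (W *m I *m W'^T) 0 0.
Proof. by rewrite -(gram11 _ _ 0 0) gram_mull gram_mulr -IE mulmxA. Qed.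

Let IT : I^T = I. Proof. by rewrite IE gramT. Qed.
Let Iu : I \in unitmx.
Proof. by have [[xx _] xv vv] := Tz; rewrite IE; exact: (first_gram_unit ex ev fr). Qed.
Let IBT : I *m B^T = B *m I. Proof. by rewrite -BI trmx_mul IT. Qed.
Let gh := gauss_gram I B.
Let K := invmx gh.
Let ghu : gh \in unitmx. Proof. exact: gauss_gram_unit. Qed.

Lemma kform_tanlift W W' : kform (tanlift W) (tanlift W') = (W *m gh *m W'^T) 0 0.
Proof.
rewrite /kform /= minkNl minkNr opprK !mink_ee /gh /gauss_gram.
rewrite mulmxBr mulmxBl [RHS]mxE; congr (_ + _); rewrite [RHS]mxE; congr (- _).
by rewrite trmx_mul !mulmxA.
Qed.

(** The Gauss map is Lagrangian because the second form is symmetric. *)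
Lemma kform_tanlift_swap W W' : kform (tanlift W) (swap (tanlift W')) = 0.
Proof.
rewrite /kform /= minkNl minkNr !mink_ee opprK trmx_mul !mulmxA.
by rewrite -(mulmxA W I) IBT mulmxA addNr.
Qed.

Lemma kform_swap2 a b : kform (swap a) (swap b) = - kform a b.
Proof. by rewrite /kform /= [RHS]opprB. Qed.

Lemma kform_swapC a b : kform (swap a) b = - kform a (swap b).
Proof. by rewrite -kform_swap2. Qed.

Lemma horver_span a : horver z a -> exists p q, a = (p *m e, q *m e).
Proof.
move=> [h1 h2 h3 h4]; have [[xx _] xv vv] := Tz.
have [p pE] := frame_span xx xv vv ex ev fr h2 h1.
have [q qE] := frame_span xx xv vv ex ev fr h4 h3.
by exists p, q; rewrite -pE -qE; case: (a).
Qed.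

Let row_eq0 (w : 'rV[R]_n) : (forall m, (w *m (ebase R m)^T) 0 0 = 0) -> w = 0.
Proof.
move=> H; apply/rowP => m; rewrite [RHS]mxE -(H m) /ebase trmx_delta.
by rewrite -colE mxE.
Qed.

(** Tangent vectors of the Gauss map and their images under J span the horizontal
    space, because the induced metric is nondegenerate. *)
Lemma jet_nondegenerate a : horver z a ->
  (forall m, kform a (tanlift (ebase R m)) = 0) ->
  (forall m, kform a (swap (tanlift (ebase R m))) = 0) -> a = 0.
Proof.
move=> /horver_span[p [q ->]] H1 H2.
have E1 : p *m I + q *m I *m B^T = 0.
  apply: row_eq0 => m; rewrite -(H1 m) /kform /= minkNr opprK !mink_ee trmx_mul.
  by rewrite mulmxDl [LHS]mxE !mulmxA.
have E2 : p *m I *m B^T + q *m I = 0.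
  apply: row_eq0 => m; apply/eqP; rewrite -oppr_eq0 -(H2 m) /kform /= minkNr !mink_ee trmx_mul.
  by rewrite mulmxDl mxE opprD !mulmxA.
have pI : p *m I = - (q *m I *m B^T) by apply/eqP; rewrite -addr_eq0 E1.
have Q : q *m gh = 0.
  rewrite /gh /gauss_gram mulmxBr -[B *m I]IBT !mulmxA.
  by move: E2; rewrite pI mulNmx addrC.
have q0 : q = 0 by rewrite -[q](mulmxK ghu) Q mul0mx.
have p0 : p = 0 by rewrite -[p](mulmxK Iu) pI q0 !mul0mx oppr0 mul0mx.
by rewrite p0 q0 !mul0mx.
Qed.

Lemma kform_tanlift_ebase i j :
  kform (tanlift (ebase R i)) (tanlift (ebase R j)) = gh i j.
Proof. by rewrite kform_tanlift /ebase trmx_delta -rowE -colE !mxE. Qed.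

(* Q collects the second derivatives of the lift and r is 1 / n; the assumption says
   that the trace of the cubic form is the differential dphi. *)
Context (Q : 'I_n -> 'I_n -> ambient2 R n) (dphi : 'rV[R]_n) (r : R).
Context (hQ : forall m, r * (\sum_i \sum_j K i j * kform (Q i j) (swap (tanlift (ebase R m))))
   = dphi 0 m).

Definition normal_lift a : ambient2 R n :=
  a - \sum_k \sum_l (K k l * kform a (tanlift (ebase R k))) *: tanlift (ebase R l).

Definition mean_lift : ambient2 R n := r *: \sum_i \sum_j K i j *: normal_lift (Q i j).

Lemma normal_lift_tangent a m : kform (normal_lift a) (tanlift (ebase R m)) = 0.
Proof.
rewrite /normal_lift kformBl kform_suml.
under eq_bigr => k _.
  rewrite kform_suml.
  under eq_bigr do rewrite kformZl kform_tanlift_ebase mulrAC.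
  rewrite -mulr_suml.
  have -> : \sum_l K k l * gh l m = (k == m)%:R.
    by have := congr1 (fun A : 'M[R]_n => A k m) (mulVmx ghu); rewrite !mxE.
  over.
rewrite (bigD1 m)//= eqxx mul1r big1 ?addr0 ?subrr// => k km.
by rewrite (negbTE km) mul0r.
Qed.

Lemma normal_lift_swap a m : kform (normal_lift a) (swap (tanlift (ebase R m))) =
  kform a (swap (tanlift (ebase R m))).
Proof.
rewrite /normal_lift kformBl kform_suml big1 ?subr0// => k _.
by rewrite kform_suml big1// => l _; rewrite kformZl kform_tanlift_swap mulr0.
Qed.

(** Both sides have the same products with the tangent vectors, namely 0, and with
    their images under J. *)
Lemma mean_lift_hor : hor z mean_lift = swap (tanlift (- dphi *m K)).
Proof.
set W := - dphi *m K.
have Wg : W *m gh = - dphi by rewrite /W mulmxKV.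
apply/eqP; rewrite -subr_eq0; apply/eqP; apply: jet_nondegenerate => [|m|m].
- rewrite addrC -scaleN1r; apply: horver_comb; last exact: hor_horver.
  exact/horver_swap/horver_tanlift.
- rewrite kformBl (kform_hor _ (horver_tanlift _)) kform_swapC kform_tanlift_swap.
  rewrite opprK addr0 kformZl kform_suml big1 ?mulr0// => i _.
  by rewrite kform_suml big1// => j _; rewrite kformZl normal_lift_tangent mulr0.
rewrite kformBl (kform_hor _ (horver_swap (horver_tanlift _))) kform_swap2.
rewrite kform_tanlift Wg opprK kformZl kform_suml.
under eq_bigr do rewrite kform_suml.
under eq_bigr do under eq_bigr do rewrite kformZl normal_lift_swap.
by rewrite hQ mulNmx /ebase trmx_delta -colE !mxE subrr.
Qed.

End Jet.

(** * Smoothness of the unit normal *)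

Section UnitNormal.
Context (R : realType) (n : nat).

(** The vector that represents y |-> det (y, x, e) for the Minkowski product: the
    analogue of the cross product of the tangent vectors. *)
Definition cross (x : 'rV[R]_(n.+2)) (e : 'M[R]_(n, n.+2)) : 'rV[R]_(n.+2) :=
  \row_j (mink_sign R j *
    cofactor (col_mx (col_mx (0 : 'rV[R]_(n.+2)) x) e : 'M[R]_(n.+2)) ord0 j).

Lemma mink_cross (x y : 'rV[R]_(n.+2)) (e : 'M[R]_(n, n.+2)) :
  mink y (cross x e) = \det (col_mx (col_mx y x) e : 'M[R]_(n.+2)).
Proof.
pose M (w : 'rV[R]_(n.+2)) : 'M[R]_(1 + 1 + n, n.+2) := col_mx (col_mx w x) e.
have M0 w j : M w (lshift n (lshift 1 0)) j = w 0 j by rewrite /M !col_mxEu.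
have MS w w' (i : 'I_n.+1) j : M w (lift (ord0 : 'I_n.+2) i) j = M w' (lift (ord0 : 'I_n.+2) i) j.
  rewrite /M; case: (split_ordP (lift (ord0 : 'I_n.+2) i : 'I_(1 + 1 + n))) => l E.
    rewrite E !col_mxEu; case: (split_ordP l) => m Em; last by rewrite Em !col_mxEd.
    by have /(congr1 val) := E; rewrite Em /= ord1.
  by rewrite E !col_mxEd.
rewrite (expand_det_row _ (ord0 : 'I_n.+2)) minkE; apply: eq_bigr => j _.
rewrite [cross x e 0 j]mxE.
have -> : (col_mx (col_mx y x) e : 'M[R]_(n.+2)) ord0 j = y 0 j.
  rewrite -(M0 y j) /M; congr (col_mx _ _ _ _); exact: val_inj.
have -> : cofactor (col_mx (col_mx y x) e : 'M[R]_(n.+2)) ord0 j =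
          cofactor (M 0 : 'M[R]_(n.+2)) ord0 j.
  rewrite /cofactor; congr (_ * \det _); apply/matrixP => i k.
  rewrite [LHS]mxE [LHS]mxE [RHS]mxE [RHS]mxE; exact: MS.
move: (cofactor _ _ _) => k.
transitivity (mink_sign R j * mink_sign R j * (y 0 j * k)); first by ring.
by rewrite mink_sign_sqr mul1r.
Qed.

(** The unit normal is determined by orthogonality and orientation alone, so it is
    the normalised cross product. *)
Lemma unit_normal_cross (x v : 'rV[R]_(n.+2)) (e : 'M[R]_(n, n.+2)) (o : bool) :
  mink x x = -1 -> mink x v = 0 -> mink v v = 1 ->
  (forall i, mink (row i e) x = 0) -> (forall i, mink (row i e) v = 0) ->
  0 < (-1) ^+ o * \det (col_mx (col_mx v x) e : 'M[R]_(n.+2)) ->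
  0 < mink (cross x e) (cross x e) /\
  v = ((-1) ^+ o * (Num.sqrt (mink (cross x e) (cross x e)))^-1) *: cross x e.
Proof.
move=> xx xv vv ex ev; set d := \det _ => d0.
have dn : d != 0 by apply: contraTneq d0 => ->; rewrite mulr0 ltxx.
have vx : mink v x = 0 by rewrite minkC.
have E : cross x e = d *: v.
  apply/eqP; rewrite -subr_eq0; apply/eqP.
  apply: (frame_nondegenerate (v := v) (x := x) (e := e)) => //.
  - by rewrite minkDl minkNl minkZl vv mulr1 minkC mink_cross subrr.
  - rewrite minkDl minkNl minkZl vx mulr0 subr0 minkC mink_cross.
    apply: (determinant_alternate (i1 := lshift n (lshift 1 (0 : 'I_1)) : 'I_(1 + 1 + n))
      (i2 := lshift n (rshift 1 (0 : 'I_1)) : 'I_(1 + 1 + n))) => //.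
    by move=> j; rewrite !col_mxEu col_mxEd.
  move=> i; rewrite minkDl minkNl minkZl minkC mink_cross.
  rewrite [mink v _]minkC ev mulr0 subr0.
  apply: (determinant_alternate (i1 := lshift n (lshift 1 (0 : 'I_1)) : 'I_(1 + 1 + n))
      (i2 := rshift (1 + 1) i : 'I_(1 + 1 + n))) => //.
  by move=> j; rewrite !col_mxEu col_mxEd mxE.
rewrite E minkZl minkZr vv mulr1 -expr2 sqrtr_sqr.
split; first by rewrite exprn_even_gt0.
have n0 : `|d| != 0 by rewrite normr_eq0.
rewrite scalerA -mulrA; have -> : (-1) ^+ o * (`|d|^-1 * d) = 1.
  rewrite mulrCA -[X in _ * X]gtr0_norm// normrM normr_sign mul1r mulVf//.
by rewrite scale1r.
Qed.

Lemma Ck_on_col_mx (V : normedModType R) (U : set V) k m1 m2 m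
    (A : V -> 'M[R]_(m1, m)) (C : V -> 'M[R]_(m2, m)) :
  (forall i j, Ck_on k U (fun q => A q i j)) ->
  (forall i j, Ck_on k U (fun q => C q i j)) ->
  forall i j, Ck_on k U (fun q => col_mx (A q) (C q) i j).
Proof.
by move=> hA hC i j; under eq_fun do rewrite mxE; case: (fintype.split i).
Qed.

Lemma Ck_on_cross (V : normedModType R) (U : set V) (Uo : open U) k
    (F : V -> 'rV[R]_(n.+2)) (e : V -> 'M[R]_(n, n.+2)) :
  Ck_on k U F -> Ck_on k U e -> Ck_on k U (fun q => cross (F q) (e q)).
Proof.
move=> hF he; apply: Ck_on_mx => // i j; under eq_fun do rewrite mxE.
apply: Ck_on_mul => //; first exact: Ck_on_cst.
apply: Ck_on_mul => //; first exact: Ck_on_cst.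
apply: Ck_on_det => // a b.
have H : forall i j, Ck_on k U (fun q => col_mx (col_mx (0 : 'rV[R]_(n.+2)) (F q)) (e q) i j).
  apply: Ck_on_col_mx => [|c d]; last exact: Ck_on_entry.
  apply: Ck_on_col_mx => [c d|c d]; last exact: Ck_on_entry.
  exact: Ck_on_cst.
refine (eq_Ck_on Uo _ (H (lift (ord0 : 'I_n.+2) a) (lift j b))) => q _.
by rewrite [RHS]mxE [RHS]mxE.
Qed.

(** The normal field is characterised pointwise; its smoothness comes from its formula
    in terms of the immersion. *)
Lemma smooth_unit_normal (V : normedModType R) (U : set V) (Uo : open U) (o : bool)
    (F N : V -> 'rV[R]_(n.+2)) (e : V -> 'M[R]_(n, n.+2)) :
  smooth_on U F -> smooth_on U e ->
  (forall q, U q -> mink (F q) (F q) = -1 /\ mink (F q) (N q) = 0 /\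
    mink (N q) (N q) = 1) ->
  (forall q i, U q -> mink (row i (e q)) (F q) = 0 /\ mink (row i (e q)) (N q) = 0) ->
  (forall q, U q -> 0 < (-1) ^+ o *
     \det (col_mx (col_mx (N q) (F q)) (e q) : 'M[R]_(n.+2))) ->
  smooth_on U N.
Proof.
move=> hF he h1 h2 h3 k.
have C := Ck_on_cross Uo (hF k) (he k).
have H q : U q -> _ := fun Uq => unit_normal_cross (h1 q Uq).1 (h1 q Uq).2.1 (h1 q Uq).2.2
   (fun i => (h2 q i Uq).1) (fun i => (h2 q i Uq).2) (h3 q Uq).
refine (eq_Ck_on Uo (fun q Uq => esym (H q Uq).2) _).
apply: Ck_on_mx => // i j; under eq_fun do rewrite mxE.
apply: Ck_on_mul => //; last exact: Ck_on_entry.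
apply: Ck_on_mul => //; first exact: Ck_on_cst.
apply: Ck_on_inv => //.
  by move=> q Uq; rewrite gt_eqF// sqrtr_gt0; exact: (H q Uq).1.
apply: Ck_on_sqrt => //; first by move=> q Uq; exact: (H q Uq).1.
exact: Ck_on_mink.
Qed.

End UnitNormal.

(** * The speed as a logarithm of determinants *)

Section SymmetricFunction.
Context (R : realType).

Lemma horner_char_poly n (B : 'M[R]_n) a : (char_poly B).[a] = \det (a%:M - B).
Proof.
rewrite -horner_evalE -det_map_mx; congr (\det _); apply/matrixP => i j.
by rewrite !mxE /= horner_evalE hornerD hornerN hornerC hornerMn hornerX.
Qed.

Lemma ln_prod n (f : 'I_n -> R) : (forall k, 0 < f k) ->
  ln (\prod_k f k) = \sum_k ln (f k).
Proof.
move=> f0; elim: n f f0 => [|n IH] f f0; first by rewrite !big_ord0 ln1.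
rewrite !big_ord_recr /= lnM ?posrE// ?prodr_gt0// IH//.
Qed.

Lemma det_one_minus n (B : 'M[R]_n) (l : 'I_n -> R) :
  char_poly B = \prod_(k < n) ('X - (l k)%:P) -> \det (1%:M - B) = \prod_k (1 - l k).
Proof.
move=> H; rewrite -horner_char_poly H horner_prod.
by apply: eq_bigr => k _; rewrite hornerXsubC.
Qed.

Lemma det_one_plus n (B : 'M[R]_n) (l : 'I_n -> R) :
  char_poly B = \prod_(k < n) ('X - (l k)%:P) -> \det (1%:M + B) = \prod_k (1 + l k).
Proof.
move=> H; have : \det ((-1)%:M - B) = \prod_k (- (1 + l k)).
  rewrite -horner_char_poly H horner_prod.
  by apply: eq_bigr => k _; rewrite hornerXsubC opprD.
have -> : (-1)%:M - B = (-1) *: (1%:M + B).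
  by rewrite scaleN1r opprD; apply/matrixP => i j; rewrite !mxE mulNrn.
rewrite detZ prodrN card_ord => /(mulfI _); apply.
by rewrite expf_neq0// oppr_eq0 oner_neq0.
Qed.

(** arctanh l is half of ln (1 + l) - ln (1 - l), and the characteristic polynomial
    at 1 and -1 gives the products of the 1 - l k and 1 + l k as determinants.  The
    factor I cancels in the quotient; with it the matrices are the first and second
    forms, whose smoothness is clear, rather than B. *)
Lemma sum_arctanh n (B I : 'M[R]_n) (l : 'I_n -> R) : I \in unitmx ->
  char_poly B = \prod_(k < n) ('X - (l k)%:P) -> (forall k, -1 < l k < 1) ->
  [/\ 1%:M - B \in unitmx, 1%:M + B \in unitmx,
   0 < \det (I + B *m I) / \det (I - B *m I) &
   \sum_k arctanh (l k) = ln (\det (I + B *m I) / \det (I - B *m I)) / 2].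
Proof.
move=> Iu H l1; have Em := det_one_minus H; have Ep := det_one_plus H.
have p1 k : 0 < 1 + l k by have /andP[] := l1 k; lra.
have p2 k : 0 < 1 - l k by have /andP[] := l1 k; lra.
have dm : 0 < \det (1%:M - B) by rewrite Em prodr_gt0.
have dp : 0 < \det (1%:M + B) by rewrite Ep prodr_gt0.
have dI : \det I != 0 by rewrite -unitfE -unitmxE.
have E : \det (I + B *m I) / \det (I - B *m I) = \det (1%:M + B) / \det (1%:M - B).
  have -> : I + B *m I = (1%:M + B) *m I by rewrite mulmxDl mul1mx.
  have -> : I - B *m I = (1%:M - B) *m I by rewrite mulmxBl mul1mx.
  by rewrite !det_mulmx; field; rewrite dI gt_eqF.
split.
- by rewrite unitmxE unitfE gt_eqF.
- by rewrite unitmxE unitfE gt_eqF.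
- by rewrite E divr_gt0.
rewrite E Ep Em ln_div ?posrE ?prodr_gt0// !ln_prod// -sumrB mulr_suml.
by apply: eq_bigr => k _; rewrite /arctanh ln_div ?posrE.
Qed.

Lemma is_derive_lnf (V : normedModType R) (f : V -> R) q v df : 0 < f q ->
  is_derive q v f df -> is_derive q v (fun x => ln (f x)) (df / f q).
Proof.
move=> f0 fd; have [dl Dl] := is_derive1_ln f0.
have d : differentiable (@ln R) (f q) by apply/derivable1_diffP.
have := is_derive_chain d fd.
suff -> : 'D_df (@ln R) (f q) = df / f q by [].
have E : df *: (1 : R) = df := mulr1 df.
by rewrite -Dl -{1}E (derive_scale _ _ d).
Qed.

Lemma is_derive_det (V : normedModType R) n (F : V -> 'M[R]_n) q v X :
  is_derive q v F X -> is_derive q v (fun x => \det (F x)) (\tr (X *m \adj (F q))).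
Proof.
move=> FX; rewrite -derive_det; apply: (is_derive_chain (f := fun M => \det M)) => //.
by apply: differentiable_det; exact: ex_diff.
Qed.

Lemma is_derive_ln_det_ratio (V : normedModType R) n (F1 F2 : V -> 'M[R]_n) q v X1 X2 :
  is_derive q v F1 X1 -> is_derive q v F2 X2 ->
  F1 q \in unitmx -> F2 q \in unitmx -> 0 < \det (F1 q) / \det (F2 q) ->
  is_derive q v (fun x => ln (\det (F1 x) / \det (F2 x)))
    (\tr (X1 *m invmx (F1 q)) - \tr (X2 *m invmx (F2 q))).
Proof.
move=> h1 h2 u1 u2 r0.
have d1 : \det (F1 q) != 0 by rewrite -unitfE -unitmxE.
have d2 : \det (F2 q) != 0 by rewrite -unitfE -unitmxE.
have D1 := is_derive_det h1; have D2 := is_derive_det h2.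
have DV : is_derive q v (fun x => (\det (F2 x))^-1)
    (- (\det (F2 q)) ^- 2 * \tr (X2 *m \adj (F2 q))).
  split; first by apply: derivableV => //; case: D2.
  by rewrite deriveV//; case: D2 => _ ->.
have D := is_derive_mul D1 DV.
apply: (is_derive_eq (is_derive_lnf (f := fun x => \det (F1 x) / \det (F2 x)) r0 D)).
rewrite /invmx u1 u2 -!scalemxAr !mxtraceZ.
by field; rewrite d1 d2.
Qed.

End SymmetricFunction.

(** * Functions of space and time *)

Section Slices.
Context (R : realType) (n : nat) (W : normedModType R).
Local Notation V := ('rV[R]_n * R^o)%type.
Implicit Types (Phi : V -> W).

Definition hdir (w : 'rV[R]_n) : V := (w, 0).
Definition tdir : V := (0, 1).

Lemma derive_slice Phi w u (s : R) :
  'D_w (fun u' => Phi (u', s)) u = 'D_(hdir w) Phi (u, s).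
Proof.
have E : (fun h : R => h^-1 *: (((fun u' => Phi (u', s)) \o shift u) (h *: w) - Phi (u, s)))
   = (fun h : R => h^-1 *: ((Phi \o shift ((u, s) : V)) (h *: hdir w) - Phi (u, s))).
  apply/funext => h /=; congr (_ *: (Phi _ - _)); congr (_, _).
  by rewrite /= scaler0 add0r.
by rewrite /derive E.
Qed.

Lemma is_derive_time Phi u (s : R) d :
  is_derive ((u, s) : V) tdir Phi d -> is_derive s 1 (fun s' => Phi (u, s')) d.
Proof.
have E : (fun h : R => h^-1 *: (((fun s' => Phi (u, s')) \o shift s) (h *: (1 : R)) - Phi (u, s)))
   = (fun h : R => h^-1 *: ((Phi \o shift ((u, s) : V)) (h *: tdir) - Phi (u, s))).
  apply/funext => h /=; congr (_ *: (Phi _ - _)); congr (_, _).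
  by rewrite /= scaler0 add0r.
by move=> [hd hv]; split; [rewrite /derivable E|rewrite /derive E].
Qed.

Lemma differentiable_slice Phi u (s : R) : differentiable Phi ((u, s) : V) ->
  differentiable (fun u' => Phi (u', s)) u.
Proof.
by move=> d; apply: (@differentiable_comp _ _ _ _ (fun u' => (u', s) : V) Phi).
Qed.

Lemma near_slice (Q : V -> Prop) u (s : R) : (\forall z \near ((u, s) : V), Q z) ->
  \forall u' \near u, Q (u', s).
Proof.
have d : differentiable (fun u' : 'rV[R]_n => (u', s) : V) u.
  apply: (@differentiable_pair _ _ _ _ id (cst (s : R^o))); first exact: ex_diff.
  exact: differentiable_cst.
exact: (near_compose (Q := Q) (differentiable_continuous d)).
Qed.

End Slices.

(** * Evolution of the hypersurface and of its Gauss map *)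

Section Evolution.
Context (R : realType) (n : nat).
Local Notation V := ('rV[R]_n * R^o)%type.
Context (U : set 'rV[R]_n) (Uo : open U) (eps : R) (o : bool).
Context (F N : V -> 'rV[R]_(n.+2)) (B : V -> 'M[R]_n) (lambda : V -> 'I_n -> R).
Implicit Types (z : V) (w : 'rV[R]_n) (i j m : 'I_n).

Definition spacetime : set V := [set z | U z.1 /\ - eps < z.2 < eps].
Definition frame z : 'M[R]_(n, n.+2) := \matrix_(i < n) 'D_(hdir (ebase R i)) F z.
Local Notation O := spacetime.

Context (hF : smooth_on O F).
Context (hH : forall z, O z -> mink (F z) (F z) = -1).
Context (hN : forall z, O z -> [/\ mink (F z) (N z) = 0, mink (N z) (N z) = 1,
  (forall w, mink ('D_(hdir w) F z) (N z) = 0) &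
  0 < (-1) ^+ o * \det (col_mx (col_mx (N z) (F z)) (frame z))]).
Context (hB : forall z w, O z ->
  'D_(hdir (w *m B z)) F z = - tanproj (F z) ('D_(hdir w) N z)).

Lemma open_spacetime : open O.
Proof.
have -> : O = (fst @^-1` U) `&` (snd @^-1` [set s : R^o | - eps < s < eps]).
  by apply/seteqP; split.
apply: openI.
  by apply: open_comp => // z _; exact: cvg_fst.
apply: open_comp => [z _|]; first exact: cvg_snd.
have -> : [set s : R^o | - eps < s < eps] = [set` `]- eps, eps[].
  by apply/seteqP; split => s /=; rewrite in_itv.
exact: interval_open.
Qed.

Lemma dF z : O z -> differentiable F z.
Proof. by have [d _] := hF 1; exact: d. Qed.

Lemma smooth_dF v : smooth_on O (fun z => 'D_v F z).
Proof. by move=> k; have [_ D] := hF k.+1; exact: D. Qed.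

Lemma frame_row z i : row i (frame z) = 'D_(hdir (ebase R i)) F z.
Proof. by rewrite rowK. Qed.

Lemma hdir_sum w : hdir w = \sum_i w 0 i *: hdir (ebase R i).
Proof.
have S (r : seq 'I_n) : \sum_(i <- r) w 0 i *: hdir (ebase R i) =
    hdir (\sum_(i <- r) w 0 i *: ebase R i).
  elim: r => [|i r IH]; first by rewrite !big_nil.
  rewrite !big_cons IH /hdir; congr (_, _) => /=; by rewrite scaler0 addr0.
by rewrite S -row_sum_ebase.
Qed.

Lemma derive_hdir (W : normedModType R) (Phi : V -> W) z w : differentiable Phi z ->
  'D_(hdir w) Phi z = \sum_i w 0 i *: 'D_(hdir (ebase R i)) Phi z.
Proof. by move=> d; rewrite hdir_sum derive_lincomb. Qed.

Lemma dF_frame z w : O z -> 'D_(hdir w) F z = w *m frame z.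
Proof.
move=> Oz; rewrite (derive_hdir _ (dF Oz)) mulmx_sum_row.
by apply: eq_bigr => i _; rewrite frame_row.
Qed.

Lemma smooth_frame : smooth_on O frame.
Proof.
move=> k; apply: (Ck_on_mx open_spacetime) => i j.
refine (eq_Ck_on open_spacetime _
  (Ck_on_entry open_spacetime 0 j (smooth_dF (hdir (ebase R i)) k))) => z _.
by rewrite -frame_row mxE.
Qed.

Lemma derive_eq_on (W : normedModType R) (f g : V -> W) z v : O z ->
  (forall z', O z' -> f z' = g z') -> 'D_v f z = 'D_v g z.
Proof.
move=> Oz fg; apply: near_eq_derive.
by apply: filterS (near_open open_spacetime Oz) => y; exact: fg.
Qed.

Lemma derive_mink (f g : V -> 'rV[R]_(n.+2)) z v (k : R) : O z ->
  differentiable f z -> differentiable g z ->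
  (forall z', O z' -> mink (f z') (g z') = k) ->
  mink ('D_v f z) (g z) + mink (f z) ('D_v g z) = 0.
Proof.
move=> Oz df dg fg.
have [_ <-] := is_derive_mink (is_diff_derive v df) (is_diff_derive v dg).
by rewrite (derive_eq_on (g := cst k) v Oz fg) derive_cst.
Qed.

Lemma frame_F z i : O z -> mink (row i (frame z)) (F z) = 0.
Proof.
move=> Oz; rewrite frame_row.
have := derive_mink (hdir (ebase R i)) Oz (dF Oz) (dF Oz) hH.
rewrite [mink (F z) _]minkC; move: (mink _ _) => x; lra.
Qed.

Lemma frame_N z i : O z -> mink (row i (frame z)) (N z) = 0.
Proof. by move=> Oz; have [_ _ H _] := hN Oz; rewrite frame_row H. Qed.

Lemma smooth_N : smooth_on O N.
Proof.
apply: (smooth_unit_normal open_spacetime (o := o) hF smooth_frame).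
- by move=> z Oz; have [h1 h2 _ _] := hN Oz; split; [exact: hH|].
- by move=> z i Oz; split; [exact: frame_F|exact: frame_N].
- by move=> z Oz; have [_ _ _ h] := hN Oz.
Qed.

Lemma dN z : O z -> differentiable N z.
Proof. by have [d _] := smooth_N 1; exact: d. Qed.

Lemma ddF v z : O z -> differentiable (fun z => 'D_v F z) z.
Proof. by have [d _] := smooth_dF v 1; exact: d. Qed.

Lemma ddN v z : O z -> differentiable (fun z => 'D_v N z) z.
Proof. by move=> Oz; have [_ D] := smooth_N 2; have [d _] := D v; exact: d. Qed.

Lemma swapF v v' z : O z ->
  'D_v (fun z => 'D_v' F z) z = 'D_v' (fun z => 'D_v F z) z.
Proof.
move=> Oz; apply: derive_swap; try exact: ddF.
by apply: filterS (near_open open_spacetime Oz) => y; exact: dF.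
Qed.

Lemma swapN v v' z : O z ->
  'D_v (fun z => 'D_v' N z) z = 'D_v' (fun z => 'D_v N z) z.
Proof.
move=> Oz; apply: derive_swap; try exact: ddN.
by apply: filterS (near_open open_spacetime Oz) => y; exact: dN.
Qed.

Lemma dN_F z w : O z -> mink ('D_(hdir w) N z) (F z) = 0.
Proof.
move=> Oz; have := derive_mink (hdir w) Oz (dF Oz) (dN Oz) (k := 0).
move=> /(_ _)H; have := H (fun z' Oz' => let: And4 h _ _ _ := hN Oz' in h).
have [_ _ h _] := hN Oz; rewrite h add0r minkC; exact.
Qed.

Lemma dN_N z v : O z -> mink ('D_v N z) (N z) = 0.
Proof.
move=> Oz.
have := derive_mink v Oz (dN Oz) (dN Oz) (fun z' Oz' => let: And4 _ h _ _ := hN Oz' in h).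
rewrite [mink (N z) _]minkC; move: (mink _ _) => x; lra.
Qed.

Lemma weingarten z w : O z -> 'D_(hdir w) N z = - (w *m B z *m frame z).
Proof.
move=> Oz; rewrite -(dF_frame _ Oz) hB// opprK /tanproj (dN_F _ Oz).
by rewrite scale0r addr0.
Qed.

Definition first_form_mx z : 'M[R]_n :=
  \matrix_(i, j) mink ('D_(hdir (ebase R i)) F z) ('D_(hdir (ebase R j)) F z).
Definition second_form_mx z : 'M[R]_n :=
  \matrix_(i, j) - mink ('D_(hdir (ebase R i)) N z) ('D_(hdir (ebase R j)) F z).

Lemma first_form_gram z : first_form_mx z = gram (frame z) (frame z).
Proof. by apply/matrixP => i j; rewrite gramE !frame_row mxE. Qed.

Lemma second_formE z : O z -> B z *m first_form_mx z = second_form_mx z.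
Proof.
move=> Oz; rewrite first_form_gram -gram_mull; apply/matrixP => i j.
rewrite gramE frame_row [RHS]mxE (weingarten _ Oz) minkNl opprK.
by rewrite row_mul rowE.
Qed.

(** Differentiating <nu, sigma_j> = 0 along e_i shows that the left side is
    - <nu, sigma_ij>. *)
Lemma second_form_sym z i j : O z ->
  mink ('D_(hdir (ebase R i)) N z) ('D_(hdir (ebase R j)) F z) =
  mink ('D_(hdir (ebase R j)) N z) ('D_(hdir (ebase R i)) F z).
Proof.
move=> Oz.
have H k l : mink ('D_(hdir (ebase R k)) N z) ('D_(hdir (ebase R l)) F z) =
    - mink (N z) ('D_(hdir (ebase R k)) (fun z => 'D_(hdir (ebase R l)) F z) z).
  have E (z' : V) : O z' -> mink (N z') ('D_(hdir (ebase R l)) F z') = 0.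
    by move=> Oz'; have [_ _ h _] := hN Oz'; rewrite minkC.
  have := derive_mink (hdir (ebase R k)) Oz (dN Oz) (ddF (hdir (ebase R l)) Oz) E.
  by move=> /eqP; rewrite addr_eq0 => /eqP.
apply: etrans (H i j) _; apply: etrans _ (esym (H j i)).
exact: (congr1 (fun y => - mink (N z) y) (swapF _ _ Oz)).
Qed.

Lemma det_frame z : O z -> \det (col_mx (col_mx (N z) (F z)) (frame z)) != 0.
Proof.
by move=> Oz; have [_ _ _] := hN Oz; apply: contraTneq => ->; rewrite mulr0 ltxx.
Qed.

Lemma first_form_unit z : O z -> first_form_mx z \in unitmx.
Proof.
move=> Oz; rewrite first_form_gram; have [h1 h2 _ _] := hN Oz.
apply: (first_gram_unit (x := F z) (v := N z)); last exact: det_frame.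
- by move=> i; exact: frame_F.
- by move=> i; exact: frame_N.
Qed.

Context (hl : forall z, O z -> char_poly (B z) = \prod_(k < n) ('X - (lambda z k)%:P)).
Context (hsmall : forall z k, O z -> -1 < lambda z k < 1).

Local Notation D i := (hdir (ebase R i)).
Local Notation tdir := (tdir R n).

Definition speed z : R := n%:R^-1 * \sum_(k < n) arctanh (lambda z k).

Lemma shape_units z : O z ->
  [/\ 1%:M - B z \in unitmx, 1%:M + B z \in unitmx,
   0 < \det (first_form_mx z + second_form_mx z) / \det (first_form_mx z - second_form_mx z) &
   speed z = n%:R^-1 * (ln (\det (first_form_mx z + second_form_mx z)
       / \det (first_form_mx z - second_form_mx z)) * 2^-1)].
Proof.
move=> Oz; have := sum_arctanh (first_form_unit Oz) (hl Oz) (fun k => hsmall k Oz).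
by rewrite (second_formE Oz) => -[h1 h2 h3 h4]; split=> //; rewrite /speed h4.
Qed.

Definition dframe_gram m z : 'M[R]_n :=
  \matrix_(k, l) mink ('D_(D m) (fun z => 'D_(D k) F z) z) ('D_(D l) F z).

Definition dsecond_form m z : 'M[R]_n :=
  \matrix_(k, l) - (mink ('D_(D m) (fun z => 'D_(D k) N z) z) ('D_(D l) F z) +
                    mink ('D_(D k) N z) ('D_(D m) (fun z => 'D_(D l) F z) z)).

Lemma is_derive_first_form m z : O z ->
  is_derive z (D m) first_form_mx (dframe_gram m z + (dframe_gram m z)^T).
Proof.
move=> Oz; apply: is_derive_mx => i j.
have H := is_derive_mink (is_diff_derive (D m) (ddF (D i) Oz)) (is_diff_derive (D m) (ddF (D j) Oz)).
rewrite [X in is_derive _ _ _ X](_ : _ = mink ('D_(D m) (fun z => 'D_(D i) F z) z) ('D_(D j) F z) +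
   mink ('D_(D i) F z) ('D_(D m) (fun z => 'D_(D j) F z) z)); last first.
  apply: etrans (mxE _ _ _ _) _; apply: (congr2 +%R); first exact: mxE.
  apply: etrans (mxE _ _ _ _) _; apply: etrans (mxE _ _ _ _) _; exact: minkC.
by apply: is_derive_ext H => q; apply: esym; exact: mxE.
Qed.

Lemma is_derive_second_form m z : O z ->
  is_derive z (D m) second_form_mx (dsecond_form m z).
Proof.
move=> Oz; apply: is_derive_mx => i j.
have H := is_deriveN (is_derive_mink (is_diff_derive (D m) (ddN (D i) Oz))
   (is_diff_derive (D m) (ddF (D j) Oz))).
have E : dsecond_form m z i j = _ := mxE _ _ _ _.
rewrite E.
by apply: is_derive_ext H => q; apply: esym; exact: mxE.
Qed.

(** The derivative of the speed as Jacobi's formula gives it. *)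
Definition dspeed m z : R := n%:R^-1 *
  ((\tr ((dframe_gram m z + (dframe_gram m z)^T + dsecond_form m z) *m
        invmx (first_form_mx z + second_form_mx z)) -
    \tr ((dframe_gram m z + (dframe_gram m z)^T - dsecond_form m z) *m
        invmx (first_form_mx z - second_form_mx z))) * 2^-1).

Lemma second_form_tr z : O z -> (B z *m first_form_mx z)^T = B z *m first_form_mx z.
Proof.
move=> Oz; rewrite (second_formE Oz); apply/matrixP => i j.
apply: etrans (mxE _ _ _ _) _; apply: etrans (mxE _ _ _ _) _.
apply: etrans _ (esym (mxE _ _ _ _)).
exact: (congr1 -%R (second_form_sym j i Oz)).
Qed.

Lemma is_derive_speed m z : O z -> is_derive z (D m) speed (dspeed m z).
Proof.
move=> Oz; have [h1 h2 h3 _] := shape_units Oz.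
have Iu := first_form_unit Oz.
have u1 : first_form_mx z + second_form_mx z \in unitmx.
  by rewrite -(second_formE Oz); exact: add_gram_unit.
have u2 : first_form_mx z - second_form_mx z \in unitmx.
  by rewrite -(second_formE Oz); exact: sub_gram_unit.
have d1 := is_deriveD (is_derive_first_form m Oz) (is_derive_second_form m Oz).
have d2 := is_deriveB (is_derive_first_form m Oz) (is_derive_second_form m Oz).
have L := is_derive_ln_det_ratio d1 d2 u1 u2 h3.
have K := is_derive_mul (is_derive_cst (n%:R^-1 : R) z (D m))
  (is_derive_mul L (is_derive_cst (2^-1 : R) z (D m))).
have A (b c d e f : R) : 0 * e + b * (c * d + f * 0) = b * (c * d) by ring.
have {}K := is_derive_eq K (A _ _ _ _ _).
apply: near_eq_is_derive K; apply: filterS (near_open open_spacetime Oz) => q Oq.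
by have [_ _ _ ->] := shape_units Oq.
Qed.

Lemma mink_dN_expand z j (y : 'rV[R]_(n.+2)) : O z ->
  mink y ('D_(D j) N z) = - \sum_k B z j k * mink y ('D_(D k) F z).
Proof.
move=> Oz; rewrite (weingarten _ Oz) minkNr minkC mink_mulmx; congr (- _).
apply: eq_bigr => k _; rewrite frame_row minkC; congr (_ * _).
by rewrite /ebase -rowE mxE.
Qed.

Lemma codazzi_rearrange (fij nij fim nim Fm Fj Nm Nj : 'rV[R]_(n.+2)) :
  mink nij Fm + mink Nj fim = mink nim Fj + mink Nm fij ->
  mink fij Nm - mink nij Fm = mink fim Nj - mink nim Fj.
Proof.
rewrite (minkC fij) (minkC fim).
by move: (mink nij Fm) (mink Nj fim) (mink nim Fj) (mink Nm fij) => a b c d; lra.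
Qed.

(** The Codazzi equation: differentiate the symmetry of the second form along e_i and
    exchange the order of derivatives of sigma and nu. *)
Lemma codazzi z i j m : O z ->
  mink ('D_(D i) (fun z => 'D_(D j) F z) z) ('D_(D m) N z) -
  mink ('D_(D i) (fun z => 'D_(D j) N z) z) ('D_(D m) F z) =
  mink ('D_(D m) (fun z => 'D_(D i) F z) z) ('D_(D j) N z) -
  mink ('D_(D m) (fun z => 'D_(D i) N z) z) ('D_(D j) F z).
Proof.
move=> Oz.
have H1 := is_derive_mink (is_diff_derive (D i) (ddN (D j) Oz)) (is_diff_derive (D i) (ddF (D m) Oz)).
have H2 := is_derive_mink (is_diff_derive (D i) (ddN (D m) Oz)) (is_diff_derive (D i) (ddF (D j) Oz)).
have E : mink ('D_(D i) (fun z => 'D_(D j) N z) z) ('D_(D m) F z) +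
     mink ('D_(D j) N z) ('D_(D i) (fun z => 'D_(D m) F z) z) =
   mink ('D_(D i) (fun z => 'D_(D m) N z) z) ('D_(D j) F z) +
     mink ('D_(D m) N z) ('D_(D i) (fun z => 'D_(D j) F z) z).
  have [_ v1] := H1; have [_ v2] := H2.
  apply: etrans (esym v1) (etrans _ v2).
  by apply: (derive_eq_on _ Oz) => q Oq; exact: second_form_sym.
have sF := swapF (D m) (D i) Oz; have sN := swapN (D m) (D i) Oz.
apply: etrans _ (esym (congr2 (fun a b => mink a ('D_(D j) N z) - mink b ('D_(D j) F z)) sF sN)).
exact: codazzi_rearrange E.
Qed.

(** Weingarten's formula for the first derivatives of nu makes the cubic form an
    expression in derivatives of the first and second forms. *)
Lemma codazzi_mx z i j m : O z ->
  mink ('D_(D m) (fun z => 'D_(D i) F z) z) ('D_(D j) N z) -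
  mink ('D_(D m) (fun z => 'D_(D i) N z) z) ('D_(D j) F z) =
  (dsecond_form m z - dframe_gram m z *m (B z)^T - B z *m (dframe_gram m z)^T) i j.
Proof.
move=> Oz.
have e1 : (dframe_gram m z *m (B z)^T) i j =
    - mink ('D_(D m) (fun z => 'D_(D i) F z) z) ('D_(D j) N z).
  rewrite (mink_dN_expand _ _ Oz) opprK; apply: etrans (mxE _ _ _ _) _.
  apply: eq_bigr => k _; apply: etrans (mulrC _ _) _; apply: (congr2 *%R); exact: mxE.
have e2 : (B z *m (dframe_gram m z)^T) i j =
    - mink ('D_(D i) N z) ('D_(D m) (fun z => 'D_(D j) F z) z).
  apply: etrans _ (congr1 -%R (minkC _ _)).
  rewrite (mink_dN_expand _ _ Oz) opprK; apply: etrans (mxE _ _ _ _) _.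
  apply: eq_bigr => k _; apply: (congr1 ( *%R _)).
  by apply: etrans (mxE _ _ _ _) _; exact: mxE.
have e3 : dsecond_form m z i j = _ := mxE _ _ _ _.
have E (X Y Z : 'M[R]_n) : (X - Y - Z) i j = X i j - Y i j - Z i j by rewrite !mxE.
have A (a b c : R) : a - b = - (b + c) - - a - - c by ring.
apply: etrans (A _ _ _) (esym _).
by apply: etrans (E _ _ _) _; rewrite e1 e2 e3.
Qed.

(** The heart of the matter: the trace of the cubic form, hence the mean curvature of
    the Gauss map, is the differential of the speed. *)
Lemma dspeed_trace z m : O z ->
  n%:R^-1 * (\sum_i \sum_j invmx (gauss_gram (first_form_mx z) (B z)) i j *
    (mink ('D_(D i) (fun z => 'D_(D j) F z) z) ('D_(D m) N z) -
     mink ('D_(D i) (fun z => 'D_(D j) N z) z) ('D_(D m) F z))) = dspeed m z.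
Proof.
move=> Oz; have [h1 h2 h3 _] := shape_units Oz.
have Iu := first_form_unit Oz.
have IT : (first_form_mx z)^T = first_form_mx z by rewrite first_form_gram gramT.
have BI := second_form_tr Oz.
rewrite /dspeed; apply: (congr1 ( *%R _)).
have T := trace_identity (dframe_gram m z) (dsecond_form m z) Iu IT BI h1 h2.
rewrite (second_formE Oz) in T; apply: etrans _ (etrans T (mulrC _ _)).
set K := invmx _; set C := dsecond_form m z - _ - _.
have KT : K^T = K by rewrite /K trmx_inv (gauss_gramT (B z) IT).
have -> : \tr (K *m C) = \sum_i \sum_j K i j * C i j.
  rewrite exchange_big; apply: eq_bigr => j _; rewrite mxE; apply: eq_bigr => i _.
  by rewrite -[in LHS]KT mxE.
apply: eq_bigr => i _; apply: eq_bigr => j _; apply: (congr1 ( *%R _)).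
exact: etrans (codazzi i j m Oz) (codazzi_mx i j m Oz).
Qed.

Context (hpos : forall z, O z -> 0 < F z 0 ord_max).
Context (hflow : forall z, O z -> 'D_tdir F z = speed z *: N z).

Lemma T1H_lift z : O z -> T1H (F z, N z).
Proof.
by move=> Oz; have [h1 h2 _ _] := hN Oz; split => //; split; [exact: hH|exact: hpos].
Qed.

(** Differentiate <nu, sigma_i> = 0 in time, where sigma_ti is the derivative of
    speed * nu along e_i and nu_i is orthogonal to nu. *)
Lemma dN_time z i : O z -> mink ('D_tdir N z) ('D_(D i) F z) = - dspeed i z.
Proof.
move=> Oz; have [h1 h2 h3 _] := hN Oz.
have E z' : O z' -> mink (N z') ('D_(D i) F z') = 0.
  by move=> Oz'; have [_ _ h _] := hN Oz'; rewrite minkC.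
have H := derive_mink tdir Oz (dN Oz) (ddF (D i) Oz) E.
have sw : 'D_tdir (fun z => 'D_(D i) F z) z = dspeed i z *: N z + speed z *: 'D_(D i) N z.
  apply: etrans (swapF _ _ Oz) _.
  apply: etrans (derive_eq_on (D i) Oz hflow) _.
  by have [_ v] := is_derive_scalef (is_derive_speed i Oz) (is_diff_derive (D i) (dN Oz)).
have K : mink (N z) ('D_tdir (fun z => 'D_(D i) F z) z) = dspeed i z.
  rewrite sw minkDr !minkZr h2 mulr1.
  by rewrite [mink (N z) _]minkC (dN_N _ Oz) mulr0 addr0.
by move/eqP: H; rewrite K addr_eq0 => /eqP.
Qed.

Lemma dN_time_F z : O z -> mink ('D_tdir N z) (F z) = - speed z.
Proof.
move=> Oz; have [h1 h2 _ _] := hN Oz.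
have E z' : O z' -> mink (N z') (F z') = 0.
  by move=> Oz'; have [h _ _ _] := hN Oz'; rewrite minkC.
have H := derive_mink tdir Oz (dN Oz) (dF Oz) E.
rewrite (hflow Oz) minkZr h2 mulr1 in H.
by move/eqP: H; rewrite addr_eq0 => /eqP.
Qed.

(** Minus the gradient of the speed for the metric induced by the Gauss map. *)
Definition tangent_coeff z : 'rV[R]_n :=
  - (\row_m dspeed m z) *m invmx (gauss_gram (first_form_mx z) (B z)).

(** The products of nu_t with nu, sigma and the sigma_i are known.  Since the induced
    metric is (1 - B^2) I, the coefficients W - B^2 W are minus the gradient of the
    speed for the first form I. *)
Lemma dN_time_eq z : O z -> 'D_tdir N z =
  speed z *: F z + (tangent_coeff z - tangent_coeff z *m B z *m B z) *m frame z.
Proof.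
move=> Oz; have [h1 h2 _ _] := hN Oz.
have NF : mink (N z) (F z) = 0 by rewrite minkC.
have [u1 u2 _ _] := shape_units Oz.
have IT : (first_form_mx z)^T = first_form_mx z by rewrite first_form_gram gramT.
have BI := second_form_tr Oz; have Iu := first_form_unit Oz.
set W := tangent_coeff z; set c := W - _.
have Fe i := frame_F i Oz; have Ne i := frame_N i Oz.
apply/eqP; rewrite -subr_eq0; apply/eqP.
apply: (frame_nondegenerate (x := F z) (v := N z) (e := frame z) (det_frame Oz)).
- rewrite minkDl minkNl minkDl minkZl h1 (mink_ev Ne) mulr0 addr0 subr0.
  exact: dN_N.
- rewrite minkDl minkNl minkDl minkZl (hH Oz) (mink_ex Fe) addr0.
  by rewrite (dN_time_F Oz); ring.
move=> i; rewrite minkDl minkNl minkDl minkZl [mink (F z) _]minkC Fe mulr0 add0r.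
rewrite {1}frame_row (dN_time i Oz) -gram1r gram_mull -first_form_gram.
have -> : c *m first_form_mx z = - \row_m dspeed m z.
  have E1 : W *m B z *m B z *m first_form_mx z = W *m (B z *m (B z *m first_form_mx z)).
    by rewrite -[LHS]mulmxA -[LHS]mulmxA.
  rewrite /c mulmxBl E1.
  have -> : W *m first_form_mx z - W *m (B z *m (B z *m first_form_mx z)) =
      W *m gauss_gram (first_form_mx z) (B z).
    have IBT : first_form_mx z *m (B z)^T = B z *m first_form_mx z.
      by rewrite -{1}IT -trmx_mul BI.
    by rewrite /gauss_gram mulmxBr -(mulmxA (B z) _ (B z)^T) IBT.
  by rewrite /W mulmxKV// gauss_gram_unit.
by rewrite !mxE subrr.
Qed.

Section Geodesics.
Context (phi : chart R (n + n) (set (ambient2 R n))) (hphi : geodesic_chart phi).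
Context (Gam : connection_on R (n + n)).
Context (hGam : levi_civita (cimg phi) (gmetric phi) Gam).
Context (u0 : 'rV[R]_n) (t : R).
Let z0 : V := (u0, t).
Context (Oz0 : O z0) (cz : in_chart phi (F z0, N z0)).
Context (G : 'rV[R]_n -> 'rV[R]_(n + n)).
Context (hG : forall u, G u = cmap phi (gproj (F (u, t), N (u, t)))).

Let zeta u : ambient2 R n := (F (u, t), N (u, t)).
Local Notation P := (geodesic_coord phi).

Let near_O : \forall u \near u0, O (u, t).
Proof. by apply: (near_slice (s := t)); exact: (near_open open_spacetime Oz0). Qed.

Let zeta_diff : \forall u \near u0, differentiable zeta u.
Proof.
apply: filterS near_O => u Ou; apply: differentiable_pair.
  by apply: differentiable_slice; exact: dF.
by apply: differentiable_slice; exact: dN.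
Qed.

Let dzetaE w : \forall u \near u0,
  ('D_(hdir w) F (u, t), 'D_(hdir w) N (u, t)) = 'D_w zeta u.
Proof.
apply: filterS near_O => u Ou.
have d1 := is_diff_derive w (differentiable_slice (dF Ou)).
have d2 := is_diff_derive w (differentiable_slice (dN Ou)).
by have [_ ->] := is_derive_pair d1 d2; rewrite !derive_slice.
Qed.

Let zeta_ddiff w : differentiable (fun u => 'D_w zeta u) u0.
Proof.
apply: near_eq_differentiable (dzetaE w) _; apply: differentiable_pair.
  exact: (differentiable_slice (Phi := fun z => 'D_(hdir w) F z) (ddF (hdir w) Oz0)).
exact: (differentiable_slice (Phi := fun z => 'D_(hdir w) N z) (ddN (hdir w) Oz0)).
Qed.

Let ddzetaE v w : 'D_v (fun u => 'D_w zeta u) u0 =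
  ('D_(hdir v) (fun z => 'D_(hdir w) F z) z0, 'D_(hdir v) (fun z => 'D_(hdir w) N z) z0).
Proof.
have d1 := is_diff_derive v (differentiable_slice (ddF (hdir w) Oz0)).
have d2 := is_diff_derive v (differentiable_slice (ddN (hdir w) Oz0)).
have [_ e] := near_eq_is_derive (dzetaE w) (is_derive_pair d1 d2).
apply: etrans e _; apply: (congr2 pair).
  exact: (derive_slice (fun z => 'D_(hdir w) F z)).
exact: (derive_slice (fun z => 'D_(hdir w) N z)).
Qed.

Let I := first_form_mx z0.
Let e := frame z0.
Let B0 := B z0.
Let W := tangent_coeff z0.

Let dzeta0 w : 'D_w zeta u0 = tanlift e B0 w.
Proof.
apply: etrans (esym (nbhs_singleton (dzetaE w))) _; apply: (congr2 pair).
  exact: dF_frame.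
exact: weingarten.
Qed.

Let Tz0 := T1H_lift Oz0.
Let Fe i := frame_F i Oz0.
Let Ne i := frame_N i Oz0.

Let zeta_horver w : horver (zeta u0) ('D_w zeta u0).
Proof. by rewrite dzeta0; apply: horver_tanlift. Qed.

Let zeta_T1H : \forall u \near u0, T1H (zeta u).
Proof. by apply: filterS near_O => u Ou; exact: T1H_lift. Qed.

Let dG w : 'D_w G u0 = dproj phi (zeta u0) (tanlift e B0 w).
Proof. by rewrite -dzeta0; exact: (derive_G0 hphi zeta_diff zeta_T1H cz hG). Qed.

Let Q i j : ambient2 R n :=
  ('D_(D i) (fun z => 'D_(D j) F z) z0, 'D_(D i) (fun z => 'D_(D j) N z) z0).

Let cov i j : cov_deriv Gam G (ebase R i) (ebase R j) u0 = dproj phi (zeta u0) (Q i j).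
Proof.
apply: etrans (cov_deriv_G hphi hGam zeta_diff zeta_ddiff zeta_T1H cz zeta_horver hG _ _) _.
exact: (congr1 (dproj phi (zeta u0)) (ddzetaE _ _)).
Qed.

Let Gu0 : G u0 = P (zeta u0).
Proof. by rewrite hG (coord_T1H _ Tz0). Qed.

Let metric_lift a b : horver (zeta u0) b ->
  gmetric phi (G u0) (dproj phi (zeta u0) a) (dproj phi (zeta u0) b) = kform a b.
Proof.
move=> hb; rewrite Gu0; apply: etrans (gmetric_dproj hphi a b cz) _.
by rewrite (hor_id hb) (kform_hor _ hb).
Qed.

Let first_formE : first_form (gmetric phi) G u0 = gauss_gram I B0.
Proof.
apply/matrixP => i j; apply: etrans (mxE _ _ _ _) _.
rewrite (dG (ebase R i)) (dG (ebase R j)).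
apply: etrans (metric_lift _ _) _; first by apply: horver_tanlift.
exact: (kform_tanlift_ebase B0 (first_form_gram z0) i j).
Qed.

Let dproj_sum (J : Type) (r : seq J) (k : J -> R) (a : J -> ambient2 R n) :
  dproj phi (zeta u0) (\sum_(i <- r) k i *: a i) =
  \sum_(i <- r) k i *: dproj phi (zeta u0) (a i).
Proof. exact: derive_lincomb (coord_diff hphi (in_chart_tube cz)). Qed.

Let normal_partE a : normal_part (gmetric phi) G u0 (dproj phi (zeta u0) a) =
  dproj phi (zeta u0) (normal_lift e B0 I a).
Proof.
rewrite /normal_part /normal_lift first_formE.
rewrite -scaleN1r addrC -[in RHS]scaleN1r [in RHS]addrC (dproj_lin hphi _ _ _ cz).
apply: (congr1 (fun x => -1 *: x + dproj phi (zeta u0) a)).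
have S k : \sum_l (invmx (gauss_gram I B0) k l * kform a (tanlift e B0 (ebase R k))) *: tanlift e B0 (ebase R l)
   = 1 *: \sum_l (invmx (gauss_gram I B0) k l * kform a (tanlift e B0 (ebase R k))) *: tanlift e B0 (ebase R l).
  by rewrite scale1r.
under [in RHS]eq_bigr do rewrite S.
rewrite dproj_sum; apply: eq_bigr => k _; rewrite scale1r dproj_sum.
apply: eq_bigr => l _; rewrite (dG (ebase R l)) (dG (ebase R k)) metric_lift//.
by apply: horver_tanlift.
Qed.

Let mean_curvatureE : mean_curvature (gmetric phi) Gam G u0 =
  dproj phi (zeta u0) (mean_lift e B0 I Q n%:R^-1).
Proof.
rewrite /mean_curvature /mean_lift first_formE (dproj_scale hphi _ _ cz).
apply: (congr1 ( *:%R _)).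
have S i : \sum_j invmx (gauss_gram I B0) i j *: normal_lift e B0 I (Q i j)
  = 1 *: \sum_j invmx (gauss_gram I B0) i j *: normal_lift e B0 I (Q i j).
  by rewrite scale1r.
under [in RHS]eq_bigr do rewrite S.
rewrite dproj_sum; apply: eq_bigr => i _; rewrite scale1r dproj_sum.
apply: eq_bigr => j _; apply: (congr1 ( *:%R _)).
by rewrite /second_form cov normal_partE.
Qed.

(** The mean curvature vector is J dG(W): computed upstairs, it is dP of the mean
    lift, which may be replaced by its horizontal part. *)
Lemma mean_curvature_tanlift : mean_curvature (gmetric phi) Gam G u0 =
  dproj phi (zeta u0) (swap (tanlift e B0 W)).
Proof.
rewrite mean_curvatureE -(dproj_hor hphi _ cz); apply: (congr1 (dproj phi (zeta u0))).
have [u1 u2 _ _] := shape_units Oz0.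
apply: (mean_lift_hor Tz0 Fe Ne (det_frame Oz0) (first_form_gram z0)
  (second_form_tr Oz0) u1 u2) => m.
rewrite [RHS]mxE -(dspeed_trace m Oz0); apply: (congr1 ( *%R _)).
apply: eq_bigr => i _; apply: eq_bigr => j _; apply: (congr1 ( *%R _)).
by rewrite (weingarten _ Oz0) (dF_frame _ Oz0).
Qed.

Let swapK (a : ambient2 R n) : swap (swap a) = a.
Proof. by case: a. Qed.

(** The velocity of (sigma, nu) is the sum of a multiple of the flow direction, of the
    lift of the mean curvature and of the lift of dG(BW). *)
Lemma gauss_map_evolution :
  let H := mean_curvature (gmetric phi) Gam G u0 in
  exists2 w : 'rV[R]_n, 'D_w G u0 = gJ phi (G u0) H &
    is_derive t 1 (fun s : R => P (F (u0, s), N (u0, s))) (H + 'D_(w *m B z0) G u0).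
Proof.
move=> H; exists W; rewrite /H mean_curvature_tanlift dG.
  rewrite Gu0; apply: esym; apply: etrans (gJ_dproj hphi cz _) _.
    by apply: horver_swap; apply: horver_tanlift.
  exact: (congr1 (dproj phi (zeta u0)) (swapK _)).
have d1 : is_derive t 1 (fun s : R => F (u0, s)) (speed z0 *: N z0).
  by apply: is_derive_time; rewrite -(hflow Oz0); exact: (is_diff_derive _ (dF Oz0)).
have d2 : is_derive t 1 (fun s : R => N (u0, s)) ('D_tdir N z0).
  by apply: is_derive_time; exact: (is_diff_derive _ (dN Oz0)).
have D := is_derive_chain (f := P) (coord_diff hphi (in_chart_tube cz)) (is_derive_pair d1 d2).
apply: is_derive_eq D _.
rewrite -(dproj_add hphi _ _ cz).
have E : (speed z0 *: N z0, 'D_tdir N z0) = speed z0 *: (N z0, F z0) +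
    (swap (tanlift e B0 W) + tanlift e B0 (W *m B z0)).
  rewrite (dN_time_eq Oz0); apply: (congr2 pair) => /=.
    by rewrite addNr addr0.
  by rewrite mulmxBl.
rewrite E; apply: etrans (dproj_lin hphi _ _ _ cz) _.
have A (x y : 'rV[R]_(n + n)) : x = 0 -> speed z0 *: x + y = y.
  by move=> ->; rewrite scaler0 add0r.
exact: A (dproj_flow_direction hphi cz).
Qed.

End Geodesics.

End Evolution.

Theorem corollary11p4p2 (R : realType) (n : nat) (hn : (0 < n)%N)
    (M : oriented_manifold R n) (o : bool) (eps : R) (heps : 0 < eps)
    (sigma nu : M -> R -> 'rV[R]_(n.+2))
    (B : chart R n M -> M -> R -> 'M[R]_n)
    (lambda : M -> R -> 'I_n -> R)
    (hsigma : smooth_family eps sigma)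
    (himm : forall c p t, atlas c -> cdom c p -> - eps < t < eps ->
       immersion_at c (sigma ^~ t) p)
    (hnu : forall c p t, atlas c -> cdom c p -> - eps < t < eps ->
       unit_normal_at o c (sigma ^~ t) (nu ^~ t) p)
    (hB : forall c p t, atlas c -> cdom c p -> - eps < t < eps ->
       shape_operator_at c (sigma ^~ t) (nu ^~ t) p (B c p t))
    (hlambda : forall c p t, atlas c -> cdom c p -> - eps < t < eps ->
       char_poly (B c p t) = \prod_(k < n) ('X - (lambda p t k)%:P))
    (hsmall : forall p t k, - eps < t < eps -> -1 < lambda p t k < 1)
    (hflow : forall p t, - eps < t < eps ->
       is_derive t 1 (sigma p)
         ((n%:R^-1 * \sum_(k < n) arctanh (lambda p t k)) *: nu p t)) :
  forall (p : M) (t : R) (c : chart R n M)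
    (phi : chart R (n + n) (set (ambient2 R n)))
    (Gam : connection_on R (n + n)),
  - eps < t < eps -> atlas c -> cdom c p ->
  geodesic_chart phi -> cdom phi (gauss_map sigma nu p t) ->
  levi_civita (cimg phi) (gmetric phi) Gam ->
  let G := gauss_coord sigma nu c phi t in
  let u := cmap c p in
  let H := mean_curvature (gmetric phi) Gam G u in
  exists2 W : 'rV[R]_n,
    'D_W G u = gJ phi (G u) H &
    is_derive t 1 (fun s => cmap phi (gauss_map sigma nu p s))
      (H + 'D_(W *m B c p t) G u).
Proof.
move=> p t c phi Gam ht hc hp hphi hcdom hGam G u H.
have [_ copen cK _ _] := atlas_charts hc.
pose F (z : 'rV[R]_n * R^o) : 'rV[R]_(n.+2) := sigma (cinv c z.1) z.2.
pose N (z : 'rV[R]_n * R^o) : 'rV[R]_(n.+2) := nu (cinv c z.1) z.2.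
pose Bz (z : 'rV[R]_n * R^o) : 'M[R]_n := B c (cinv c z.1) z.2.
pose la (z : 'rV[R]_n * R^o) := lambda (cinv c z.1) z.2.
pose O := spacetime (cimg c) eps.
have inv (z : 'rV[R]_n * R^o) : O z -> cdom c (cinv c z.1) /\ cmap c (cinv c z.1) = z.1.
  by move=> [[q cq <-] _]; rewrite cK.
have dFE (z : 'rV[R]_n * R^o) w : O z ->
    mderiv c (sigma ^~ z.2) (cinv c z.1) w = 'D_(hdir w) F z.
  move=> Oz; rewrite /mderiv (inv z Oz).2 [in RHS](surjective_pairing z).
  exact: (derive_slice F).
have dNE (z : 'rV[R]_n * R^o) w : O z ->
    mderiv c (nu ^~ z.2) (cinv c z.1) w = 'D_(hdir w) N z.
  move=> Oz; rewrite /mderiv (inv z Oz).2 [in RHS](surjective_pairing z).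
  exact: (derive_slice N).
have hF : smooth_on O F by exact: (hsigma.2 c hc).
have hyp z : O z -> hyperbolic (F z) by move=> [_ hz]; exact: hsigma.1.
have hH z : O z -> mink (F z) (F z) = -1 by move=> /hyp[].
have hpos z : O z -> 0 < F z 0 ord_max by move=> /hyp[].
have hN z : O z -> [/\ mink (F z) (N z) = 0, mink (N z) (N z) = 1,
    (forall w, mink ('D_(hdir w) F z) (N z) = 0) &
    0 < (-1) ^+ o * \det (col_mx (col_mx (N z) (F z)) (frame F z))].
  move=> Oz; have [q1 q2 q3 q4] := hnu c _ _ hc (inv z Oz).1 Oz.2.
  split; [exact: q1|exact: q2|move=> w|].
    exact: etrans (congr1 (fun y => mink y (N z)) (esym (dFE z w Oz))) (q3 w).
  have -> : frame F z = \matrix_(i < n) mderiv c (sigma^~ z.2) (cinv c z.1) (ebase R i).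
    by apply/row_matrixP => i; rewrite !rowK (dFE z _ Oz).
  exact: q4.
have hBz z w : O z ->
    'D_(hdir (w *m Bz z)) F z = - tanproj (F z) ('D_(hdir w) N z).
  move=> Oz; apply: etrans (esym (dFE z _ Oz)) _.
  apply: etrans (hB c _ _ hc (inv z Oz).1 Oz.2 w) _.
  exact: (congr1 (fun y => - tanproj (F z) y) (dNE z w Oz)).
have hla z : O z -> char_poly (Bz z) = \prod_(k < n) ('X - (la z k)%:P).
  by move=> Oz; exact: (hlambda c _ _ hc (inv z Oz).1 Oz.2).
have hsm z k : O z -> -1 < la z k < 1 by move=> [_ hz]; exact: hsmall.
have hfl z : O z -> 'D_(tdir R n) F z = speed la z *: N z.
  case: z => y s Oz.
  have d : is_derive (y, s) (tdir R n) F ('D_(tdir R n) F (y, s)).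
    by apply: is_diff_derive; have [d _] := hF 1; exact: d.
  have [_ v1] := is_derive_time d; have [_ v2] := hflow (cinv c y) s Oz.2.
  exact: etrans (esym v1) v2.
have Ou : O (u, t) by split => //; exists p.
have Fu s : F (u, s) = sigma p s by rewrite /F /= cK.
have Nu s : N (u, s) = nu p s by rewrite /N /= cK.
have Tz := T1H_lift hH hN hpos Ou.
have cz : in_chart phi (F (u, t), N (u, t)).
  by split => //; rewrite Fu Nu.
have hG y : G y = cmap phi (gproj (F (y, t), N (y, t))) by [].
have [w e1 e2] := gauss_map_evolution copen hF hH hN hBz hla hsm hpos hfl hphi hGam Ou cz hG.
exists w; first exact: e1.
have E : Bz (u, t) = B c p t by rewrite /Bz /= cK.
rewrite E in e2.
apply: near_eq_is_derive e2.
have nt : \forall s \near t, - eps < s < eps.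
  have : t \in `]- eps, eps[ by rewrite in_itv.
  by move=> /near_in_itvoo; apply: filterS => s; rewrite in_itv.
apply: filterS nt => s hs.
have Os : O (u, s) by split => //; exists p.
apply: etrans (coord_T1H phi (T1H_lift hH hN hpos Os)) _.
by rewrite Fu Nu.
Qed.
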